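(* Let $p$ be a positive real number, let $U,V\subset\mathbb{C}$ be bounded domains, let $g:U\to\mathbb{C}$ be a weak solution to the $p$-Cauchy-Riemann equation on $U$, and let $f:V\to U$ be a holomorphic function with $f'(\zeta)\neq0$ for all $\zeta\in V$. Then $f'(\zeta)\|g(f(\zeta))\|^{p-2}g(f(\zeta))$ is a weak solution on $V$ to the equation $$\frac{\partial}{\partial\overline{\zeta}}\,f'(\zeta)\|g(f(\zeta))\|^{p-2}g(f(\zeta))=0;$$ that is, with $\zeta=x+iy$, $\int_V f'(\zeta)\|g(f(\zeta))\|^{p-2}g(f(\zeta))\,\frac{\partial\eta}{\partial\overline{\zeta}}(\zeta)\,dx\,dy=0$ for every test function $\eta$ on $V$.
   Context: For $z=x+iy$, $\frac{\partial}{\partial\overline z}=\frac12\left(\frac{\partial}{\partial x}+i\frac{\partial}{\partial y}\right)$ is the Cauchy-Riemann operator, and $\|\cdot\|$ is the modulus on $\mathbb{C}$. Test functions on an open set are complex-valued functions in $C_0^\infty$ of that set. Expressions $\|g\|^{p-2}g$ are taken to be $0$ where $g=0$, and the integrals in the definitions are required to exist. A function $g:U\to\mathbb{C}$ is a weak solution to the $p$-Cauchy-Riemann equation $\frac{\partial}{\partial\overline z}\|g(z)\|^{p-2}g(z)=0$ on $U$ if $g\in L^p_{loc}(U)$ and $\int_U\|g(z)\|^{p-2}g(z)\,\frac{\partial\eta}{\partial\overline z}(z)\,dx\,dy=0$ for every test function $\eta$ on $U$. *)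

(* Defs.v *)
From HB Require Import structures.
From mathcomp Require Import all_boot all_order all_algebra.
From mathcomp Require Import complex.
From mathcomp Require Import all_classical all_reals all_analysis.

Set Implicit Arguments.
Unset Strict Implicit.
Unset Printing Implicit Defensive.

Import Order.TTheory GRing.Theory Num.Theory.
Import numFieldNormedType.Exports.

Local Open Scope classical_set_scope.
Local Open Scope ring_scope.
Local Open Scope complex_scope.

(* The complex numbers as a normed space over themselves: topological notions
   are those of the modulus, and [derivable], ['D_1] are complex
   differentiability and the complex derivative. *)
Notation Cplx R := (R[i]^o).

Local Notation re := complex.Re.
Local Notation im := complex.Im.

Definition plane_borel {R : realType} :=
  (@lebesgue_measure R \x @lebesgue_measure R)%E.

HB.instance Definition _ (R : realType) := Measure.on (@plane_borel R).

(* [R * R] with the sigma-algebra of all Lebesgue measurable sets, instead of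
   that of the Borel sets which the product carries by default. *)
Notation plane R := (caratheodory_type ((@plane_borel R)^*)%mu).

Definition plane_lebesgue {R : realType} : set (plane R) -> \bar R :=
  @completed_measure_extension _ _ _ plane_borel.

HB.instance Definition _ (R : realType) := Measure.on (@plane_lebesgue R).

Section Plane.
Context {R : realType}.

Definition of_plane (w : plane R) : Cplx R := w.1 +i* w.2.

Definition bounded_domain (U : set (Cplx R)) : Prop :=
  [/\ open U, connected U, U !=set0 & bounded_set U].

Definition holomorphic_on (V : set (Cplx R)) (f : Cplx R -> Cplx R) : Prop :=
  forall z, V z -> derivable f z 1.

Definition measurable_on (U : set (Cplx R)) (h : Cplx R -> Cplx R) : Prop :=
  measurable_fun (of_plane @^-1` U) (fun w => re (h (of_plane w))) /\
  measurable_fun (of_plane @^-1` U) (fun w => im (h (of_plane w))).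

Definition Lp_loc (p : R) (U : set (Cplx R)) (g : Cplx R -> Cplx R) : Prop :=
  measurable_on U g /\
  forall K : set (Cplx R), compact K -> K `<=` U ->
    (\int[plane_lebesgue]_(w in of_plane @^-1` K)
        (Normc.normc (g (of_plane w)) `^ p)%:E < +oo)%E.

Definition integrable_on (U : set (Cplx R)) (h : Cplx R -> Cplx R) : Prop :=
  plane_lebesgue.-integrable (of_plane @^-1` U)
    (fun w => (re (h (of_plane w)))%:E) /\
  plane_lebesgue.-integrable (of_plane @^-1` U)
    (fun w => (im (h (of_plane w)))%:E).

Definition integral_on (U : set (Cplx R)) (h : Cplx R -> Cplx R) : Cplx R :=
  Rintegral plane_lebesgue (of_plane @^-1` U) (fun w => re (h (of_plane w)))
  +i*
  Rintegral plane_lebesgue (of_plane @^-1` U) (fun w => im (h (of_plane w))).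

Definition horizontal (phi : Cplx R -> R) (z : Cplx R) : R -> R :=
  fun x => phi (x +i* im z).
Definition vertical (phi : Cplx R -> R) (z : Cplx R) : R -> R :=
  fun y => phi (re z +i* y).

Definition rpartial_x (phi : Cplx R -> R) (z : Cplx R) : R :=
  derive1 (horizontal phi z) (re z).
Definition rpartial_y (phi : Cplx R -> R) (z : Cplx R) : R :=
  derive1 (vertical phi z) (im z).

Definition partial_x (eta : Cplx R -> Cplx R) (z : Cplx R) : Cplx R :=
  rpartial_x (fun w => re (eta w)) z +i* rpartial_x (fun w => im (eta w)) z.
Definition partial_y (eta : Cplx R -> Cplx R) (z : Cplx R) : Cplx R :=
  rpartial_y (fun w => re (eta w)) z +i* rpartial_y (fun w => im (eta w)) z.

Definition dbar (eta : Cplx R -> Cplx R) (z : Cplx R) : Cplx R :=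
  2^-1 * (partial_x eta z + (0 +i* 1) * partial_y eta z).

(* [mixed_partial s phi] differentiates successively, in x for [true] and in y
   for [false], reading [s] from the right. *)
Definition mixed_partial (s : seq bool) (phi : Cplx R -> R) : Cplx R -> R :=
  foldr (fun b psi => if b then rpartial_x psi else rpartial_y psi) phi s.

Definition smooth_real (phi : Cplx R -> R) : Prop :=
  forall s, continuous (mixed_partial s phi) /\
    forall z, derivable (horizontal (mixed_partial s phi) z) (re z) 1 /\
              derivable (vertical (mixed_partial s phi) z) (im z) 1.

Definition smooth (eta : Cplx R -> Cplx R) : Prop :=
  smooth_real (fun z => re (eta z)) /\ smooth_real (fun z => im (eta z)).

Definition support (eta : Cplx R -> Cplx R) : set (Cplx R) :=
  closure [set z | eta z != 0].

(* A test function on [U] is identified with its extension by zero, which is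
   smooth on the whole plane. *)
Definition test_function (U : set (Cplx R)) (eta : Cplx R -> Cplx R) : Prop :=
  [/\ smooth eta, compact (support eta) & support eta `<=` U].

(* For [p < 1] the integrability is not a consequence of [Lp_loc]. *)
Definition weak_dbar_solution (U : set (Cplx R)) (h : Cplx R -> Cplx R) : Prop :=
  forall eta, test_function U eta ->
    integrable_on U (fun z => h z * dbar eta z) /\
    integral_on U (fun z => h z * dbar eta z) = 0.

(* [`^] is total, so this is 0 at [w = 0], also when [p < 2]. *)
Definition pduality (p : R) (w : Cplx R) : Cplx R :=
  (Normc.normc w `^ (p - 2))%:C * w.

Definition pCR_weak_solution (p : R) (U : set (Cplx R)) (g : Cplx R -> Cplx R)
    : Prop :=
  Lp_loc p U g /\ weak_dbar_solution U (fun z => pduality p (g z)).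

End Plane.

(* Main.v *)
Require Import Defs.
From HB Require Import structures.
From mathcomp Require Import all_boot all_order all_algebra.
From mathcomp Require Import complex.
From mathcomp Require Import all_classical all_reals all_analysis.
From mathcomp Require finmap.
From mathcomp Require Import measurable_realfun ring lra.
Import Order.TTheory GRing.Theory Num.Theory.
Import numFieldNormedType.Exports.

(* Put h = |g|^(p-2) g and let eta be a test function on V.  Testing the
   equation for h against a product of two bumps whose dbar does not vanish at
   a given point shows that h is locally integrable, whatever p > 0 is.  Let k
   be h cut off outside a neighbourhood of the compact set f(supp eta).  The
   convolution H of k with a small bump is holomorphic near f(supp eta), since
   the equation for h gives the Cauchy-Riemann equations of H.  Hence f' (H o f)
   is holomorphic near supp eta (f' being so by Cauchy's formula), and
   integrating by parts the integral of f' (H o f) dbar(eta) is 0.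

   As the bump shrinks, the normalised H tends to k in L^1.  Since f' <> 0, f
   expands distances near each point up to a constant, so that composition
   with f is bounded from L^1 to L^1(supp eta).  The integral of
   f' (k o f) dbar(eta) is therefore 0 too, and k o f = h o f on supp eta, up
   to a null set.  No change of variables formula is needed. *)

Set Implicit Arguments.
Unset Strict Implicit.
Unset Printing Implicit Defensive.

Local Open Scope classical_set_scope.
Local Open Scope ring_scope.
Local Open Scope complex_scope.

Local Notation re := complex.Re.
Local Notation im := complex.Im.
Local Notation normc := Normc.normc.

(** * Complex differentiability *)

Section ComplexBasics.
Context {R : realType}.
Implicit Types (z w h : Cplx R) (f : Cplx R -> Cplx R).

(** Since [|h| = |g|^(p-1)] can be unbounded where [g] is small when [p < 1], the local
    integrability of [h] has to be drawn from the equation itself.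

    The definitions integrate against the completed measure, whereas Fubini, translations and
    pushforwards are used for the Borel product measure. So [h] is replaced by Borel functions that
    agree with it off a Borel null set [N]. After composition with [f] this is legitimate only if
    the preimage of [N] is null; that is the L1 bound for composition again, applied to an
    indicator.

    The bound is a covering argument: where [f] does not shrink distances by more than a factor [L],
    the preimage of a dyadic cell lies in a square of comparable area, and a monotone class argument
    leads from cells to Borel sets. Being an inequality, it tolerates several preimages: the
    constants of finitely many local pieces add up.

    The equation for [h] is tested only against products [u(x)v(y)] of bumps from one class that is
    stable under translation and differentiation, so that smoothness in the sense of mixed partials
    needs no separate study. *)

Lemma complex_eta (z : R[i]) : z = re z +i* im z.
Proof. by case: z. Qed.

Lemma complex_ext (z w : R[i]) : re z = re w -> im z = im w -> z = w.
Proof. by case: z w => [a b] [c d] /= -> ->. Qed.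

Lemma reD (z w : R[i]) : re (z + w) = re z + re w. Proof. by case: z; case: w. Qed.
Lemma imD (z w : R[i]) : im (z + w) = im z + im w. Proof. by case: z; case: w. Qed.
Lemma reN (z : R[i]) : re (- z) = - re z. Proof. by case: z. Qed.
Lemma imN (z : R[i]) : im (- z) = - im z. Proof. by case: z. Qed.
Lemma reB (z w : R[i]) : re (z - w) = re z - re w. Proof. by rewrite reD reN. Qed.
Lemma imB (z w : R[i]) : im (z - w) = im z - im w. Proof. by rewrite imD imN. Qed.
Lemma reM (z w : R[i]) : re (z * w) = re z * re w - im z * im w.
Proof. by case: z; case: w. Qed.
Lemma imM (z w : R[i]) : im (z * w) = re z * im w + im z * re w.
Proof. by case: z; case: w. Qed.

Lemma normc_sqrt (z : R[i]) : normc z = Num.sqrt (re z ^+ 2 + im z ^+ 2).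
Proof. by case: z. Qed.

Lemma normcC (z : R[i]) : `|z| = (normc z)%:C.
Proof. by case: z. Qed.

Lemma normc_ge0 (z : R[i]) : 0 <= normc z.
Proof. by rewrite normc_sqrt sqrtr_ge0. Qed.

Lemma normc_gt0 (z : R[i]) : (0 < normc z) = (z != 0).
Proof.
rewrite lt_def normc_ge0 andbT; congr (~~ _).
apply/eqP/eqP => [/Normc.eq0_normc //|->]; exact: Normc.normc0.
Qed.

Lemma ler_normcD (z w : R[i]) : normc (z + w) <= normc z + normc w.
Proof. exact: le_normcD. Qed.

Lemma normcNE (z : R[i]) : normc (- z) = normc z.
Proof. exact: normcN. Qed.

Lemma normcBC (z w : R[i]) : normc (z - w) = normc (w - z).
Proof. by rewrite -normcNE opprB. Qed.

Lemma ler_normc_dist (z w : R[i]) : normc z - normc w <= normc (z - w).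
Proof. by rewrite lerBlDr -{1}(subrK w z) ler_normcD. Qed.

Lemma normcMr (z w : R[i]) : normc (z * w) = normc z * normc w.
Proof. exact: Normc.normcM. Qed.

Lemma normc_re (z : R[i]) : `|re z| <= normc z.
Proof.
by rewrite normc_sqrt -sqrtr_sqr ler_wsqrtr// lerDl sqr_ge0.
Qed.

Lemma normc_im (z : R[i]) : `|im z| <= normc z.
Proof.
by rewrite normc_sqrt -sqrtr_sqr ler_wsqrtr// lerDr sqr_ge0.
Qed.

Lemma normc_real (x : R) : normc x%:C = `|x|.
Proof. by rewrite normc_sqrt/= expr0n addr0 sqrtr_sqr. Qed.

Lemma normc_le_reim (z : R[i]) : normc z <= `|re z| + `|im z|.
Proof.
rewrite [in leLHS](complexE z) (le_trans (ler_normcD _ _))// normcMr normc_real.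
by rewrite normc_real [X in X * _](_ : _ = 1) ?mul1r// normc_sqrt/= expr0n add0r expr1n sqrtr1.
Qed.

Lemma ballC_E z (r : R) w : ball z r%:C w <-> normc (w - z) < r.
Proof. by rewrite /ball/= normcC ltcR normcBC. Qed.

Lemma nbhs_normc z (P : set (Cplx R)) :
  nbhs z P <-> exists2 r : R, 0 < r & forall w, normc (w - z) < r -> P w.
Proof.
split => [/nbhs_ballP[[e e']]|[r r0 H]]; last apply/nbhs_ballP.
  rewrite /= ltcE/= => /andP[/eqP e'0 e0] H; subst e'.
  by exists e => // w wr; apply: H; rewrite /= -/(_%:C) ballC_E.
by exists r%:C; rewrite /= ?ltcR// => w /ballC_E; exact: H.
Qed.

Lemma open_normc (A : set (Cplx R)) z : open A -> A z ->
  exists2 r : R, 0 < r & forall w, normc (w - z) < r -> A w.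
Proof. by move=> oA Az; apply/nbhs_normc; exact: open_nbhs_nbhs. Qed.

Definition cdiff f z (c : R[i]) := forall e : R, 0 < e -> exists2 d : R, 0 < d &
  forall w, normc (w - z) < d ->
    normc (f w - f z - c * (w - z)) <= e * normc (w - z).

Lemma cdiff_is_cvg f z (c : R[i]) : cdiff f z c ->
  h^-1 *: ((f \o shift z) (h *: 1) - f z) @[h --> (0 : Cplx R)^'] --> (c : Cplx R).
Proof.
move=> H; apply/cvgrPdist_le => -[e e']; rewrite ltcE/= => /andP[/eqP e'0 e0].
subst e'; have [d d0 {}H] := H e e0.
rewrite near_withinE; apply/nbhs_normc; exists d => // h hd h0.
have hn : 0 < normc h by rewrite normc_gt0.
rewrite /shift /= -/(e%:C) normcC lecR.
have -> : (h *: (1 : Cplx R)) = h by rewrite -[LHS]/(h * 1) mulr1.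
rewrite -[h^-1 *: _]/(h^-1 * (f (h + z) - f z)).
rewrite -(ler_pM2r hn) -normcMr mulrBl mulrAC mulVf// mul1r normcBC.
have := H (h + z); rewrite addrK => /(_ _); apply.
by move: hd; rewrite subr0.
Qed.

Lemma cdiff_derivable f z c : cdiff f z c -> derivable f z 1.
Proof. by move=> /cdiff_is_cvg H; apply/cvg_ex; exists c. Qed.

Lemma cdiff_derive f z c : cdiff f z c -> 'D_1 f z = c.
Proof. by move=> /cdiff_is_cvg /cvg_lim; apply; exact: norm_hausdorff. Qed.

Lemma derivable_cdiff f z : derivable f z 1 -> cdiff f z ('D_1 f z).
Proof.
move=> df e e0; have /cvgrPdist_le/(_ e%:C) := df.
rewrite ltcR => /(_ e0); rewrite near_withinE => /nbhs_normc[d d0 H].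
exists d => // w wd.
have [->|wz] := eqVneq w z; first by rewrite !subrr mulr0 subrr !Normc.normc0 mulr0.
have h0 : w - z != 0 by rewrite subr_eq0.
have := H (w - z); rewrite subr0 => /(_ wd h0).
rewrite /shift /= normcC lecR.
have -> : ((w - z) *: (1 : Cplx R)) = w - z by rewrite -[LHS]/((w - z) * 1) mulr1.
rewrite subrK -[_ *: _]/((w - z)^-1 * (f w - f z)).
rewrite -(ler_pM2r (_ : 0 < normc (w - z))) ?normc_gt0// -normcMr mulrBl mulrAC mulVf// mul1r.
by rewrite normcBC.
Qed.

Lemma near_cdiff f g z c : (\forall w \near z, f w = g w) -> cdiff f z c -> cdiff g z c.
Proof.
move=> fg H e e0; have [d d0 {}H] := H e e0.
have gz : f z = g z by exact: nbhs_singleton fg.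
have /nbhs_normc[r r0 fr] := fg.
exists (Num.min d r); first by rewrite lt_min d0 r0.
by move=> w; rewrite lt_min => /andP[wd wr]; rewrite -gz -fr//; exact: H.
Qed.

Lemma cdiff_continuous f z c : cdiff f z c -> {for z, continuous f}.
Proof.
move=> H; apply/(@cvgrPdist_le _ (Cplx R) _ (nbhs z)) => -[e e']; rewrite ltcE/= => /andP[/eqP e'0 e0].
subst e'; have [d d0 {}H] := H 1 ltr01.
have k0 : 0 < 1 + normc c by have := normc_ge0 c; lra.
apply/nbhs_normc; exists (Num.min d (e / (1 + normc c))).
  by rewrite lt_min d0 divr_gt0.
move=> w; rewrite lt_min => /andP[wd]; rewrite ltr_pdivlMr// => we.
rewrite -/(e%:C) normcC lecR normcBC; have {}H := H w wd.
have -> : f w - f z = (f w - f z - c * (w - z)) + c * (w - z) by ring.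
rewrite (le_trans (ler_normcD _ _))// normcMr; rewrite mul1r in H.
by rewrite mulrDr mulr1 in we; lra.
Qed.

Lemma continuousC_eps f z : {for z, continuous f} ->
  forall e : R, 0 < e -> exists2 d : R, 0 < d &
    forall w, normc (w - z) < d -> normc (f w - f z) < e.
Proof.
move=> cf e e0; have /(@cvgrPdist_lt _ (Cplx R) _ (nbhs z))/(_ e%:C) := cf.
rewrite ltcR => /(_ e0) /nbhs_normc[d d0 H]; exists d => // w /H.
by rewrite normcC ltcR normcBC.
Qed.

Lemma eps_continuousC f z :
  (forall e : R, 0 < e -> exists2 d : R, 0 < d &
    forall w, normc (w - z) < d -> normc (f w - f z) <= e) ->
  {for z, continuous f}.
Proof.
move=> H; apply/(@cvgrPdist_le _ (Cplx R) _ (nbhs z)) => -[e e']; rewrite ltcE/= => /andP[/eqP e'0 e0].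
subst e'; have [d d0 {}H] := H e e0; apply/nbhs_normc; exists d => // w /H.
by rewrite -/(e%:C) normcC lecR normcBC.
Qed.

Lemma cdiff_id z : cdiff id z 1.
Proof.
by move=> e e0; exists 1 => // w _; rewrite mul1r subrr Normc.normc0 mulr_ge0 ?normc_ge0// ltW.
Qed.

Lemma cdiff_cst (c : R[i]) z : cdiff (fun=> c) z 0.
Proof.
by move=> e e0; exists 1 => // w _; rewrite mul0r !subrr Normc.normc0 mulr_ge0 ?normc_ge0// ltW.
Qed.

Lemma cdiffD f g z a b : cdiff f z a -> cdiff g z b -> cdiff (fun w => f w + g w) z (a + b).
Proof.
move=> df dg e e0; have e2 : 0 < e / 2 by rewrite divr_gt0.
have [d d0 {}df] := df _ e2; have [k k0 {}dg] := dg _ e2.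
exists (Num.min d k); first by rewrite lt_min d0.
move=> w; rewrite lt_min => /andP[wd wk].
have -> : f w + g w - (f z + g z) - (a + b) * (w - z) =
  (f w - f z - a * (w - z)) + (g w - g z - b * (w - z)) by ring.
rewrite (le_trans (ler_normcD _ _))// (le_trans (lerD (df _ wd) (dg _ wk)))//.
by rewrite -mulrDl -splitr.
Qed.

Lemma cdiff_comp f g z a b : cdiff g z b -> cdiff f (g z) a -> cdiff (f \o g) z (a * b).
Proof.
move=> dg df e e0.
have b0 : 0 < 1 + normc b by have := normc_ge0 b; lra.
have [d1 d10 df1] := df (e / (2 * (1 + normc b))) (divr_gt0 e0 (mulr_gt0 (ltr0n _ 2) b0)).
have a0 : 0 < 1 + normc a by have := normc_ge0 a; lra.
(* The entry [1] makes [g] Lipschitz at [z] with constant [1 + normc b]; the other one absorbs the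
   factor [normc a] in front of the remainder of [g]. *)
have m0 : 0 < Num.min 1 (e / (2 * (1 + normc a))).
  by rewrite lt_min ltr01 divr_gt0// mulr_gt0.
have [d2 d20 dg2] := dg _ m0.
exists (Num.min d2 (d1 / (1 + normc b))); first by rewrite lt_min d20 divr_gt0.
move=> w; rewrite lt_min ltr_pdivlMr// => /andP[wd2 wd1].
have {dg2} := dg2 w wd2; set D := g w - g z - b * (w - z) => DE.
have n0 := normc_ge0 (w - z).
have D1 : normc D <= normc (w - z).
  by rewrite (le_trans DE)// ler_piMl// ge_min lexx.
have gE : g w - g z = D + b * (w - z) by rewrite /D; ring.
have gw : normc (g w - g z) <= (1 + normc b) * normc (w - z).
  by rewrite gE (le_trans (ler_normcD _ _))// normcMr mulrDl mul1r lerD2r.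
have gwd : normc (g w - g z) < d1 by rewrite (le_lt_trans gw)// mulrC.
have {}df1 := df1 (g w) gwd.
have -> : (f \o g) w - (f \o g) z - a * b * (w - z) =
   (f (g w) - f (g z) - a * (g w - g z)) + a * D by rewrite /D/=; ring.
rewrite (le_trans (ler_normcD _ _))// normcMr.
rewrite (_ : e = e / 2 + e / 2); last by rewrite -splitr.
rewrite mulrDl lerD//.
  rewrite (le_trans df1)//.
  apply: (@le_trans _ _ (e / (2 * (1 + normc b)) * ((1 + normc b) * normc (w - z)))).
    by rewrite ler_wpM2l// ltW// divr_gt0// mulr_gt0.
  by rewrite le_eqVlt; apply/orP; left; apply/eqP; field; rewrite gt_eqF.
apply: (@le_trans _ _ ((1 + normc a) * (e / (2 * (1 + normc a)) * normc (w - z)))).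
  apply: ler_pM => //; rewrite ?normc_ge0//; first by rewrite lerDr.
  by rewrite (le_trans DE)// ler_wpM2r// ge_min lexx orbT.
by rewrite le_eqVlt; apply/orP; left; apply/eqP; field; rewrite gt_eqF.
Qed.

Lemma eq_cdiff f z a b : cdiff f z a -> a = b -> cdiff f z b.
Proof. by move=> + <-. Qed.

Lemma cdiffZ (k : R[i]) f z a : cdiff f z a -> cdiff (fun w => k * f w) z (k * a).
Proof.
move=> df; apply: (@cdiff_comp (fun w => k * w)) => // e e0; exists 1 => // w _.
by rewrite mulrBr subrr Normc.normc0 mulr_ge0 ?normc_ge0// ltW.
Qed.

Lemma cdiff_sqr z : cdiff (fun w => w * w) z (2 * z).
Proof.
move=> e e0; exists e => // w wz.
have -> : w * w - z * z - 2 * z * (w - z) = (w - z) * (w - z) by ring.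
by rewrite normcMr ler_wpM2r ?normc_ge0// ltW.
Qed.

(* polarisation: [f g = ((f + g)^2 - f^2 - g^2) / 2] *)
Lemma cdiffM f g z a b : cdiff f z a -> cdiff g z b ->
  cdiff (fun w => f w * g w) z (a * g z + f z * b).
Proof.
move=> df dg.
have := cdiffZ 2^-1 (cdiffD (cdiff_comp (cdiffD df dg) (cdiff_sqr _))
  (cdiffD (cdiffZ (-1) (cdiff_comp df (cdiff_sqr _))) (cdiffZ (-1) (cdiff_comp dg (cdiff_sqr _))))).
set k := (k in cdiff k); set c := (c in cdiff _ _ c).
have -> : k = (fun w => f w * g w) by apply/funext => u; rewrite /k/=; field.
by have -> : c = a * g z + f z * b by rewrite /c; field.
Qed.

Lemma cdiff_inv z : z != 0 -> cdiff (fun w => w^-1) z (- (z * z)^-1).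
Proof.
move=> z0 e e0; have nz : 0 < normc z by rewrite normc_gt0.
(* The first bound keeps [normc w] above [normc z / 2]. The remainder is [(w - z)^2 / (w z^2)], at
   most [2 |w - z| / |z|^3] times [|w - z|]; hence the second bound. *)
exists (Num.min (normc z / 2) (e * (normc z ^+ 3) / 2)).
  by rewrite lt_min !divr_gt0// mulr_gt0// exprn_gt0.
move=> w; rewrite lt_min => /andP[w1 w2].
have nw : normc z / 2 < normc w.
  by have := ler_normc_dist z w; rewrite normcBC; lra.
have w0 : w != 0 by rewrite -normc_gt0 (lt_trans _ nw)// divr_gt0.
have -> : w^-1 - z^-1 - - (z * z)^-1 * (w - z) = (w - z) * (w - z) * (w * (z * z))^-1.
  by field; rewrite z0 w0.
rewrite !normcMr Normc.normcV !normcMr mulrAC ler_wpM2r ?normc_ge0//.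
rewrite ler_pdivrMr; last by rewrite !mulr_gt0// (lt_trans _ nw)// divr_gt0.
rewrite (le_trans (ltW w2))// -mulrA ler_wpM2l ?(ltW e0)//.
rewrite (_ : _ / 2 = normc z / 2 * (normc z * normc z)); last by field.
by rewrite ler_wpM2r ?(ltW nw)// mulr_ge0// ltW.
Qed.

Lemma cdiffV f z a : cdiff f z a -> f z != 0 ->
  cdiff (fun w => (f w)^-1) z (- (f z * f z)^-1 * a).
Proof. by move=> df fz; apply: (cdiff_comp df); exact: cdiff_inv. Qed.

End ComplexBasics.

(** * Integrals of continuous functions over intervals *)

Section IntervalIntegral.
Context {R : realType}.
Implicit Types (f g : R -> R) (a b c x : R).

Definition itv_int a b f : R := \int[lebesgue_measure]_(x in `[a, b]) f x.

(** Continuity is two-sided at the end points too, so that it restricts to subintervals at once, as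
    the bisection requires. *)
Definition continuous_itv a b f := forall x, a <= x <= b -> {for x, continuous f}.

Lemma continuous_itv_within a b f : continuous_itv a b f ->
  {within `[a, b], continuous f}.
Proof.
by move=> cf; apply: continuous_in_subspaceT => x; rewrite inE/= in_itv/= => /cf.
Qed.

Lemma continuous_itv_integrable a b f : continuous_itv a b f ->
  lebesgue_measure.-integrable `[a, b] (EFin \o f).
Proof.
move=> cf; apply: continuous_compact_integrable; first exact: segment_compact.
exact: continuous_itv_within.
Qed.

Lemma itv_int_split a b c f : continuous_itv a b f -> a <= c <= b ->
  itv_int a b f = itv_int a c f + itv_int c b f.
Proof.
move=> cf /andP[ac cb]; apply/eqP; rewrite addrC -subr_eq; apply/eqP.
have fi := continuous_itv_integrable cf.
rewrite /itv_int Rintegral_itvB ?bnd_simp// Rintegral_itv_obnd_cbnd//.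
apply: integrableS fi => //; apply: subset_itv; rewrite bnd_simp//.
Qed.

Lemma itv_intB a b f g : continuous_itv a b f -> continuous_itv a b g ->
  itv_int a b (fun x => f x - g x) = itv_int a b f - itv_int a b g.
Proof. by move=> cf cg; apply: RintegralB => //; exact: continuous_itv_integrable. Qed.

Lemma itv_intD a b f g : continuous_itv a b f -> continuous_itv a b g ->
  itv_int a b (fun x => f x + g x) = itv_int a b f + itv_int a b g.
Proof. by move=> cf cg; apply: RintegralD => //; exact: continuous_itv_integrable. Qed.

Lemma itv_int_cst a b c : a <= b -> itv_int a b (fun=> c) = c * (b - a).
Proof.
move=> ab; rewrite /itv_int Rintegral_cst//= lebesgue_measure_itv/= lte_fin.
by move: ab; rewrite le_eqVlt => /predU1P[->|->]; rewrite ?ltxx ?subrr.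
Qed.

Lemma itv_int_bound a b f c : a <= b -> continuous_itv a b f ->
  (forall x, a <= x <= b -> `|f x| <= c) -> `|itv_int a b f| <= c * (b - a).
Proof.
move=> ab cf fc.
have fi := continuous_itv_integrable cf.
rewrite (le_trans (le_normr_Rintegral _ fi))//= -itv_int_cst//.
apply: le_Rintegral => //; first exact: integrable_norm.
by apply: continuous_itv_integrable => x _; exact: cvg_cst.
Qed.

End IntervalIntegral.

(** * Goursat's lemma and Cauchy's formula *)

Section Goursat.
Context {R : realType}.
Implicit Types (A B : R -> R -> R).

(** Total differentiability with gradient [(p, q)], nothing being asked of the continuity of the
    partial derivatives: this is all that complex differentiability provides before Cauchy's
    formula. *)
Definition rdiff A (x y p q : R) := forall e : R, 0 < e -> exists2 d : R, 0 < d &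
  forall u v, `|u - x| < d -> `|v - y| < d ->
    `|A u v - A x y - p * (u - x) - q * (v - y)| <= e * (`|u - x| + `|v - y|).

Lemma rdiff_continuous A x y p q : rdiff A x y p q ->
  forall e, 0 < e -> exists2 d : R, 0 < d & forall u v, `|u - x| < d -> `|v - y| < d ->
    `|A u v - A x y| <= e.
Proof.
move=> H e e0; have [d d0 {}H] := H 1 ltr01.
have k0 : 0 < 2 + `|p| + `|q| by have := normr_ge0 p; have := normr_ge0 q; lra.
exists (Num.min d (e / (2 + `|p| + `|q|))); first by rewrite lt_min d0 divr_gt0.
move=> u v; rewrite !lt_min => /andP[ud ue] /andP[vd ve].
have {}H := H u v ud vd.
have -> : A u v - A x y = (A u v - A x y - p * (u - x) - q * (v - y)) + (p * (u - x) + q * (v - y)) by ring.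
rewrite (le_trans (ler_normD _ _))//.
rewrite (le_trans (lerD H (ler_normD _ _)))// !normrM mul1r.
have -> : `|u - x| + `|v - y| + (`|p| * `|u - x| + `|q| * `|v - y|) =
  (1 + `|p|) * `|u - x| + (1 + `|q|) * `|v - y| by ring.
move: ue ve; rewrite !ltr_pdivlMr// => ue ve.
have p0 := normr_ge0 p; have q0 := normr_ge0 q.
have ux0 := normr_ge0 (u - x); have vy0 := normr_ge0 (v - y).
have : (1 + `|p|) * `|u - x| <= (1 + `|p|) * (e / (2 + `|p| + `|q|)).
  by rewrite ler_pM2l ?ltr_pwDl// ler_pdivlMr// ltW.
have : (1 + `|q|) * `|v - y| <= (1 + `|q|) * (e / (2 + `|p| + `|q|)).
  by rewrite ler_pM2l ?ltr_pwDl// ler_pdivlMr// ltW.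
have : (1 + `|p|) * (e / (2 + `|p| + `|q|)) + (1 + `|q|) * (e / (2 + `|p| + `|q|)) = e.
  rewrite -mulrDl mulrCA -[RHS]mulr1; congr (_ * _).
  by rewrite (_ : 1 + _ + _ = 2 + `|p| + `|q|) ?mulfV ?gt_eqF//; ring.
lra.
Qed.

Lemma rdiff_slicel A x y p q : rdiff A x y p q -> {for x, continuous (A ^~ y)}.
Proof.
move=> /rdiff_continuous H; apply/cvgrPdist_le => e e0.
have [d d0 {}H] := H e e0; near=> t; rewrite distrC; apply: H; last by rewrite subrr normr0.
by rewrite distrC; near: t; exact: cvgr_dist_lt.
Unshelve. all: by end_near. Qed.

Lemma rdiff_slicer A x y p q : rdiff A x y p q -> {for y, continuous (A x)}.
Proof.
move=> /rdiff_continuous H; apply/cvgrPdist_le => e e0.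
have [d d0 {}H] := H e e0; near=> t; rewrite distrC; apply: H; first by rewrite subrr normr0.
by rewrite distrC; near: t; exact: cvgr_dist_lt.
Unshelve. all: by end_near. Qed.

(** The integral of the form [A dx + B dy] along the boundary of the rectangle [[a, b] x [c, d]],
    counterclockwise. *)
Definition bdry_int A B (a b c d : R) : R :=
  itv_int a b (fun x => A x c - A x d) + itv_int c d (fun y => B b y - B a y).

Section Bisection.
Variables (A B : R -> R -> R) (a0 b0 c0 d0 : R).
(** The common [q] expresses that the form [A dx + B dy] is closed. *)
Hypothesis closed_form : forall x y, a0 <= x <= b0 -> c0 <= y <= d0 ->
  exists p q r, rdiff A x y p q /\ rdiff B x y q r.

Let cA y : c0 <= y <= d0 -> continuous_itv a0 b0 (A ^~ y).
Proof.
by move=> hy x hx; have [p [q [r [+ _]]]] := closed_form hx hy; exact: rdiff_slicel.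
Qed.

Let cB x : a0 <= x <= b0 -> continuous_itv c0 d0 (B x).
Proof.
by move=> hx y hy; have [p [q [r [_ +]]]] := closed_form hx hy; exact: rdiff_slicer.
Qed.

Let cAs a b y : a0 <= a -> b <= b0 -> c0 <= y <= d0 -> continuous_itv a b (A ^~ y).
Proof.
by move=> aa bb hy x /andP[ax xb]; apply: cA => //; rewrite (le_trans aa ax) (le_trans xb bb).
Qed.

Let cBs c d x : c0 <= c -> d <= d0 -> a0 <= x <= b0 -> continuous_itv c d (B x).
Proof.
by move=> cc dd hx y /andP[cy yd]; apply: cB => //; rewrite (le_trans cc cy) (le_trans yd dd).
Qed.

Let subrect a b c d := [/\ a0 <= a, a <= b, b <= b0 & [/\ c0 <= c, c <= d & d <= d0]].

Let bdryE a b c d : subrect a b c d -> bdry_int A B a b c d =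
  itv_int a b (A ^~ c) - itv_int a b (A ^~ d) + (itv_int c d (B b) - itv_int c d (B a)).
Proof.
move=> [aa ab bb [cc cd dd]]; rewrite /bdry_int itv_intB ?itv_intB//.
all: try (apply: cAs => //; lra).
all: try (apply: cBs => //; lra).
Qed.

Let bdry_splitl a m b c d : subrect a b c d -> a <= m <= b ->
  bdry_int A B a b c d = bdry_int A B a m c d + bdry_int A B m b c d.
Proof.
move=> [aa ab bb [cc cd dd]] mab; rewrite !bdryE; last first.
- by split; [lra|lra|lra|split; lra].
- by split; [lra|lra|lra|split; lra].
- by split; [lra|lra|lra|split; lra].
rewrite (@itv_int_split _ a b m (A ^~ c)) ?(@itv_int_split _ a b m (A ^~ d))//; first ring.
all: apply: cAs => //; lra.
Qed.

Let bdry_splitr a b c m d : subrect a b c d -> c <= m <= d ->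
  bdry_int A B a b c d = bdry_int A B a b c m + bdry_int A B a b m d.
Proof.
move=> [aa ab bb [cc cd dd]] mab; rewrite !bdryE; last first.
- by split; [lra|lra|lra|split; lra].
- by split; [lra|lra|lra|split; lra].
- by split; [lra|lra|lra|split; lra].
rewrite (@itv_int_split _ c d m (B a)) ?(@itv_int_split _ c d m (B b))//; first ring.
all: apply: cBs => //; lra.
Qed.

(** The boundary integrals of the four quarters add up to that of the whole, so one of them has at
    least a quarter of its modulus. *)
Let half_step a b c d : subrect a b c d -> exists a' b' c' d',
  [/\ a <= a', b' <= b, c <= c', d' <= d &
   [/\ b' - a' = (b - a) / 2, d' - c' = (d - c) / 2 &
     `|bdry_int A B a b c d| <= 4 * `|bdry_int A B a' b' c' d'|]].
Proof.
move=> s; have [aa ab bb [cc cd dd]] := s.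
pose m := (a + b) / 2; pose n := (c + d) / 2.
have ma : a <= m <= b by rewrite /m; lra.
have nc : c <= n <= d by rewrite /n; lra.
have E : bdry_int A B a b c d = bdry_int A B a m c n + bdry_int A B a m n d +
    (bdry_int A B m b c n + bdry_int A B m b n d).
  rewrite (bdry_splitl s ma) (@bdry_splitr a m c n d)//; last by split; [lra|lra|lra|split; lra].
  by rewrite (@bdry_splitr m b c n d)//; split; [lra|lra|lra|split; lra].
set X := bdry_int _ _ _ _ _ _ in E *; set X1 := bdry_int _ _ a m c n in E.
set X2 := bdry_int _ _ a m n d in E; set X3 := bdry_int _ _ m b c n in E.
set X4 := bdry_int _ _ m b n d in E.
have [h1|h1] := leP `|X| (4 * `|X1|).
  by exists a, m, c, n; split => //; rewrite /m /n; [lra..|split => //; lra].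
have [h2|h2] := leP `|X| (4 * `|X2|).
  by exists a, m, n, d; split => //; rewrite /m /n; [lra..|split => //; lra].
have [h3|h3] := leP `|X| (4 * `|X3|).
  by exists m, b, c, n; split => //; rewrite /m /n; [lra..|split => //; lra].
exists m, b, n, d; split => //; rewrite ?/m ?/n; [lra..|split => //; [lra|lra|]].
have := ler_normD (X1 + X2) (X3 + X4); have := ler_normD X1 X2.
have := ler_normD X3 X4; rewrite -E; lra.
Qed.

(** The affine parts of [A] and [B] contribute [q (c - d) (b - a)] and [q (b - a) (d - c)], which
    cancel because the same [q] occurs in both. Only the remainders are left, each at most [e] times
    the sum of the two side lengths. *)
Let bdry_small a b c d x y p q r e : subrect a b c d -> a <= x <= b -> c <= y <= d ->
  (forall u v, a <= u <= b -> c <= v <= d ->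
    `|A u v - A x y - p * (u - x) - q * (v - y)| <= e * (`|u - x| + `|v - y|)) ->
  (forall u v, a <= u <= b -> c <= v <= d ->
    `|B u v - B x y - q * (u - x) - r * (v - y)| <= e * (`|u - x| + `|v - y|)) ->
  0 <= e ->
  `|bdry_int A B a b c d| <= 2 * e * ((b - a) + (d - c)) ^+ 2.
Proof.
move=> s hx hy HA HB e0; have [aa ab bb [cc cd dd]] := s.
have dist u v : a <= u <= b -> c <= v <= d -> e * (`|u - x| + `|v - y|) <= e * ((b - a) + (d - c)).
  move=> hu hv; rewrite ler_wpM2l// lerD// ler_norml; lra.
have cst_c (k l t : R) (g : R -> R) : continuous_itv k l (fun=> t).
  by move=> z _; exact: cvg_cst.
have EA : itv_int a b (fun x => A x c - A x d - q * (c - d)) =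
   itv_int a b (fun x => A x c - A x d) - q * (c - d) * (b - a).
  rewrite itv_intB ?itv_int_cst//; last by move=> z _; exact: cvg_cst.
  by move=> z hz; apply: cvgB; apply: cAs hz => //; lra.
have EB : itv_int c d (fun y => B b y - B a y - q * (b - a)) =
   itv_int c d (fun y => B b y - B a y) - q * (b - a) * (d - c).
  rewrite itv_intB ?itv_int_cst//; last by move=> z _; exact: cvg_cst.
  by move=> z hz; apply: cvgB; apply: cBs hz => //; lra.
have -> : bdry_int A B a b c d = itv_int a b (fun x => A x c - A x d - q * (c - d)) +
   itv_int c d (fun y => B b y - B a y - q * (b - a)) by rewrite EA EB /bdry_int; ring.
rewrite (le_trans (ler_normD _ _))//.
have BA : `|itv_int a b (fun x => A x c - A x d - q * (c - d))| <= 2 * e * ((b - a) + (d - c)) * (b - a).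
  apply: itv_int_bound => //.
    by move=> z hz; apply: cvgB; [apply: cvgB; apply: cAs hz => //; lra|exact: cvg_cst].
  move=> z hz; have hc : c <= c <= d by lra.
  have hd : c <= d <= d by lra.
  have := HA z c hz hc; have := HA z d hz hd; have := dist z c hz hc; have := dist z d hz hd.
  set D := e * _.
  move=> h1 h2 h3 h4.
  have -> : A z c - A z d - q * (c - d) =
     (A z c - A x y - p * (z - x) - q * (c - y)) - (A z d - A x y - p * (z - x) - q * (d - y)).
    by ring.
  rewrite (le_trans (ler_normB _ _))//.
  by rewrite -mulrA -/D; lra.
have BB : `|itv_int c d (fun y => B b y - B a y - q * (b - a))| <= 2 * e * ((b - a) + (d - c)) * (d - c).
  apply: itv_int_bound => //.
    by move=> z hz; apply: cvgB; [apply: cvgB; apply: cBs hz => //; lra|exact: cvg_cst].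
  move=> z hz; have ha : a <= a <= b by lra.
  have hb : a <= b <= b by lra.
  have := HB a z ha hz; have := HB b z hb hz; have := dist a z ha hz; have := dist b z hb hz.
  set D := e * _.
  move=> h1 h2 h3 h4.
  have -> : B b z - B a z - q * (b - a) =
     (B b z - B x y - q * (b - x) - r * (z - y)) - (B a z - B x y - q * (a - x) - r * (z - y)).
    by ring.
  rewrite (le_trans (ler_normB _ _))//.
  by rewrite -mulrA -/D; lra.
by rewrite (le_trans (lerD BA BB))// -mulrDr expr2 !mulrA.
Qed.

(* Bisection: the boundary integral is additive on rectangles, while near a
   point of differentiability it is o(diameter^2). *)
Lemma goursat : a0 <= b0 -> c0 <= d0 -> bdry_int A B a0 b0 c0 d0 = 0.
Proof.
move=> ab cd.
pose D (q : R * R * R * R) := bdry_int A B q.1.1.1 q.1.1.2 q.1.2 q.2.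
pose S (q : R * R * R * R) := subrect q.1.1.1 q.1.1.2 q.1.2 q.2.
(* Stated for all quadruples, with [S q] as a premise inside the existential, so that [choice]
   yields a total function to iterate. *)
have stepP (q : R * R * R * R) : exists q' : R * R * R * R, S q ->
    [/\ q.1.1.1 <= q'.1.1.1, q'.1.1.2 <= q.1.1.2, q.1.2 <= q'.1.2, q'.2 <= q.2 &
    [/\ q'.1.1.2 - q'.1.1.1 = (q.1.1.2 - q.1.1.1) / 2, q'.2 - q'.1.2 = (q.2 - q.1.2) / 2 &
     `|D q| <= 4 * `|D q'|]].
  have [/half_step[a' [b' [c' [d' H]]]]|nS] := pselect (S q); last by exists q.
  by exists (a', b', c', d').
have [step {}stepP] := choice stepP.
pose Q n := iter n step (a0, b0, c0, d0).
have Q0 : S (Q 0%N) by split.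
have QS n : S (Q n).
  elim: n => // n IH; rewrite /Q iterS -/(Q n).
  have [h1 h2 h3 h4 [h5 h6 _]] := stepP _ IH.
  by have [? ? ? [? ? ?]] := IH; split; [lra|lra|lra|split; lra].
have Qstep n := stepP _ (QS n).
have wE n : (Q n).1.1.2 - (Q n).1.1.1 = (b0 - a0) / 2 ^+ n.
  elim: n => [|n IH]; first by rewrite expr0 divr1.
  rewrite /Q iterS -/(Q n); have [_ _ _ _ [-> _ _]] := Qstep n.
  by rewrite IH exprSr invfM mulrA.
have hE n : (Q n).2 - (Q n).1.2 = (d0 - c0) / 2 ^+ n.
  elim: n => [|n IH]; first by rewrite expr0 divr1.
  rewrite /Q iterS -/(Q n); have [_ _ _ _ [_ -> _]] := Qstep n.
  by rewrite IH exprSr invfM mulrA.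
have DE n : `|bdry_int A B a0 b0 c0 d0| <= 4 ^+ n * `|D (Q n)|.
  elim: n => [|n IH]; first by rewrite expr0 mul1r.
  rewrite (le_trans IH)// exprSr -mulrA ler_pM2l ?exprn_gt0//.
  by have [_ _ _ _ [_ _]] := Qstep n.
have mono n k : [/\ (Q n).1.1.1 <= (Q (n + k)%N).1.1.1, (Q (n + k)%N).1.1.2 <= (Q n).1.1.2,
   (Q n).1.2 <= (Q (n + k)%N).1.2 & (Q (n + k)%N).2 <= (Q n).2].
  elim: k => [|k [i1 i2 i3 i4]]; first by rewrite addn0.
  rewrite addnS /Q iterS -/(Q (n + k)%N); have [h1 h2 h3 h4 _] := Qstep (n + k)%N.
  by split; lra.
have lowup n m : (Q n).1.1.1 <= (Q m).1.1.2 /\ (Q n).1.2 <= (Q m).2.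
  have [h1 _ h3 _] := mono n m; have [_ h2 _ h4] := mono m n.
  rewrite addnC in h2 h4; have [_ s1 _ [_ s2 _]] := QS (n + m)%N; lra.
(* The suprema of the left and of the lower ends are the coordinates of a point common to all the
   nested rectangles. *)
pose xs := [set (Q n).1.1.1 | n in setT]; pose ys := [set (Q n).1.2 | n in setT].
have xsP n : (Q n).1.1.1 <= sup xs <= (Q n).1.1.2.
  apply/andP; split.
    apply: ub_le_sup; last by exists n.
    by exists (Q 0%N).1.1.2 => _ [m _ <-]; have [] := lowup m 0%N.
  by apply: ge_sup; [exists (Q 0%N).1.1.1, 0%N|move=> _ [m _ <-]; have [] := lowup m n].
have ysP n : (Q n).1.2 <= sup ys <= (Q n).2.
  apply/andP; split.
    apply: ub_le_sup; last by exists n.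
    by exists (Q 0%N).2 => _ [m _ <-]; have [] := lowup m 0%N.
  by apply: ge_sup; [exists (Q 0%N).1.2, 0%N|move=> _ [m _ <-]; have [] := lowup m n].
have [p [q [r [dA dB]]]] := closed_form (xsP 0%N) (ysP 0%N).
apply/eqP; rewrite -normr_le0; apply/ler_addgt0Pl => e e0; rewrite addr0.
(* The factor [4 ^+ n] lost in the bisection cancels the square of the scale [2 ^- n] of the sides,
   so the final bound is at most [2 * e1 * L ^+ 2 = e]. The [1] keeps [L] positive for degenerate
   rectangles. *)
pose L := (b0 - a0) + (d0 - c0) + 1.
have L0 : 0 < L by rewrite /L; lra.
pose e1 := e / (2 * L ^+ 2).
have L2 : 0 < 2 * L ^+ 2 by rewrite mulr_gt0// exprn_gt0.
have e10 : 0 < e1 by rewrite divr_gt0.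
have [dA1 dA0 {}dA] := dA e1 e10; have [dB1 dB0 {}dB] := dB e1 e10.
pose dl := Num.min dA1 dB1; have dl0 : 0 < dl by rewrite lt_min dA0.
have [n nP] : exists n : nat, L / 2 ^+ n < dl.
  exists (Num.truncn (L / dl)).+1.
  have h : L / dl < (Num.truncn (L / dl)).+1%:R by apply: truncnS_gt.
  rewrite ltr_pdivrMr ?exprn_gt0// mulrC -ltr_pdivrMr//.
  by rewrite (lt_trans h)// -natrX ltr_nat ltn_expl.
have P2 : 0 < 2 ^+ n :> R by rewrite exprn_gt0.
have wdl : (b0 - a0) / 2 ^+ n < dl.
  by rewrite (le_lt_trans _ nP)// ler_pM2r ?invr_gt0// /L; lra.
have hdl : (d0 - c0) / 2 ^+ n < dl.
  by rewrite (le_lt_trans _ nP)// ler_pM2r ?invr_gt0// /L; lra.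
have close u v : (Q n).1.1.1 <= u <= (Q n).1.1.2 -> (Q n).1.2 <= v <= (Q n).2 ->
    `|u - sup xs| < dl /\ `|v - sup ys| < dl.
  move=> hu hv; have := xsP n; have := ysP n; have := wE n; have := hE n.
  by move=> h1 h2 h3 h4; split; rewrite ltr_norml; lra.
have := @bdry_small _ _ _ _ _ _ p q r e1 (QS n) (xsP n) (ysP n) _ _ (ltW e10).
move=> /(_ _ _)/wrap[].
  by move=> u v hu hv; have [] := close u v hu hv; rewrite !lt_min => /andP[? _] /andP[? _]; exact: dA.
  by move=> u v hu hv; have [] := close u v hu hv; rewrite !lt_min => /andP[_ ?] /andP[_ ?]; exact: dB.
rewrite wE hE -mulrDl exprMn => H.
rewrite (le_trans (DE n))// (le_trans (ler_wpM2l _ H)) ?exprn_ge0//.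
have -> : 4 ^+ n * (2 * e1 * (((b0 - a0) + (d0 - c0)) ^+ 2 * (2 ^+ n)^-1 ^+ 2)) =
  2 * e1 * ((b0 - a0) + (d0 - c0)) ^+ 2.
  have -> : (4 : R) ^+ n = (2 ^+ n) ^+ 2 by rewrite exprAC; congr (_ ^+ _); ring.
  by field; rewrite gt_eqF.
have : ((b0 - a0) + (d0 - c0)) ^+ 2 <= L ^+ 2 by rewrite ler_pXn2r ?nnegrE// /L; lra.
rewrite /e1 => K; rewrite -[leRHS]mul1r mulrAC mulrA -mulrAC ler_pM2r//.
by rewrite ler_pdivrMr// mul1r ler_pM2l.
Qed.

End Bisection.
End Goursat.

(** * Complex functions of two real variables *)

Section TwoVariables.
Context {R : realType}.
Implicit Types (G H : R -> R -> R[i]) (x y : R) (p q : R[i]).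

(** One calculus serves both the homotopies in [(u, v)] and the paths, which are taken as functions
    constant in the first variable. *)
Definition cdiff2 G x y p q := forall e : R, 0 < e -> exists2 d : R, 0 < d &
  forall u v, `|u - x| < d -> `|v - y| < d ->
    normc (G u v - G x y - p * (u - x)%:C - q * (v - y)%:C) <= e * (`|u - x| + `|v - y|).

Lemma cdiff2_rdiff G x y p q : cdiff2 G x y p q ->
  rdiff (fun u v => re (G u v)) x y (re p) (re q) /\
  rdiff (fun u v => im (G u v)) x y (im p) (im q).
Proof.
move=> dG; split => e e0; have [d d0 {}dG] := dG e e0; exists d => // u v ud vd;
  apply: le_trans (dG u v ud vd).
  by apply: le_trans (normc_re _); rewrite !(reB, reM)/= !mulr0 !subr0.
by apply: le_trans (normc_im _); rewrite !(imB, imM)/= !mulr0 !add0r.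
Qed.

Lemma rdiff_cdiff2 (A B : R -> R -> R) x y (p q p' q' : R) :
  rdiff A x y p q -> rdiff B x y p' q' ->
  cdiff2 (fun u v => A u v +i* B u v) x y (p +i* p') (q +i* q').
Proof.
move=> dA dB e e0; have e2 : 0 < e / 2 by rewrite divr_gt0.
have [d d0 {}dA] := dA _ e2; have [k k0 {}dB] := dB _ e2.
exists (Num.min d k); first by rewrite lt_min d0.
move=> u v; rewrite !lt_min => /andP[ud uk] /andP[vd vk].
rewrite (le_trans (normc_le_reim _))// !(reB, reM, imB, imM)/= !mulr0 !subr0 !add0r.
rewrite (le_trans (lerD (dA _ _ ud vd) (dB _ _ uk vk)))//.
by rewrite -mulrDl -splitr.
Qed.

Lemma eq_cdiff2 G x y p q p' : cdiff2 G x y p q -> p = p' -> cdiff2 G x y p' q.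
Proof. by move=> + <-. Qed.

Lemma cdiff2D G H x y p q p' q' : cdiff2 G x y p q -> cdiff2 H x y p' q' ->
  cdiff2 (fun u v => G u v + H u v) x y (p + p') (q + q').
Proof.
move=> dA dB e e0; have e2 : 0 < e / 2 by rewrite divr_gt0.
have [d d0 {}dA] := dA _ e2; have [k k0 {}dB] := dB _ e2.
exists (Num.min d k); first by rewrite lt_min d0.
move=> u v; rewrite !lt_min => /andP[ud uk] /andP[vd vk].
set a := _%:C; set b := _%:C.
have -> : G u v + H u v - (G x y + H x y) - (p + p') * a - (q + q') * b =
 (G u v - G x y - p * a - q * b) + (H u v - H x y - p' * a - q' * b) by ring.
rewrite (le_trans (ler_normcD _ _))//.
rewrite (le_trans (lerD (dA _ _ ud vd) (dB _ _ uk vk)))//.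
by rewrite -mulrDl -splitr.
Qed.

Lemma cdiff2_cst (c : R[i]) x y : cdiff2 (fun _ _ => c) x y 0 0.
Proof.
move=> e e0; exists 1 => // u v _ _; rewrite !mul0r !subrr Normc.normc0.
by rewrite mulr_ge0 ?addr_ge0// ltW.
Qed.

Lemma cdiff2_fst x y : cdiff2 (fun u _ => u%:C) x y 1 0.
Proof.
move=> e e0; exists 1 => // u v _ _; rewrite mul0r subr0 mul1r rmorphB subrr Normc.normc0.
by rewrite mulr_ge0 ?addr_ge0// ltW.
Qed.

Lemma cdiff2_lip G x y p q : cdiff2 G x y p q -> exists d K : R, [/\ 0 < d, 0 < K &
  forall u v, `|u - x| < d -> `|v - y| < d ->
   normc (G u v - G x y) <= K * (`|u - x| + `|v - y|)].
Proof.
move=> dG; have [d d0 {}dG] := dG 1 ltr01.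
have := normc_ge0 p; have := normc_ge0 q => q0 p0.
exists d, (1 + normc p + normc q); split => //; first by lra.
move=> u v ud vd; have := dG u v ud vd; set a := (u - x)%:C; set b := (v - y)%:C => h.
have -> : G u v - G x y = (G u v - G x y - p * a - q * b) + (p * a + q * b) by ring.
rewrite (le_trans (ler_normcD _ _))// (le_trans (lerD h (ler_normcD _ _)))//.
rewrite !normcMr !normc_real mul1r.
have ux0 := normr_ge0 (u - x); have vy0 := normr_ge0 (v - y).
have := mulr_ge0 p0 vy0; have := mulr_ge0 q0 ux0; lra.
Qed.

Lemma cdiff2_comp (f : Cplx R -> Cplx R) G x y p q c : cdiff2 G x y p q -> cdiff f (G x y) c ->
  cdiff2 (fun u v => f (G u v)) x y (c * p) (c * q).
Proof.
move=> dG df e e0; have [d [K [d0 K0 lG]]] := cdiff2_lip dG.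
have c0 : 0 < 1 + normc c by have := normc_ge0 c; lra.
have [d1 d10 {}df] := df (e / (2 * K)) (divr_gt0 e0 (mulr_gt0 (ltr0n _ 2) K0)).
have [d2 d20 {}dG] := dG (e / (2 * (1 + normc c))) (divr_gt0 e0 (mulr_gt0 (ltr0n _ 2) c0)).
pose d3 := d1 / (2 * K).
exists (Num.min d (Num.min d2 d3)); first by rewrite !lt_min d0 d20 divr_gt0// mulr_gt0.
move=> u v; rewrite !lt_min => /andP[ud /andP[ud2 ud3]] /andP[vd /andP[vd2 vd3]].
have {}lG := lG u v ud vd; have {}dG := dG u v ud2 vd2.
have s0 : 0 <= `|u - x| + `|v - y| by rewrite addr_ge0.
have K1 : K * (`|u - x| + `|v - y|) < d1.
  rewrite -ltr_pdivlMl// mulrC (_ : d1 / K = d3 + d3) ?ltrD//.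
  by rewrite /d3; field; rewrite gt_eqF.
have {}df := df (G u v) (le_lt_trans lG K1).
move: dG; set a := (u - x)%:C; set b := (v - y)%:C; set D := G u v - _ - _ - _ => dG.
have -> : f (G u v) - f (G x y) - c * p * a - c * q * b =
  (f (G u v) - f (G x y) - c * (G u v - G x y)) + c * D by rewrite /D; ring.
rewrite (le_trans (ler_normcD _ _))// normcMr.
rewrite [in leRHS](_ : e = e / 2 + e / 2); last by rewrite -splitr.
rewrite [leRHS]mulrDl lerD//.
  rewrite (le_trans df)//.
  apply: (@le_trans _ _ (e / (2 * K) * (K * (`|u - x| + `|v - y|)))).
    by rewrite ler_wpM2l// ltW// divr_gt0// mulr_gt0.
  by rewrite le_eqVlt; apply/orP; left; apply/eqP; field; rewrite gt_eqF.
apply: (@le_trans _ _ ((1 + normc c) * (e / (2 * (1 + normc c)) * (`|u - x| + `|v - y|)))).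
  by apply: ler_pM => //; rewrite ?normc_ge0// lerDr.
by rewrite le_eqVlt; apply/orP; left; apply/eqP; field; rewrite gt_eqF.
Qed.

Lemma cdiff2M G H x y p q p' q' : cdiff2 G x y p q -> cdiff2 H x y p' q' ->
  cdiff2 (fun u v => G u v * H u v) x y (p * H x y + G x y * p') (q * H x y + G x y * q').
Proof.
have sqr (K : R -> R -> R[i]) a b : cdiff2 K x y a b ->
    cdiff2 (fun u v => K u v * K u v) x y (2 * K x y * a) (2 * K x y * b).
  move=> dK; apply: (@cdiff2_comp (fun w => w * w)) => //.
  apply: eq_cdiff (cdiffM (@cdiff_id _ _) (@cdiff_id _ _)) _.
  by rewrite mul1r mulr1 mulr2n mulrDl mul1r.
have cmul (K : R -> R -> R[i]) (c a b : R[i]) : cdiff2 K x y a b ->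
    cdiff2 (fun u v => c * K u v) x y (c * a) (c * b).
  move=> dK; apply: (@cdiff2_comp (fun w => c * w)) => //.
  apply: eq_cdiff (cdiffM (@cdiff_cst _ c _) (@cdiff_id _ _)) _.
  by rewrite mul0r add0r mulr1.
(* polarisation: [G H = ((G + H)^2 - G^2 - H^2) / 2] *)
move=> dG dH.
have := cmul _ 2^-1 _ _ (cdiff2D (sqr _ _ _ (cdiff2D dG dH))
  (cdiff2D (cmul _ (-1) _ _ (sqr _ _ _ dG)) (cmul _ (-1) _ _ (sqr _ _ _ dH)))).
set k := (k in cdiff2 k); set a := (a in cdiff2 _ _ _ a); set b := (b in cdiff2 _ _ _ _ b).
have -> : k = (fun u v => G u v * H u v) by apply/funext => u; apply/funext => v; rewrite /k; field.
have -> : a = p * H x y + G x y * p' by rewrite /a; field.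
by have -> : b = q * H x y + G x y * q' by rewrite /b; field.
Qed.

End TwoVariables.

(** * Complex-valued integrals and their dependence on a parameter *)

Section ComplexIntegral.
Context {R : realType}.
Implicit Types (q : R -> R[i]) (a b : R).

Definition cint a b q : R[i] :=
  itv_int a b (fun x => re (q x)) +i* itv_int a b (fun x => im (q x)).

Definition continuous_citv a b q :=
  continuous_itv a b (fun x => re (q x)) /\ continuous_itv a b (fun x => im (q x)).

Lemma cdiff2_continuous_citv a b q :
  (forall y, a <= y <= b -> exists p r, cdiff2 (fun _ v => q v) 0 y p r) ->
  continuous_citv a b q.
Proof.
move=> H; split=> y /H[p [r /cdiff2_rdiff[dr di]]].
  exact: rdiff_slicer dr.
exact: rdiff_slicer di.
Qed.

Lemma cintB a b q1 q2 : continuous_citv a b q1 -> continuous_citv a b q2 ->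
  cint a b (fun x => q1 x - q2 x) = cint a b q1 - cint a b q2.
Proof.
move=> [r1 i1] [r2 i2]; apply: complex_ext; rewrite ?(reB, imB)/= -itv_intB//;
  by congr itv_int; apply/funext => x; rewrite ?(reB, imB).
Qed.

Lemma continuous_citvB a b q1 q2 : continuous_citv a b q1 -> continuous_citv a b q2 ->
  continuous_citv a b (fun x => q1 x - q2 x).
Proof.
move=> [r1 i1] [r2 i2]; split => x xab.
  rewrite (_ : (fun x => _) = (fun x => re (q1 x) - re (q2 x))).
    by apply: cvgB; [exact: r1|exact: r2].
  by apply/funext => y; rewrite reB.
rewrite (_ : (fun x => _) = (fun x => im (q1 x) - im (q2 x))).
  by apply: cvgB; [exact: i1|exact: i2].
by apply/funext => y; rewrite imB.
Qed.

Lemma continuous_citvZ a b (c : R[i]) q : continuous_citv a b q ->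
  continuous_citv a b (fun x => c * q x).
Proof.
move=> [r1 i1]; split => x xab.
  rewrite (_ : (fun x => _) = (fun x => re c * re (q x) - im c * im (q x))).
    by apply: cvgB; apply: cvgMr; [exact: r1|exact: i1].
  by apply/funext => y; rewrite reM.
rewrite (_ : (fun x => _) = (fun x => re c * im (q x) + im c * re (q x))).
  by apply: cvgD; apply: cvgMr; [exact: i1|exact: r1].
by apply/funext => y; rewrite imM.
Qed.

Lemma itv_intZ a b c (f : R -> R) : continuous_itv a b f ->
  itv_int a b (fun x => c * f x) = c * itv_int a b f.
Proof. by move=> cf; apply: RintegralZl => //; exact: continuous_itv_integrable. Qed.

Lemma continuous_itvZ a b c (f : R -> R) : continuous_itv a b f ->
  continuous_itv a b (fun x => c * f x).
Proof. by move=> cf x xab; apply: cvgMr; exact: cf. Qed.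

Lemma cintZ a b (c : R[i]) q : continuous_citv a b q ->
  cint a b (fun x => c * q x) = c * cint a b q.
Proof.
move=> [r1 i1]; apply: complex_ext; rewrite ?(reM, imM)/=.
  rewrite -!itv_intZ// -itv_intB; [|exact: continuous_itvZ..].
  by congr itv_int; apply/funext => x; rewrite reM.
rewrite -!itv_intZ// -itv_intD; [|exact: continuous_itvZ..].
by congr itv_int; apply/funext => x; rewrite imM.
Qed.

(** The factor [2] comes from bounding the real and the imaginary part separately. *)
Lemma cint_bound a b q c : a <= b -> continuous_citv a b q ->
  (forall x, a <= x <= b -> normc (q x) <= c) -> normc (cint a b q) <= 2 * c * (b - a).
Proof.
move=> ab [r1 i1] qc; rewrite (le_trans (normc_le_reim _))//=.
rewrite mulrAC -mulrA mulr2n mulrDl mul1r mulrC; apply: lerD; apply: itv_int_bound => // x /qc.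
  by apply: le_trans; exact: normc_re.
by apply: le_trans; exact: normc_im.
Qed.

Lemma continuous_citv_bounded a b q : a <= b -> continuous_citv a b q ->
  exists2 M : R, 0 < M & forall x, a <= x <= b -> normc (q x) <= M.
Proof.
move=> ab [r1 i1].
have bnd (f : R -> R) : continuous_itv a b f ->
    exists2 M : R, 0 < M & forall x, a <= x <= b -> `|f x| <= M.
  move=> cf; have [c _ H] := EVT_max ab (continuous_itv_within cf).
  have [d _ K] := EVT_min ab (continuous_itv_within cf).
  exists (`|f c| + `|f d| + 1); first by rewrite ltr_wpDl// addr_ge0.
  move=> x xab; have /H fc : x \in `[a, b] by rewrite in_itv.
  have /K fd : x \in `[a, b] by rewrite in_itv.
  by rewrite ler_norml; have := ler_norm (f c); have := ler_norm (- f d); rewrite normrN;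
    have := normr_ge0 (f c); have := normr_ge0 (f d); lra.
have [M1 M10 H1] := bnd _ r1; have [M2 M20 H2] := bnd _ i1.
exists (M1 + M2); first by rewrite addr_gt0.
by move=> x xab; rewrite (le_trans (normc_le_reim _))// lerD ?H1 ?H2.
Qed.

(** Differentiation under the integral sign: a remainder that is quadratic in [w - z], uniformly in
    [x], integrates to a quadratic remainder. *)
Lemma cint_cdiff a b (k : R -> Cplx R -> R[i]) (k' : R -> R[i]) z (m K : R) :
  a <= b -> 0 < m -> 0 < K ->
  (forall w, normc (w - z) < m -> continuous_citv a b (k ^~ w)) ->
  continuous_citv a b k' ->
  (forall x w, a <= x <= b -> normc (w - z) < m ->
    normc (k x w - k x z - k' x * (w - z)) <= K * normc (w - z) ^+ 2) ->
  cdiff (fun w => cint a b (k ^~ w)) z (cint a b k').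
Proof.
move=> ab m0 K0 ck ck' H e e0.
(* The [2] is that of [cint_bound]; the [1] keeps the denominator positive when [a = b]. *)
have L0 : 0 < 2 * K * (b - a) + 1 by rewrite ltr_wpDl// !mulr_ge0 ?subr_ge0// ltW.
exists (Num.min m (e / (2 * K * (b - a) + 1))); first by rewrite lt_min m0 divr_gt0.
move=> w; rewrite lt_min ltr_pdivlMr// => /andP[wm we].
have ckz : continuous_citv a b (k ^~ z) by apply: ck; rewrite subrr Normc.normc0.
rewrite [X in _ - X]mulrC -cintZ// -cintB; [|exact: ck|by []].
rewrite -cintB; [|apply: continuous_citvB => //; exact: ck|exact: continuous_citvZ].
have n0 := normc_ge0 (w - z).
apply: le_trans (cint_bound (c := K * normc (w - z) ^+ 2) ab _ _) _.
- apply: continuous_citvB; last exact: continuous_citvZ.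
  by apply: continuous_citvB => //; exact: ck.
- by move=> x xab; rewrite (mulrC (w - z)); exact: H.
- rewrite (_ : 2 * _ * _ = normc (w - z) * (2 * K * (b - a)) * normc (w - z)); last by ring.
  by rewrite ler_wpM2r// (le_trans _ (ltW we))// ler_wpM2l// lerDl.
Qed.

End ComplexIntegral.

(** * Cauchy's formula and the differentiability of the derivative *)

Section Cauchy.
Context {R : realType}.
Implicit Types (f : Cplx R -> Cplx R) (z a : Cplx R).

Lemma is_derive_eps (g : R -> R) (y d : R) : is_derive y 1 g d -> forall e, 0 < e ->
  exists2 k : R, 0 < k & forall v, `|v - y| < k -> `|g v - g y - d * (v - y)| <= e * `|v - y|.
Proof.
move=> [dg gd] e e0; have := dg; rewrite /derivable => /cvgrPdist_le/(_ e e0).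
rewrite -/(derive g y 1) gd near_withinE => /nbhs_ballP[k k0 H].
exists k => // v vk.
have [->|vy] := eqVneq v y; first by rewrite !subrr mulr0 subrr !normr0 mulr0.
have h0 : v - y != 0 by rewrite subr_eq0.
have := H (v - y); rewrite /ball/= sub0r normrN => /(_ vk h0).
rewrite -[_ *: (1 : R)]/((v - y) * 1) mulr1 subrK -[_ *: _]/((v - y)^-1 * (g v - g y)).
rewrite -(ler_pM2r (_ : 0 < `|v - y|)) ?normr_gt0// -normrM mulrBl mulrAC mulVf// mul1r.
by rewrite distrC.
Qed.

Lemma rdiff_snd (g : R -> R) (x y d : R) : is_derive y 1 g d -> rdiff (fun _ v => g v) x y 0 d.
Proof.
move=> dg e e0; have [k k0 H] := is_derive_eps dg e0; exists k => // u v _ vy.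
by rewrite mul0r subr0 (le_trans (H _ vy))// ler_wpM2l ?(ltW e0)// lerDr.
Qed.

Definition circle (rho theta : R) : R[i] := (rho * cos theta) +i* (rho * sin theta).

Lemma normc_circle rho theta : 0 <= rho -> normc (circle rho theta) = rho.
Proof.
by move=> r0; rewrite normc_sqrt/= !exprMn -mulrDr cos2Dsin2 mulr1 sqrtr_sqr ger0_norm.
Qed.

Lemma cdiff2_circle rho x y : cdiff2 (fun _ v => circle rho v) x y 0 ('i * circle rho y).
Proof.
rewrite (_ : 'i * circle rho y = (- (rho * sin y)) +i* (rho * cos y)); last first.
  by apply: complex_ext; rewrite ?(reM, imM)/= ?mul0r ?mul1r ?sub0r ?add0r.
apply: (rdiff_cdiff2 (p := 0) (p' := 0)); apply: rdiff_snd.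
  rewrite -mulrN; exact: (is_deriveZ _ (is_derive_cos y)).
Qed.

Section CauchyFormula.
Variables (f : Cplx R -> Cplx R) (z : Cplx R) (r : R).
Hypothesis (r0 : 0 < r) (fd : forall w, normc (w - z) < r -> derivable f w 1).
Let rho := r / 2.
Let rho0 : 0 < rho. Proof. by rewrite divr_gt0. Qed.

(** The form [dw / (w - a)] on the circle [w = z + circle (r / 2) th]. *)
Definition cauchy_ker (a : Cplx R) (th : R) : R[i] :=
  'i * circle (r / 2) th * (circle (r / 2) th + (z - a))^-1.

Let den_neq0 a th : normc (a - z) < rho -> circle rho th + (z - a) != 0.
Proof.
move=> az; rewrite -normc_gt0.
have -> : circle rho th + (z - a) = circle rho th - (a - z) by ring.
have := ler_normc_dist (circle rho th) (a - z); rewrite normc_circle ?(ltW rho0)//.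
by apply: lt_le_trans; rewrite subr_gt0.
Qed.

Let ker_cdiff2 a x y : normc (a - z) < rho -> exists q, cdiff2 (fun _ v => cauchy_ker a v) x y 0 q.
Proof.
move=> az; have d1 := cdiff2M (cdiff2_cst 'i x y) (cdiff2_circle rho x y).
have d2 := cdiff2D (cdiff2_circle rho x y) (cdiff2_cst (z - a) x y).
have d3 := cdiff2_comp d2 (cdiff_inv (den_neq0 y az)).
have := cdiff2M d1 d3; rewrite !(mul0r, mulr0, addr0) => H.
by eexists; exact: H.
Qed.

(** The straight homotopy from the point [a] at [u = 0] to the circle around [z] at [u = 1]. *)
Let Phi a (u v : R) : R[i] := a + u%:C * (circle rho v + (z - a)).

Let Phi_in a u v : normc (a - z) < rho -> 0 <= u <= 1 -> normc (Phi a u v - z) < r.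
Proof.
move=> az /andP[u0 u1].
have -> : Phi a u v - z = (1 - u)%:C * (a - z) + u%:C * circle rho v.
  by rewrite /Phi rmorphB/=; ring.
rewrite (le_lt_trans (ler_normcD _ _))// !normcMr !normc_real normc_circle ?(ltW rho0)//.
rewrite !ger0_norm ?subr_ge0//.
have := ler_wpM2l (_ : 0 <= 1 - u) (ltW az); rewrite subr_ge0 => /(_ u1).
have -> : r = rho + rho by rewrite /rho -splitr.
by have := rho0; lra.
Qed.

Let Phi_cdiff2 a x y : cdiff2 (Phi a) x y (circle rho y + (z - a)) (x%:C * ('i * circle rho y)).
Proof.
have d2 := cdiff2D (cdiff2_circle rho x y) (cdiff2_cst (z - a) x y).
have := cdiff2D (cdiff2_cst a x y) (cdiff2M (cdiff2_fst x y) d2).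
by rewrite !(mul0r, mulr0, addr0, add0r, mul1r).
Qed.

(** The form [f(w) dw / (w - a)], closed off [a], is pulled back by [Phi] to [A du + B dv].
    Goursat's lemma applies on [[t, 1] x [0, 2 pi]]; the sides [v = 0] and [v = 2 pi] cancel by
    periodicity, and the other two are the integrals compared. *)
Let int_const a t : normc (a - z) < rho -> 0 < t <= 1 ->
  cint 0 (2 * pi) (fun v => f (Phi a t v) * cauchy_ker a v) =
  cint 0 (2 * pi) (fun v => f (Phi a 1 v) * cauchy_ker a v).
Proof.
move=> az /andP[t0 t1].
pose A u v := f (Phi a u v) * (u%:C)^-1; pose B u v := f (Phi a u v) * cauchy_ker a v.
have dAB x y : t <= x <= 1 -> exists p q s, cdiff2 A x y p q /\ cdiff2 B x y q s.
  move=> /andP[tx x1].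
  have x01 : 0 <= x <= 1 by rewrite x1 (le_trans (ltW t0)).
  have dPhi := cdiff2_comp (Phi_cdiff2 a x y) (derivable_cdiff (fd (Phi_in y az x01))).
  have [k dk] := ker_cdiff2 x y az.
  have x0 : x%:C != 0 :> R[i].
    by rewrite -normc_gt0 normc_real normr_gt0 gt_eqF// (lt_le_trans t0).
  have dA := cdiff2M dPhi (cdiff2_comp (cdiff2_fst x y) (cdiff_inv x0)).
  have dB := cdiff2M dPhi dk.
  do 3 eexists; split; first exact: dA.
  (* Both mixed derivatives equal [f'(Phi a x y) * 'i * circle rho y]: the form is closed. *)
  apply: (eq_cdiff2 dB).
  rewrite !mulr0 !addr0 /cauchy_ker -!mulrA; congr (_ * _).
  have h1 := den_neq0 y az.
  by field; rewrite x0 h1.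
have perA u : A u 0 = A u (2 * pi).
  rewrite /A /Phi /circle; congr (f (_ + _ * (_ + _)) / _).
  by rewrite mulr_natl cos2pi sin2pi cos0 sin0.
have pi0 : 0 <= 2 * pi :> R by rewrite mulr_ge0// pi_ge0.
have G (S : R[i] -> R) : (forall x y p q, cdiff2 A x y p q -> rdiff (fun u v => S (A u v)) x y (S p) (S q)) ->
    (forall x y p q, cdiff2 B x y p q -> rdiff (fun u v => S (B u v)) x y (S p) (S q)) ->
    itv_int 0 (2 * pi) (fun v => S (B t v)) = itv_int 0 (2 * pi) (fun v => S (B 1 v)).
  move=> SA SB.
  have := @goursat _ (fun u v => S (A u v)) (fun u v => S (B u v)) t 1 0 (2 * pi).
  move=> /(_ _ t1 pi0).
  have cf x y : t <= x <= 1 -> 0 <= y <= 2 * pi -> exists p q s,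
      rdiff (fun u v => S (A u v)) x y p q /\ rdiff (fun u v => S (B u v)) x y q s.
    move=> /(dAB x y)[p [q [s [dA dB]]]] _; exists (S p), (S q), (S s).
    by split; [exact: SA|exact: SB].
  move=> /(_ cf); rewrite /bdry_int; cbv beta.
  rewrite (_ : (fun x => S (A x 0) - _) = fun=> 0); last by apply/funext => x; rewrite perA subrr.
  rewrite itv_int_cst// mul0r add0r itv_intB.
  - by move=> /eqP; rewrite subr_eq0 => /eqP.
  - move=> y hy; have h1 : t <= (1 : R) <= 1 by rewrite t1 lexx.
    have [p [q [s [_ dB]]]] := cf 1 y h1 hy.
    exact: rdiff_slicer dB.
  - move=> y hy; have h1 : t <= t <= (1 : R) by rewrite t1 lexx.
    have [p [q [s [_ dB]]]] := cf t y h1 hy.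
    exact: rdiff_slicer dB.
apply: complex_ext => /=.
  by apply: G => x y p q /cdiff2_rdiff[].
by apply: G => x y p q /cdiff2_rdiff[].
Qed.

Let ker_cont a : normc (a - z) < rho -> continuous_citv 0 (2 * pi) (cauchy_ker a).
Proof.
move=> az; apply: cdiff2_continuous_citv => y _.
by have [q H] := ker_cdiff2 0 y az; exists 0, q.
Qed.

Let int_cont a t : normc (a - z) < rho -> 0 <= t <= 1 ->
  continuous_citv 0 (2 * pi) (fun v => f (Phi a t v) * cauchy_ker a v).
Proof.
move=> az t01; apply: cdiff2_continuous_citv => y _.
have d1 := cdiff2_comp (cdiff2D (cdiff2_cst a 0 y) (cdiff2M (cdiff2_cst t%:C 0 y)
  (cdiff2D (cdiff2_circle rho 0 y) (cdiff2_cst (z - a) 0 y))))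
  (derivable_cdiff (fd (Phi_in y az t01))).
have [q dk] := ker_cdiff2 0 y az.
by eexists; eexists; exact: (cdiff2M d1 dk).
Qed.

(** The integral over the contracted circle does not change with [t > 0], and [f (Phi a t v)] tends
    to [f a] uniformly in [v] as [t] tends to 0. The integral on the right, classically [2 pi i], is
    left unevaluated: the formula will be divided by it. *)
Lemma cauchy_formula a : normc (a - z) < r / 2 ->
  cint 0 (2 * pi) (fun v => f (z + circle (r / 2) v) * cauchy_ker a v) =
  f a * cint 0 (2 * pi) (cauchy_ker a).
Proof.
rewrite -/rho => az.
have pi0 : 0 <= 2 * pi :> R by rewrite mulr_ge0// pi_ge0.
have [M M0 HM] := continuous_citv_bounded pi0 (ker_cont az).
have rr : rho < r by rewrite /rho; have := r0; lra.
have aV : normc (a - z) < r := lt_trans az rr.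
have cfa := continuousC_eps (cdiff_continuous (derivable_cdiff (fd aV))).
rewrite (_ : (fun v => _) = (fun v => f (Phi a 1 v) * cauchy_ker a v)); last first.
  by apply/funext => v; congr (f _ * _); rewrite /Phi; ring.
apply/eqP; rewrite -subr_eq0; apply/eqP/Normc.eq0_normc/eqP.
rewrite eq_le normc_ge0 andbT.
apply/ler_addgt0Pl => e e0; rewrite addr0.
have D0 : 0 < 2 * M * (2 * pi) + 1 by rewrite ltr_wpDl// mulr_ge0// mulr_ge0// ltW.
have [d d0 fad] := cfa _ (divr_gt0 e0 D0).
(* The distance from [Phi a t x] to [a] is [t * normc (circle rho x + (z - a))], and that norm is
   below [2 * r]. *)
pose t := Num.min 1 (d / (2 * r)).
have t0 : 0 < t by rewrite lt_min ltr01 divr_gt0// mulr_gt0.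
have t1 : t <= 1 by rewrite ge_min lexx.
rewrite -(@int_const a t az) ?t0// -cintZ; last exact: ker_cont.
rewrite -cintB; [|apply: int_cont => //; rewrite t1 ltW//|apply: continuous_citvZ; exact: ker_cont].
apply: le_trans (cint_bound (c := e / (2 * M * (2 * pi) + 1) * M) pi0 _ _) _.
- apply: continuous_citvB; last by apply: continuous_citvZ; exact: ker_cont.
  by apply: int_cont => //; rewrite t1 ltW.
- move=> x hx; rewrite -mulrBl normcMr ler_pM ?normc_ge0// ?HM// ltW// fad//.
  rewrite /Phi addrAC subrr add0r normcMr normc_real ger0_norm ?ltW//.
  have : normc (circle rho x + (z - a)) < 2 * r.
    rewrite (le_lt_trans (ler_normcD _ _))// normc_circle ?(ltW rho0)// normcBC.
    by move: az; rewrite /rho; have := r0; lra.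
  move=> h; rewrite (le_lt_trans (_ : _ <= d / (2 * r) * normc (circle rho x + (z - a))))//.
    by rewrite ler_wpM2r ?normc_ge0// ge_min lexx orbT.
  by rewrite mulrAC ltr_pdivrMr ?mulr_gt0// ltr_pM2l.
- have key (D : R) : 0 < D -> 2 * (e / D * M) * (2 * pi) = e * (2 * M * (2 * pi) / D).
    by move=> hD; field; rewrite gt_eqF.
  rewrite subr0 key//.
  by rewrite ler_piMr ?(ltW e0)// ler_pdivrMr// mul1r lerDl.
Qed.

End CauchyFormula.

Section CauchyTransform.
Variables (z : Cplx R) (rho : R) (q : R -> R[i]).
Hypothesis rho0 : 0 < rho.
Hypothesis dq : forall y, exists p r, cdiff2 (fun _ v => q v) 0 y p r.

Let W v (a : Cplx R) : R[i] := circle rho v + (z - a).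

Let W_ge v a : normc (a - z) < rho / 2 -> rho / 2 <= normc (W v a).
Proof.
move=> az; have -> : W v a = circle rho v - (a - z) by rewrite /W; ring.
have := ler_normc_dist (circle rho v) (a - z); rewrite normc_circle ?(ltW rho0)//.
apply: le_trans; move: az; move: (normc _) => t; lra.
Qed.

Let W_neq0 v a : normc (a - z) < rho / 2 -> W v a != 0.
Proof. by move=> /(W_ge v) h; rewrite -normc_gt0 (lt_le_trans _ h)// divr_gt0. Qed.

(** The integral of [q(v) / (w(v) - a)^n] over the circle. Differentiating in [a] raises [n] by one
    and brings down [n]; two such steps give the second derivative of [f]. *)
Definition cauchy_transform (n : nat) (a : Cplx R) : R[i] :=
  cint 0 (2 * pi) (fun v => q v * (W v a)^-1 ^+ n).

Let W_cont n a : normc (a - z) < rho / 2 ->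
  continuous_citv 0 (2 * pi) (fun v => q v * (W v a)^-1 ^+ n).
Proof.
move=> az; apply: cdiff2_continuous_citv => y _.
have [p [r dqy]] := dq y.
have d1 := cdiff2_comp (cdiff2D (cdiff2_circle rho 0 y) (cdiff2_cst (z - a) 0 y))
  (cdiff_inv (W_neq0 y az)).
have [p' [r' dn]] : exists p' r', cdiff2 (fun _ v => (W v a)^-1 ^+ n) 0 y p' r'.
  elim: n => [|n [p' [r' IH]]].
    by eexists; eexists; under eq_fun do under eq_fun do rewrite expr0; exact: cdiff2_cst.
  by eexists; eexists; under eq_fun do under eq_fun do rewrite exprS; exact: cdiff2M d1 IH.
by eexists; eexists; exact: (cdiff2M dqy dn).
Qed.

Let pi20 : 0 <= 2 * pi :> R. Proof. by rewrite mulr_ge0// pi_ge0. Qed.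

Let qM : exists2 M : R, 0 < M & forall x, 0 <= x <= 2 * pi -> normc (q x) <= M.
Proof. by apply: continuous_citv_bounded => //; apply: cdiff2_continuous_citv => y _; exact: dq. Qed.

Lemma cauchy_transform_cdiff1 a : normc (a - z) < rho / 4 ->
  cdiff (cauchy_transform 1) a (cauchy_transform 2 a).
Proof.
move=> az; have [M M0 HM] := qM.
have m0 : 0 < rho / 4 by rewrite divr_gt0.
have near w : normc (w - a) < rho / 4 -> normc (w - z) < rho / 2.
  move=> wa; have -> : w - z = (w - a) + (a - z) by ring.
  rewrite (le_lt_trans (ler_normcD _ _))//.
  have : rho / 2 = rho / 4 + rho / 4 by field.
  by move=> ->; rewrite ltrD.
have az2 : normc (a - z) < rho / 2 by apply: near; rewrite subrr Normc.normc0.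
apply: (@cint_cdiff _ _ _ (fun v w => q v * (W v w)^-1 ^+ 1) _ a (rho / 4)
  (M * ((rho / 2) ^+ 3)^-1)) => //.
- by rewrite mulr_gt0// invr_gt0 exprn_gt0// divr_gt0.
- by move=> w /near /(W_cont 1).
- exact: W_cont.
- move=> v w hv /near wz.
  have w0 := W_neq0 v wz; have a0 := W_neq0 v az2.
  have WE : W v w = W v a - (w - a) by rewrite /W; ring.
  have -> : q v * (W v w)^-1 ^+ 1 - q v * (W v a)^-1 ^+ 1 - q v * (W v a)^-1 ^+ 2 * (w - a) =
    q v * ((W v w) * (W v a) ^+ 2)^-1 * (w - a) ^+ 2.
    by move: w0; rewrite WE => w0; field; rewrite a0 w0.
  rewrite !exprS expr0 !mulr1 !normcMr ler_wpM2r ?mulr_ge0 ?normc_ge0//.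
  rewrite ler_pM ?normc_ge0 ?HM// Normc.normcV lef_pV2 ?posrE ?normc_gt0; last 2 first.
  + by rewrite !mulf_neq0.
  + by rewrite !mulr_gt0// divr_gt0.
  rewrite !normcMr.
  have h : 0 <= rho / 2 by rewrite ltW// divr_gt0.
  apply: ler_pM => //; [exact: mulr_ge0|exact: W_ge|].
  by apply: ler_pM => //; exact: W_ge.
Qed.

Lemma cauchy_transform_cdiff2 a : normc (a - z) < rho / 4 ->
  cdiff (cauchy_transform 2) a (2 * cauchy_transform 3 a).
Proof.
move=> az; have [M M0 HM] := qM.
have m0 : 0 < rho / 4 by rewrite divr_gt0.
have near w : normc (w - a) < rho / 4 -> normc (w - z) < rho / 2.
  move=> wa; have -> : w - z = (w - a) + (a - z) by ring.
  rewrite (le_lt_trans (ler_normcD _ _))//.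
  have : rho / 2 = rho / 4 + rho / 4 by field.
  by move=> ->; rewrite ltrD.
have az2 : normc (a - z) < rho / 2 by apply: near; rewrite subrr Normc.normc0.
rewrite /cauchy_transform -cintZ; last exact: W_cont.
apply: (@cint_cdiff _ _ _ (fun v w => q v * (W v w)^-1 ^+ 2) _ a (rho / 4)
  (M * (((rho / 2) ^+ 4)^-1 * 3))) => //.
- by rewrite mulr_gt0// mulr_gt0// invr_gt0 exprn_gt0// divr_gt0.
- by move=> w /near /(W_cont 2).
- by apply: continuous_citvZ; exact: W_cont.
- move=> v w hv /near wz.
  have w0 := W_neq0 v wz; have a0 := W_neq0 v az2.
  have WE : W v w = W v a - (w - a) by rewrite /W; ring.
  (* The remainder consists of three terms, two of them equal, with four factors [W] in each
     denominator; every factor is at least [rho / 2], whence [3 / (rho / 2) ^+ 4]. *)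
  have -> : q v * (W v w)^-1 ^+ 2 - q v * (W v a)^-1 ^+ 2 - 2 * (q v * (W v a)^-1 ^+ 3) * (w - a) =
    q v * (((W v w) * (W v w) * ((W v a) * (W v a)))^-1 +
      2 * ((W v w) * (W v a) * ((W v a) * (W v a)))^-1) * (w - a) ^+ 2.
    by move: w0; rewrite WE => w0; field; rewrite a0 w0.
  have inv_le x y : normc (x - z) < rho / 2 -> normc (y - z) < rho / 2 ->
      normc (((W v x) * (W v y) * ((W v a) * (W v a)))^-1) <= ((rho / 2) ^+ 4)^-1.
    move=> xz yz; have h : 0 <= rho / 2 by rewrite ltW// divr_gt0.
    rewrite Normc.normcV lef_pV2 ?posrE ?normc_gt0; last 2 first.
    + by rewrite !mulf_neq0// W_neq0.
    + by rewrite exprn_gt0// divr_gt0.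
    rewrite !normcMr (_ : _ ^+ 4 = (rho / 2 * (rho / 2)) * (rho / 2 * (rho / 2))); last by ring.
    by apply: ler_pM; [exact: mulr_ge0|exact: mulr_ge0| |]; apply: ler_pM => //; exact: W_ge.
  rewrite normcMr normcMr (_ : normc ((w - a) ^+ 2) = normc (w - a) ^+ 2); last first.
    by rewrite !expr2 normcMr.
  apply: ler_wpM2r; first by rewrite exprn_ge0// normc_ge0.
  apply: ler_pM; rewrite ?normc_ge0 ?HM//.
  rewrite (le_trans (ler_normcD _ _))// normcMr.
  have -> : normc (2 : R[i]) = 2.
    by rewrite -[2 : R[i]](rmorph_nat (real_complex R)) normc_real ger0_norm.
  have add3 (s t u : R) : s <= u -> t <= u -> s + 2 * t <= u * 3 by lra.
  by apply: add3; exact: inv_le.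
Qed.

End CauchyTransform.

(** By Cauchy's formula [f] is near [z] the quotient of two Cauchy transforms, [N 1] with density
    [f(w) dw] and [C 1] with density [dw]. Both can be differentiated twice, and the denominator
    does not vanish near [z]. *)
Lemma derivable_derive f z (r : R) : 0 < r ->
  (forall w, normc (w - z) < r -> derivable f w 1) -> derivable (fun w => 'D_1 f w) z 1.
Proof.
move=> r0 fd; have rho0 : 0 < r / 2 by rewrite divr_gt0.
pose q1 v := 'i * circle (r / 2) v; pose q v := f (z + circle (r / 2) v) * q1 v.
have dq1 y : exists p s, cdiff2 (fun _ v => q1 v) 0 y p s.
  by eexists; eexists; exact: (cdiff2M (cdiff2_cst 'i 0 y) (cdiff2_circle (r / 2) 0 y)).
have dq y : exists p s, cdiff2 (fun _ v => q v) 0 y p s.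
  have [p [s d1]] := dq1 y.
  have zr : normc (z + circle (r / 2) y - z) < r.
    by rewrite addrAC subrr add0r normc_circle ?(ltW rho0)//; move: r0; lra.
  have d2 := cdiff2_comp (cdiff2D (cdiff2_cst z 0 y) (cdiff2_circle (r / 2) 0 y))
    (derivable_cdiff (fd _ zr)).
  by eexists; eexists; exact: (cdiff2M d2 d1).
pose N := cauchy_transform z (r / 2) q; pose C := cauchy_transform z (r / 2) q1.
have fE a : normc (a - z) < r / 2 -> N 1%N a = f a * C 1%N a.
  move=> az; have := cauchy_formula r0 fd az.
  rewrite /N /C /cauchy_transform /cauchy_ker /q.
  under [in X in X -> _]eq_fun do rewrite mulrA.
  by under [in X in _ -> X]eq_fun do rewrite expr1; under [in X in _ -> _ = _ * X]eq_fun do rewrite expr1.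
have r80 : 0 < r / 2 / 4 by rewrite !divr_gt0.
have N1 a := cauchy_transform_cdiff1 rho0 dq (z := z) (a := a).
have N2 a := cauchy_transform_cdiff2 rho0 dq (z := z) (a := a).
have C1 a := cauchy_transform_cdiff1 rho0 dq1 (z := z) (a := a).
have C2 a := cauchy_transform_cdiff2 rho0 dq1 (z := z) (a := a).
have zz s : 0 < s -> normc (z - z) < s by rewrite subrr Normc.normc0.
(* At the centre the integrand is constantly ['i], so that [C 1 z] is [2 pi i]. *)
have C0 : C 1%N z != 0.
  rewrite /C /cauchy_transform.
  rewrite (_ : (fun v => _) = fun=> 'i); last first.
    apply/funext => v; rewrite /q1 expr1 subrr addr0 mulfK//.
    by rewrite -normc_gt0 normc_circle ?(ltW rho0).
  rewrite /cint/= !itv_int_cst ?mulr_ge0 ?pi_ge0// mul0r mul1r subr0.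
  by apply/eqP => -[] /eqP; rewrite mulf_eq0 pnatr_eq0/= gt_eqF// pi_gt0.
have nC0 : 0 < normc (C 1%N z) by rewrite normc_gt0.
have [d d0 Cd] := continuousC_eps (cdiff_continuous (C1 z (zz _ r80))) nC0.
have {}Cd a : normc (a - z) < d -> C 1%N a != 0.
  by move=> /Cd; apply: contraTneq; rewrite /C => ->; rewrite sub0r normcNE ltxx.
pose s := Num.min d (r / 2 / 4); have s0 : 0 < s by rewrite lt_min d0.
pose D a := N 2%N a * (C 1%N a)^-1 + N 1%N a * (- (C 1%N a * C 1%N a)^-1 * C 2%N a).
have fD a : normc (a - z) < s -> cdiff f a (D a).
  rewrite lt_min => /andP[ad ar].
  apply: near_cdiff (cdiffM (N1 a ar) (cdiffV (C1 a ar) (Cd a ad))).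
  apply/nbhs_normc; exists (s - normc (a - z)); first by rewrite subr_gt0 lt_min ad.
  move=> w; rewrite ltrBrDr => ws.
  have : normc (w - z) < s.
    by rewrite (le_lt_trans _ ws)// (le_trans _ (ler_normcD _ _))// addrA subrK.
  rewrite lt_min => /andP[wd wr].
  have wr2 : normc (w - z) < r / 2 by rewrite (lt_le_trans wr)// ler_pdivrMr// ler_peMr ?ltW// ltr1n.
  have := fE _ wr2; rewrite /N /C => ->; rewrite mulfK//; exact: Cd.
have z8 := zz _ r80.
have dD := cdiffD (cdiffM (N2 z z8) (cdiffV (C1 z z8) C0))
  (cdiffM (N1 z z8) (cdiffM (cdiffZ (-1) (cdiffV (cdiffM (C1 z z8) (C1 z z8)) (mulf_neq0 C0 C0))) (C2 z z8))).
apply: (cdiff_derivable (near_cdiff _ dD)).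
apply/nbhs_normc; exists s => // w ws.
by rewrite (cdiff_derive (fD w ws)) /D mulN1r.
Qed.

End Cauchy.

(** * Test functions *)

Section FlatExponential.
Context {R : realType}.
Implicit Types (t x a b : R) (m n : nat) (u v : R -> R).

(* The family [flat n t = t^-n exp (-1/t)], extended by [0] to [t <= 0], is
   stable under differentiation up to linear combinations. *)
Definition flat n t : R := if 0 < t then t^-1 ^+ n * expR (- t^-1) else 0.

Lemma flat_ge0 n t : 0 <= flat n t.
Proof.
by rewrite /flat; case: ifPn => // t0; rewrite mulr_ge0 ?exprn_ge0 ?invr_ge0 ?expR_ge0// ltW.
Qed.

Lemma flat_gt0 n t : 0 < t -> 0 < flat n t.
Proof. by move=> t0; rewrite /flat t0 mulr_gt0 ?exprn_gt0 ?invr_gt0 ?expR_gt0. Qed.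

Lemma flat_le0 n t : t <= 0 -> flat n t = 0.
Proof. by rewrite /flat leNgt => /negbTE ->. Qed.

(** For [t > 0], with [s = t^-1], [exp s = exp (s / n.+1) ^+ n.+1 >= (s / n.+1) ^+ n.+1]; this is
    the origin of the constant. *)
Lemma flat_bound n : exists2 C : R, 0 < C & forall t, flat n t <= C * `|t|.
Proof.
exists (n.+1%:R ^+ n.+1); first by rewrite exprn_gt0.
move=> t; have [t0|t0] := ltP 0 t; last first.
  by rewrite flat_le0// mulr_ge0.
rewrite /flat t0 (gtr0_norm t0) expRN -ler_pdivlMr ?invr_gt0 ?expR_gt0// invrK.
have -> : expR t^-1 = expR (t^-1 / n.+1%:R) ^+ n.+1 by rewrite -expRM_natr divfK.
have h : t^-1 / n.+1%:R <= expR (t^-1 / n.+1%:R).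
  by rewrite (le_trans _ (expR_ge1Dx _))// lerDr.
have h0 : 0 <= t^-1 / n.+1%:R by rewrite divr_ge0// invr_ge0 ltW.
apply: (@le_trans _ _ (n.+1%:R ^+ n.+1 * t * (t^-1 / n.+1%:R) ^+ n.+1)).
  rewrite le_eqVlt; apply/orP; left; apply/eqP.
  rewrite -[in RHS]mulrA mulrCA -exprMn mulrCA mulfV// mulr1.
  by rewrite exprS mulrA mulfV ?mul1r// gt_eqF.
rewrite ler_pM2l ?mulr_gt0 ?exprn_gt0//.
by rewrite lerXn2r ?nnegrE// expR_ge0.
Qed.

Lemma is_derive1_compR (g f : R -> R) x (a b : R) :
  is_derive x 1 f a -> is_derive (f x) 1 g b -> is_derive x 1 (g \o f) (b * a).
Proof.
move=> [df fa] [dg gb]; split.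
  by apply/derivable1_diffP; apply: differentiable_comp; exact/derivable1_diffP.
by rewrite -derive1E derive1_comp// !derive1E fa gb.
Qed.

Lemma is_derive_flat n t : is_derive t 1 (flat n) (flat n.+2 t - n%:R * flat n.+1 t).
Proof.
have [t0|t0|->] := ltgtP t 0.
- rewrite !flat_le0 ?(ltW t0)// mulr0 subr0.
  apply: (@near_eq_is_derive _ _ _ (cst 0)) => //.
  near=> s; rewrite flat_le0//; apply: ltW; near: s; exact: lt_nbhsl.
- rewrite /flat t0.
  apply: (@near_eq_is_derive _ _ _ (fun s : R => s^-1 ^+ n * expR (- s^-1))).
    near=> s; rewrite ifT//; near: s; exact: lt_nbhsr.
  have tn0 : t != 0 by rewrite gt_eqF.
  have dV : is_derive t 1 (fun s : R => s^-1) (- t ^- 2).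
    by have := is_deriveV tn0 (is_derive_id t (1 : R)); rewrite scaler1.
  have dE : is_derive t 1 (fun s => expR (- s^-1)) (expR (- t^-1) * t ^- 2).
    have dN : is_derive t 1 (fun s : R => - s^-1) (t ^- 2).
      by have := is_deriveN dV; rewrite opprK.
    exact: (is_derive1_compR dN (is_derive_expR (- t^-1))).
  have dX : is_derive t 1 (fun s : R => s^-1 ^+ n) (n%:R * t^-1 ^+ n.-1 * - t ^- 2).
    by have := is_deriveX n dV; rewrite exprfctE.
  apply: (is_derive_eq (is_deriveM dX dE)); rewrite -![_ *: _]/(_ * _).
  case: n {dX} => [|n].
    by rewrite !mul0r mulr0 addr0 subr0 !expr0 mul1r mulrC -exprVn.
  by rewrite /= -exprVn !exprS; field.
(* At [0] the difference quotient is [flat n.+1 h] for [h > 0] and [0] for [h < 0]; [flat_bound]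
   makes it tend to 0. *)
- rewrite !flat_le0// mulr0 subrr.
  have [C C0 HC] := flat_bound n.+1.
  have cv : h^-1 *: ((flat n \o shift 0) (h *: 1) - flat n 0) @[h --> 0^'] --> (0 : R).
    apply/cvgrPdist_le => e e0; rewrite near_withinE; near=> h => h0.
    rewrite sub0r normrN /= addr0 (flat_le0 n (lexx 0)) subr0.
    rewrite -[h *: (1 : R)]/(h * 1) mulr1 -[_ *: _]/(_ * _).
    have [hp|hn] := ltP 0 h; last by rewrite flat_le0// mulr0 normr0 ltW.
    have -> : h^-1 * flat n h = flat n.+1 h by rewrite /flat hp mulrA -exprS.
    rewrite ger0_norm ?flat_ge0// (le_trans (HC h))// -ler_pdivlMl//.
    near: h; apply/nbhs_ballP; exists (C^-1 * e); first by rewrite /= mulr_gt0// invr_gt0.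
    by move=> y; rewrite /ball/= sub0r normrN => /ltW.
  by split; [apply/cvg_ex; exists 0|exact: cvg_lim cv].
Unshelve. all: by end_near. Qed.

Lemma is_derive_shift (u : R -> R) x c d : is_derive (x - c) 1 u d ->
  is_derive x 1 (fun y => u (y - c)) d.
Proof.
move=> du; have dx : is_derive x 1 (fun y : R => y - c) 1.
  by have := is_deriveB (is_derive_id x (1 : R)) (is_derive_cst c x (1 : R)); rewrite subr0.
by have := is_derive1_compR (f := fun y => y - c) dx du; rewrite mulr1.
Qed.

Lemma is_derive_rshift (u : R -> R) x c d : is_derive (c - x) 1 u d ->
  is_derive x 1 (fun y => u (c - y)) (- d).
Proof.
move=> du; have dx : is_derive x 1 (fun y : R => c - y) (- 1).
  by have := is_deriveB (is_derive_cst c x (1 : R)) (is_derive_id x (1 : R)); rewrite sub0r.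
by have := is_derive1_compR (f := fun y => c - y) dx du; rewrite mulrN1.
Qed.

Definition flat_bump a b m n x := flat m (x - a) * flat n (b - x).

(** The linear span of the bumps with given end points. It contains the derivatives of its members,
    so a fact proved for the class holds for the derivatives of all orders. *)
Inductive bump_function a b : (R -> R) -> Prop :=
| bump_flat m n : bump_function a b (flat_bump a b m n)
| bump_add u v : bump_function a b u -> bump_function a b v -> bump_function a b (fun x => u x + v x)
| bump_scale c u : bump_function a b u -> bump_function a b (fun x => c * u x).

Lemma is_derive_flat_bump a b m n x : is_derive x 1 (flat_bump a b m n)
  ((flat_bump a b m.+2 n x + - m%:R * flat_bump a b m.+1 n x)
   + (-1) * (flat_bump a b m n.+2 x + - n%:R * flat_bump a b m n.+1 x)).
Proof.
have d1 := is_derive_shift (is_derive_flat m (x - a)).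
have d2 := is_derive_rshift (is_derive_flat n (b - x)).
apply: (is_derive_eq (is_deriveM d1 d2)).
by rewrite -![_ *: _]/(_ * _) /flat_bump; ring.
Qed.

Lemma bump_derive a b u : bump_function a b u ->
  (forall x, is_derive x 1 u (derive1 u x)) /\ bump_function a b (derive1 u).
Proof.
elim=> {u} [m n|u v _ [du bu] _ [dv bv]|c u _ [du bu]].
- have dE : derive1 (flat_bump a b m n) = fun x =>
      (flat_bump a b m.+2 n x + - m%:R * flat_bump a b m.+1 n x)
      + (-1) * (flat_bump a b m n.+2 x + - n%:R * flat_bump a b m n.+1 x).
    by apply/funext => x; rewrite derive1E; case: (is_derive_flat_bump a b m n x).
  split; first by move=> x; rewrite dE; exact: is_derive_flat_bump.
  by rewrite dE; do !(apply: bump_add || apply: bump_scale || apply: bump_flat).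
- have dE : derive1 (fun x => u x + v x) = fun x => derive1 u x + derive1 v x.
    by apply/funext => x; rewrite derive1E; case: (is_deriveD (du x) (dv x)).
  by split; [move=> x; rewrite dE; exact: is_deriveD|rewrite dE; exact: bump_add].
- have dE : derive1 (fun x => c * u x) = fun x => c * derive1 u x.
    by apply/funext => x; rewrite derive1E; case: (is_deriveZ c (du x)).
  by split; [move=> x; rewrite dE; exact: is_deriveZ|rewrite dE; exact: bump_scale].
Qed.

Lemma bump_out a b u x : bump_function a b u -> ~ (a < x < b) -> u x = 0.
Proof.
move=> bu xab; elim: bu => {u} [m n|u v _ -> _ ->|c u _ ->]; rewrite ?addr0 ?mulr0//.
rewrite /flat_bump; have [xa|xa] := leP x a; first by rewrite flat_le0 ?mul0r// subr_le0.
rewrite [X in _ * X]flat_le0 ?mulr0// subr_le0 leNgt; apply/negP => xb.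
by apply: xab; rewrite xa.
Qed.

Lemma bump_continuous a b u : bump_function a b u -> continuous u.
Proof.
move=> /bump_derive[du _] x; apply: differentiable_continuous.
by apply/derivable1_diffP; case: (du x).
Qed.

Lemma bump_bounded a b u : bump_function a b u -> exists2 M : R, 0 < M & forall x, `|u x| <= M.
Proof.
move=> bu; have [ab|ab] := leP a b; last first.
  exists 1 => // x; rewrite (bump_out bu) ?normr0// => /andP[ax xb].
  by move: (lt_trans ax xb); rewrite ltNge ltW.
have cu : {within `[a, b], continuous u} by apply: continuous_subspaceT; exact: bump_continuous bu.
have [c _ H] := EVT_max ab cu; have [d _ K] := EVT_min ab cu.
exists (`|u c| + `|u d| + 1); first by rewrite ltr_wpDl// addr_ge0.
move=> x; have := normr_ge0 (u c); have := normr_ge0 (u d).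
have [xab|nxab] := pselect (a < x < b); last by rewrite (bump_out bu nxab) normr0; lra.
have xab' : x \in `[a, b] by rewrite in_itv/=; case/andP: xab => /ltW -> /ltW ->.
have := H _ xab'; have := K _ xab'.
rewrite ler_norml; have := ler_norm (u c); have := ler_norm (- u d); rewrite normrN; lra.
Qed.

Lemma bump_lipschitz a b u : bump_function a b u -> exists2 M : R, 0 < M &
  forall x y, `|u y - u x| <= M * `|y - x|.
Proof.
move=> bu; have [du bdu] := bump_derive bu; have [M M0 HM] := bump_bounded bdu.
exists M => // x y; wlog xy : x y / x <= y.
  by move=> W; have [/W//|/ltW/W] := leP x y; rewrite distrC (distrC x).
have [|c _ ->] := @MVT_segment _ u (derive1 u) x y xy.
  by apply: continuous_subspaceT; exact: bump_continuous bu.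
by rewrite normrM ler_wpM2r.
Qed.

(** The mean value theorem for [u], followed by the Lipschitz bound of [derive1 u]. The constant is
    uniform in [x], which later allows differentiation under the integral sign. *)
Lemma bump_taylor a b u : bump_function a b u -> exists2 M : R, 0 < M &
  forall x h, `|u (x + h) - u x - derive1 u x * h| <= M * h ^+ 2.
Proof.
move=> bu; have [du bdu] := bump_derive bu; have [M M0 HM] := bump_lipschitz bdu.
have cu := bump_continuous bu.
exists M => // x h.
have key y z : y <= z -> exists2 c, y <= c <= z & u z - u y = derive1 u c * (z - y).
  move=> yz; have [|c cyz E] := @MVT_segment _ u (derive1 u) y z yz.
    by apply: continuous_subspaceT.
  by exists c => //; rewrite in_itv in cyz.
have [h0|h0] := leP 0 h.
  have [|c /andP[xc ch] ->] := key x (x + h); first by rewrite lerDl.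
  rewrite (_ : x + h - x = h); last by ring.
  rewrite -mulrBl normrM (ger0_norm h0) expr2 mulrA; apply: ler_wpM2r => //.
  rewrite (le_trans (HM _ _))// ler_wpM2l ?(ltW M0)//.
  by rewrite ger0_norm ?subr_ge0// lerBlDl.
have [|c /andP[xc ch] E] := key (x + h) x; first by rewrite gerDl ltW.
have -> : u (x + h) - u x - derive1 u x * h = (derive1 u c - derive1 u x) * h.
  rewrite (_ : u (x + h) - u x = - (u x - u (x + h))); last by ring.
  by rewrite E; ring.
rewrite normrM -(real_normK (num_real h)) expr2 mulrA; apply: ler_wpM2r => //.
rewrite (le_trans (HM _ _))// ler_wpM2l ?(ltW M0)// (ltr0_norm h0).
by rewrite ler0_norm ?subr_le0//; lra.
Qed.

End FlatExponential.

(** * Products of bumps as test functions *)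

Section TensorBump.
Context {R : realType}.
Implicit Types (z w : Cplx R) (u v : R -> R).

Definition tensor u v z : R := u (re z) * v (im z).

Definition box (a b c d : R) : set (Cplx R) := [set z | a <= re z <= b /\ c <= im z <= d].

Lemma continuous_re : continuous (fun z : Cplx R => re z).
Proof.
move=> z; apply/(@cvgrPdist_le _ R _ (nbhs z)) => e e0; apply/nbhs_normc.
exists e => // w we; rewrite -reB (le_trans (normc_re _))// normcBC; exact: ltW.
Qed.

Lemma continuous_im : continuous (fun z : Cplx R => im z).
Proof.
move=> z; apply/(@cvgrPdist_le _ R _ (nbhs z)) => e e0; apply/nbhs_normc.
exists e => // w we; rewrite -imB (le_trans (normc_im _))// normcBC; exact: ltW.
Qed.

Lemma continuous_complex : continuous (fun p : R * R => (p.1 +i* p.2 : Cplx R)).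
Proof.
move=> p; apply/cvgrPdist_le => -[e e']; rewrite ltcE/= => /andP[/eqP e'0 e0].
subst e'; have e2 : 0 < e / 2 by rewrite divr_gt0.
exists (ball p.1 (e / 2), ball p.2 (e / 2)); first by split; exact: nbhsx_ballx.
move=> q [/= q1 q2].
rewrite -/(e%:C) normcC lecR (le_trans (normc_le_reim _))//=.
by rewrite (splitr e) lerD// ltW.
Qed.

Lemma box_compact a b c d : compact (box a b c d).
Proof.
have -> : box a b c d = (fun p : R * R => (p.1 +i* p.2 : Cplx R)) @` (`[a, b] `*` `[c, d]).
  apply/seteqP; split => [z [h1 h2]|_ [[x y] [/= h1 h2] <-]].
    by exists (re z, im z); rewrite /= ?in_itv//; case: z h1 h2.
  by move: h1 h2; rewrite !in_itv.
apply: continuous_compact.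
  by apply: continuous_subspaceT; exact: continuous_complex.
by apply: compact_setX; exact: segment_compact.
Qed.

Lemma box_closed a b c d : closed (box a b c d).
Proof. by apply: compact_closed; [exact: norm_hausdorff|exact: box_compact]. Qed.

Lemma continuous_tensor u v : continuous u -> continuous v -> continuous (tensor u v).
Proof.
move=> cu cv z.
have h1 : {for z, continuous (fun w : Cplx R => u (re w))}.
  by apply: (@continuous_comp _ _ _ (fun w : Cplx R => re w) u); [exact: continuous_re|exact: cu].
have h2 : {for z, continuous (fun w : Cplx R => v (im w))}.
  by apply: (@continuous_comp _ _ _ (fun w : Cplx R => im w) v); [exact: continuous_im|exact: cv].
exact: (@continuousM R (Cplx R) _ _ z h1 h2).
Qed.

(** Each partial derivative acts on one factor and keeps it in its class, so that the mixed partials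
    in [smooth_real] are again products of bumps. *)
Lemma mixed_partial_tensor a b c d u v s : bump_function a b u -> bump_function c d v ->
  exists u' v', [/\ bump_function a b u', bump_function c d v' & mixed_partial s (tensor u v) = tensor u' v'].
Proof.
move=> bu bv; elim: s => [|x s [u' [v' [bu' bv' E]]]]; first by exists u, v.
have [du bdu] := bump_derive bu'; have [dv bdv] := bump_derive bv'.
rewrite /= E; case: x.
  exists (derive1 u'), v'; split => //; apply/funext => z.
  rewrite /rpartial_x /horizontal /tensor/= derive1E.
  by have [_ ->] := is_deriveM (du (re z)) (is_derive_cst (v' (im z)) (re z) (1 : R)); rewrite scaler0 add0r mulrC.
exists u', (derive1 v'); split => //; apply/funext => z.
rewrite /rpartial_y /vertical /tensor/= derive1E.
by have [_ ->] := is_deriveZ (u' (re z)) (dv (im z)).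
Qed.

Lemma smooth_real0 : smooth_real (fun _ : Cplx R => 0).
Proof.
have E s : mixed_partial s (fun _ : Cplx R => 0) = fun=> 0.
  elim: s => //= -[] s ->; apply/funext => z.
    by rewrite /rpartial_x /horizontal derive1_cst.
  by rewrite /rpartial_y /vertical derive1_cst.
move=> s; rewrite E; split; first exact: cst_continuous.
by move=> z; split; exact: derivable_cst.
Qed.

Lemma smooth_real_tensor a b c d u v : bump_function a b u -> bump_function c d v -> smooth_real (tensor u v).
Proof.
move=> bu bv s; have [u' [v' [bu' bv' ->]]] := mixed_partial_tensor s bu bv.
have [du bdu] := bump_derive bu'; have [dv bdv] := bump_derive bv'.
split.
  by apply: continuous_tensor; [exact: bump_continuous bu'|exact: bump_continuous bv'].
move=> z; split.
  by have [] := is_deriveM (du (re z)) (is_derive_cst (v' (im z)) (re z) (1 : R)).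
by have [] := is_deriveZ (u' (re z)) (dv (im z)).
Qed.

Lemma tensor_test_function (U : set (Cplx R)) a b c d u v : bump_function a b u -> bump_function c d v ->
  box a b c d `<=` U -> test_function U (fun z => (tensor u v z)%:C).
Proof.
move=> bu bv boxU.
have sb : Defs.support (fun z : Cplx R => (tensor u v z)%:C : Cplx R) `<=` box a b c d.
  have /closure_id -> := @box_closed a b c d.
  apply: closure_subset => z /=; apply: contraNP => nb.
  have : u (re z) = 0 \/ v (im z) = 0.
    have [/andP[a1 b1]|n1] := pselect (a < re z < b); last by left; exact: bump_out bu n1.
    have [/andP[c1 d1]|n2] := pselect (c < im z < d); last by right; exact: bump_out bv n2.
    by exfalso; apply: nb; rewrite /box/= !ltW.
  by rewrite /tensor => -[] ->; rewrite ?mul0r ?mulr0.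
split.
- split; first exact: (smooth_real_tensor bu bv).
  exact: smooth_real0.
- by apply: subclosed_compact sb; [exact: closed_closure|exact: box_compact].
- exact: subset_trans boxU.
Qed.

Lemma dbar_tensor a b c d u v z : bump_function a b u -> bump_function c d v ->
  dbar (fun z => (tensor u v z)%:C) z =
  2^-1 * (tensor (derive1 u) v z +i* tensor u (derive1 v) z).
Proof.
move=> /bump_derive[du _] /bump_derive[dv _]; rewrite /dbar; congr (_ * _).
have -> : partial_x (fun z => (tensor u v z)%:C : Cplx R) z = tensor (derive1 u) v z +i* 0.
  rewrite /partial_x/=; congr (_ +i* _); last by rewrite /rpartial_x /horizontal derive1_cst.
  rewrite /rpartial_x /horizontal /tensor/= derive1E.
  by have [_ ->] := is_deriveM (du (re z)) (is_derive_cst (v (im z)) (re z) (1 : R)); rewrite scaler0 add0r mulrC.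
have -> : partial_y (fun z => (tensor u v z)%:C : Cplx R) z = tensor u (derive1 v) z +i* 0.
  rewrite /partial_y/=; congr (_ +i* _); last by rewrite /rpartial_y /vertical derive1_cst.
  rewrite /rpartial_y /vertical /tensor/= derive1E.
  by have [_ ->] := is_deriveZ (u (re z)) (dv (im z)).
by apply: complex_ext; rewrite ?(reD, imD, reM, imM)/=; ring.
Qed.

End TensorBump.

(** * Continuity of translations in L1 *)

Section PlaneBorel.
Context {R : realType}.
(** The plane with its Borel sets; [plane R] carries the Lebesgue measurable ones. *)
Let P := (measurableTypeR R * measurableTypeR R)%type.

(** Half-planes generate the Borel sets; through them two other generating classes are recognised
    below, the quadrants and the dyadic sets. *)
Lemma measurable_plane_gen (S : set (set P)) : sigma_algebra [set: P] S ->
  (forall a, S [set p : P | a <= p.1]) -> (forall a, S [set p : P | a <= p.2]) ->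
  (measurable : set (set P)) `<=` S.
Proof.
move=> [S0 SC SU] S1 S2.
have SCT A : S A -> S (~` A) by move=> /SC; rewrite setTD.
have gen (h : P -> R) : (forall a, S [set p : P | a <= h p]) ->
    forall A : set (measurableTypeR R), measurable A -> S (h @^-1` A).
  move=> Sh A mA; have : (RGenCInfty.G (R := R)).-sigma.-measurable A.
    by rewrite -RGenCInfty.measurableE.
  suff : <<s RGenCInfty.G (R := R) >> `<=` [set B | S (h @^-1` B)] by apply.
  apply: smallest_sub.
    split=> [|B SB|F SF] /=; rewrite ?preimage_set0//.
      by rewrite setTD preimage_setC; exact: SCT.
    by rewrite preimage_bigcup; exact: SU.
  move=> _ [x ->] /=; rewrite (_ : _ @^-1` _ = [set p | x <= h p])//.
  by apply/seteqP; split => p /=; rewrite in_itv/= andbT.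
rewrite measurable_prod_measurableType; apply: smallest_sub => //.
move=> _ [A mA [B mB <-]].
have -> : A `*` B = ~` (~` (fst @^-1` A) `|` ~` (snd @^-1` B)) :> set P.
  by rewrite setCU !setCK.
apply: (SCT); rewrite -bigcup2E; apply: SU => -[|[|n]] //=.
  by apply: SCT; exact: gen.
by apply: SCT; exact: gen.
Qed.

Lemma measurable_fst_ge (a : R) : measurable [set p : P | a <= p.1].
Proof.
rewrite (_ : [set _ | _] = fst @^-1` `[a, +oo[); last first.
  by apply/seteqP; split => p /=; rewrite in_itv/= andbT.
by rewrite -[X in measurable X]setTI; apply: measurable_fst.
Qed.

Lemma measurable_snd_ge (a : R) : measurable [set p : P | a <= p.2].
Proof.
rewrite (_ : [set _ | _] = snd @^-1` `[a, +oo[); last first.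
  by apply/seteqP; split => p /=; rewrite in_itv/= andbT.
by rewrite -[X in measurable X]setTI; apply: measurable_snd.
Qed.

Lemma open_plane_measurable (A : set (R * R)) : open A -> measurable (A : set P).
Proof.
move=> oA.
(* An open set is the union of the rational boxes inside it, which [unpickle] enumerates. *)
pose B (q : (rat * rat) * (rat * rat)) : set P :=
  `]ratr q.1.1, ratr q.1.2[ `*` `]ratr q.2.1, ratr q.2.2[.
have mB q : measurable (B q) by apply: measurableX; exact: measurable_itv.
have [g gP] : exists g : nat -> option ((rat * rat) * (rat * rat)), forall q, exists n, g n = Some q.
  by exists unpickle => q; exists (pickle q); rewrite pickleK.
pose F n : set P := if g n is Some q
  then (if `[< B q `<=` A >] then B q else set0) else set0.
suff -> : A = \bigcup_n F n.
  apply: bigcup_measurable => n _; rewrite /F; case: (g n) => // q; by case: ifP.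
apply/seteqP; split => [p Ap|p [n _]]; last first.
  by rewrite /F; case: (g n) => // q; case: ifPn => // /asboolP H /H.
have /nbhs_ballP[e /= e0 eA] : nbhs p A by exact: open_nbhs_nbhs.
have near (x : R) : exists q : rat * rat, [/\ ratr q.1 < x, x < ratr q.2 &
    forall y, ratr q.1 < y < ratr q.2 -> ball x e y].
  have [q1] := @rat_in_itvoo R (x - e) x ltac:(by rewrite ltrBlDr ltrDl).
  have [q2] := @rat_in_itvoo R x (x + e) ltac:(by rewrite ltrDl).
  rewrite !in_itv/= => /andP[a1 a2] /andP[b1 b2]; exists (q1, q2); split => //= y /andP[c1 c2].
  by rewrite /ball/= ltr_norml; apply/andP; split; lra.
have [q1 [a1 b1 c1]] := near p.1; have [q2 [a2 b2 c2]] := near p.2.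
have [n gn] := gP (q1, q2); exists n => //; rewrite /F gn ifT; last first.
  apply/asboolP => y [/=]; rewrite !in_itv/= => y1 y2; apply: eA.
  by split; [exact: c1|exact: c2].
by split; rewrite /= in_itv/= ?a1 ?b1 ?a2 ?b2.
Qed.

Lemma open_fun_measurable (D : set (R * R)) (f : R * R -> R) :
  open D -> (forall p, D p -> {for p, continuous f}) ->
  measurable_fun (D : set P) (f : P -> measurableTypeR R).
Proof.
move=> oD cf; apply: (@measurability _ _ P (measurableTypeR R) D f _ (RGenOpens.measurableE R)).
move=> _ [_ [a [b ->] <-]]; apply: open_plane_measurable.
rewrite openE => p [Dp fp].
have : nbhs p (f @^-1` `]a, b[) by apply: cf => //; apply: open_nbhs_nbhs; split => //; exact: interval_open.
by have : nbhs p D by [exact: open_nbhs_nbhs]; exact: filterI.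
Qed.

Lemma continuous_plane_measurable (f : R * R -> R) : continuous f ->
  measurable_fun [set: P] (f : P -> measurableTypeR R).
Proof. by move=> cf; apply: open_fun_measurable; [exact: openT|move=> p _; exact: cf]. Qed.

Definition translate (s : P) (p : P) : P := (p.1 + s.1, p.2 + s.2).

Lemma measurable_translate s : measurable_fun [set: P] (translate s).
Proof.
by apply: measurable_fun_pair; apply: measurable_funD.
Qed.

Lemma lebesgue_measure_shift (c : R) (A : set (measurableTypeR R)) : measurable A ->
  lebesgue_measure ((fun x => x + c) @^-1` A) = lebesgue_measure A.
Proof.
move=> mA; have mc : measurable_fun [set: measurableTypeR R] (fun x : measurableTypeR R => (x + c : measurableTypeR R)).
  exact: measurable_funD.
apply/esym; apply: (@lebesgue_measure_unique _ (pushforward lebesgue_measure _)) => // _ [[a b] _ <-].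
rewrite /= /pushforward.
have -> : (fun x : measurableTypeR R => (x + c : measurableTypeR R)) @^-1` `]a, b] = [set` `](a - c), (b - c)]].
  by apply/seteqP; split => x /=; rewrite !in_itv/= ltrBlDr lerBrDr.
by rewrite !lebesgue_measure_itv/= !lte_fin ltrD2r -!EFinB; case: ifP => // _; congr EFin; ring.
Qed.

(** A product measure is determined by its values on rectangles, which reduces the claim to
    translations of the line. *)
Lemma plane_borel_translate s (A : set P) : measurable A ->
  plane_borel (translate s @^-1` A) = plane_borel A.
Proof.
move=> mA; apply/esym.
apply: (@product_measure_unique _ _ _ _ _ _ _ (pushforward plane_borel (translate s))) => //.
  exact: measurable_translate.
move=> mt B C mB mC; rewrite /= /pushforward.
have -> : translate s @^-1` (B `*` C) = ((fun x => x + s.1) @^-1` B) `*` ((fun x => x + s.2) @^-1` C) by [].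
have mS c D : measurable D -> measurable ((fun x : measurableTypeR R => (x + c : measurableTypeR R)) @^-1` D).
  by move=> mD; rewrite -[X in measurable X]setTI; apply: measurable_funD.
rewrite /plane_borel product_measure1E; [|exact: mS|exact: mS].
by congr (_ * _)%E; exact: lebesgue_measure_shift.
Qed.

End PlaneBorel.

Lemma ecvg0_lt {R : realType} (u : nat -> \bar R) (e : R) :
  u n @[n --> \oo] --> 0%E -> 0 < e -> exists n, (u n < e%:E)%E.
Proof.
move=> cu e0.
have : nbhs (0%E : \bar R) [set x | (x < e%:E)%E].
  by apply: open_nbhs_nbhs; split; [exact: open_ereal_lt_ereal|rewrite /= lte_fin].
by move=> /cu[N _ /(_ N (leqnn N)) HN]; exists N.
Qed.

(** * Measure of the difference between a Borel set and its translate *)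

Section TranslationContinuity.
Context {R : realType}.
Local Notation P := (measurableTypeR R * measurableTypeR R)%type.
Implicit Types (A B : set P) (s : P) (M e d : R).

Definition square M : set P := `[(- M), M] `*` `[(- M), M].

Lemma measurable_square M : measurable (square M).
Proof. by apply: measurableX; exact: measurable_itv. Qed.

Lemma squareP M (p : P) : square M p <-> `|p.1| <= M /\ `|p.2| <= M.
Proof. by rewrite /square/= !in_itv/= -!ler_norml. Qed.

Lemma plane_borel_rect (a b c d : R) : a <= b -> c <= d ->
  plane_borel (`[a, b] `*` `[c, d] : set P) = ((b - a) * (d - c))%:E.
Proof.
move=> ab cd; have E (x y : R) : x <= y -> lebesgue_measure (`[x, y] : set (measurableTypeR R)) = (y - x)%:E.
  move=> xy; rewrite lebesgue_measure_itv/= lte_fin.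
  by move: xy; rewrite le_eqVlt => /predU1P[->|->]; rewrite ?ltxx ?subrr.
rewrite /plane_borel product_measure1E; [|exact: measurable_itv|exact: measurable_itv].
by rewrite EFinM; congr (_ * _)%E; exact: E.
Qed.

Lemma square_fin M : (plane_borel (square M) < +oo)%E.
Proof.
have [M0|M0] := leP 0 M; first by rewrite plane_borel_rect ?ltry// ge0_cp.
rewrite (_ : square M = set0) ?measure0 ?ltry//.
apply/seteqP; split => // p /squareP[h _].
by have := normr_ge0 p.1; rewrite leNgt (le_lt_trans h M0).
Qed.

Definition shift_diff A s : set P :=
  (translate s @^-1` A `\` A) `|` (A `\` translate s @^-1` A).

Lemma measurable_preimage_translate s A : measurable A -> measurable (translate s @^-1` A).
Proof. by move=> mA; rewrite -[X in measurable X]setTI; exact: measurable_translate. Qed.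

Lemma measurable_shift_diff A s : measurable A -> measurable (shift_diff A s).
Proof.
by move=> mA; apply: measurableU; apply: measurableD => //; exact: measurable_preimage_translate.
Qed.

(** Continuity of translations for the indicator of [A], in the local L1 sense: inside a square it
    makes sense for sets of infinite measure, hence passes to complements. *)
Definition shift_small A := forall M e, 0 < e -> exists2 d, 0 < d & forall s,
  `|s.1| < d -> `|s.2| < d -> (plane_borel (square M `&` shift_diff A s) <= e%:E)%E.

Lemma shift_smallU A B : measurable A -> measurable B ->
  shift_small A -> shift_small B -> shift_small (A `|` B).
Proof.
move=> mA mB sA sB M e e0; have e2 : 0 < e / 2 by rewrite divr_gt0.
have [d1 d10 h1] := sA M _ e2; have [d2 d20 h2] := sB M _ e2.
exists (Num.min d1 d2); first by rewrite lt_min d10.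
move=> s; rewrite !lt_min => /andP[s1 s1'] /andP[s2 s2'].
have mS := measurable_square M.
have mAs := measurable_shift_diff s mA; have mBs := measurable_shift_diff s mB.
apply: (@le_trans _ _ (plane_borel ((square M `&` shift_diff A s) `|` (square M `&` shift_diff B s)))).
  apply: le_measure; rewrite ?inE.
  - by apply: measurableI => //; apply: measurable_shift_diff; exact: measurableU.
  - by apply: measurableU; exact: measurableI.
  - move=> p [Sp [[[Ap|Bp] n]|[[Ap|Bp] n]]].
    + by left; split => //; left; split => // ?; apply: n; left.
    + by right; split => //; left; split => // ?; apply: n; right.
    + by left; split => //; right; split => // ?; apply: n; left.
    + by right; split => //; right; split => // ?; apply: n; right.
apply: (le_trans (measureU2 _ _ _)); [exact: measurableI|exact: measurableI|].
by rewrite (splitr e) EFinD; apply: leeD; [exact: h1|exact: h2].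
Qed.

(** A finite union [V n] is covered by [shift_smallU]. What it misses of the whole union has small
    measure in a bounded region, and so has the translate of that part, by invariance. *)
Lemma shift_small_bigcup (F : (set P)^nat) : (forall n, measurable (F n)) ->
  (forall n, shift_small (F n)) -> shift_small (\bigcup_n F n).
Proof.
move=> mF sF M e e0; pose U := \bigcup_n F n; pose V n := \bigcup_(i < n) F i.
have mU : measurable U by exact: bigcupT_measurable.
have mV n : measurable (V n) by apply: bigcup_measurable => k _; exact: mF.
have VU n : V n `<=` U by move=> p [k _ Fk]; exists k.
have sV n : shift_small (V n).
  elim: n => [|n IH].
    rewrite /V bigcup_mkord big_ord0 => M' e' e'0; exists 1 => // s _ _.
    by rewrite /shift_diff preimage_set0 !set0D setU0 setI0 measure0 lee_fin ltW.
  rewrite /V bigcup_mkord big_ord_recr/= -bigcup_mkord; exact: (shift_smallU (mV n) (mF n) IH (sF n)).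
(* The margin [1] leaves room for translations by less than [1]; the square makes the measure
   finite, as continuity from above requires. *)
pose H n := square (M + 1) `&` (U `\` V n).
have mH n : measurable (H n) by apply: measurableI; [exact: measurable_square|exact: measurableD].
have H0 : \bigcap_n H n = set0.
  apply/seteqP; split => // p Hp; have [_ [[k _ Fk] _]] := Hp 0%N I.
  by have [_ [_]] := Hp k.+1 I; apply; exists k => //=.
have : plane_borel (H n) @[n --> \oo] --> plane_borel (\bigcap_n H n).
  apply: nonincreasing_cvg_mu => //.
  - rewrite (le_lt_trans _ (square_fin (M + 1)))//; apply: le_measure; rewrite ?inE//.
    + exact: measurable_square.
    + exact: subIsetl.
  - by rewrite H0.
  - move=> m n mn; apply/subsetPset => p [Sp [Up nV]]; split => //; split => // -[k km Fk].
    by apply: nV; exists k => //=; exact: leq_trans mn.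
rewrite H0 measure0 => cH.
have e3 : 0 < e / 3 by rewrite divr_gt0.
have [n Hn] : exists n, (plane_borel (H n) <= (e / 3)%:E)%E.
  by have [n /ltW Hn] := ecvg0_lt cH e3; exists n.
have [d d0 hd] := sV n M _ e3.
exists (Num.min d 1); first by rewrite lt_min d0 ltr01.
move=> s; rewrite !lt_min => /andP[s1 s1'] /andP[s2 s2'].
have mS := measurable_square M.
have mVs := measurable_shift_diff s (mV n).
have mHs := measurable_preimage_translate s (mH n).
apply: (@le_trans _ _ (plane_borel ((square M `&` shift_diff (V n) s) `|` (translate s @^-1` (H n) `|` H n)))).
  apply: le_measure; rewrite ?inE.
  - by apply: measurableI => //; exact: measurable_shift_diff.
  - by apply: measurableU; [exact: measurableI|exact: measurableU].
  - have SM q : square M q -> square (M + 1) q.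
      by move=> /squareP[q1 q2]; apply/squareP; lra.
    have St q : square M q -> square (M + 1) (translate s q).
      move=> /squareP[q1 q2]; apply/squareP; rewrite /translate/=.
      by split; rewrite (le_trans (ler_normD _ _))// lerD// ltW.
    move=> p [Sp [[Us nU]|[Up nU]]].
    + have [Vs|nV] := pselect (V n (translate s p)).
        by left; split => //; left; split => // /VU.
      by right; left; split; [exact: St|split].
    + have [Vs|nV] := pselect (V n p).
        by left; split => //; right; split => // /VU.
      by right; right; split; [exact: SM|split].
apply: (le_trans (measureU2 _ _ _)); [exact: measurableI|exact: measurableU|].
have -> : e%:E = ((e / 3)%:E + ((e / 3)%:E + (e / 3)%:E))%E by rewrite -!EFinD; congr EFin; field.
apply: leeD; first exact: hd.
apply: (le_trans (measureU2 _ _ _)) => //.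
apply: leeD => //; apply: le_trans Hn.
by rewrite le_eqVlt; apply/orP; left; apply/eqP; exact: plane_borel_translate.
Qed.

(** Inside the square, the quadrant and its translate differ only on two strips of width [2 * d] and
    length [2 * M] along its edges. Their total area is [8 * M * d], which dictates [d]. *)
Lemma shift_small_quadrant (a b : R) : shift_small [set p | a <= p.1 /\ b <= p.2].
Proof.
set A := [set p | _]; move=> M e e0.
have mA : measurable A by apply: measurableI; [exact: measurable_fst_ge|exact: measurable_snd_ge].
(* For [M <= 0] the square is a point or empty, hence null. *)
have [M0|M0] := ltP 0 M; last first.
  exists 1 => // s _ _; rewrite (@le_trans _ _ (plane_borel (square M)))//.
    apply: le_measure; rewrite ?inE; [|exact: measurable_square|exact: subIsetl].
    by apply: measurableI; [exact: measurable_square|exact: measurable_shift_diff].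
  have [->|Mn] := eqVneq M 0; first by rewrite /square oppr0 plane_borel_rect// subrr mul0r lee_fin ltW.
  rewrite (_ : square M = set0) ?measure0 ?lee_fin ?ltW//.
  apply/seteqP; split => // p /squareP[h _].
  by have := normr_ge0 p.1; rewrite leNgt (le_lt_trans h)// lt_neqAle Mn.
pose d := e / (8 * M); have d0 : 0 < d by rewrite divr_gt0// mulr_gt0.
exists d => // s s1 s2.
pose B1 : set P := `[(a - d), (a + d)] `*` `[(- M), M].
pose B2 : set P := `[(- M), M] `*` `[(b - d), (b + d)].
have mB1 : measurable B1 by apply: measurableX; exact: measurable_itv.
have mB2 : measurable B2 by apply: measurableX; exact: measurable_itv.
apply: (@le_trans _ _ (plane_borel (B1 `|` B2))).
  apply: le_measure; rewrite ?inE.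
  - by apply: measurableI; [exact: measurable_square|exact: measurable_shift_diff].
  - exact: measurableU.
  - move=> p [/[dup] Sp /squareP[p1 p2] H].
    have key (x c t : R) : `|t| < d -> ~ (c <= x + t <-> c <= x) -> c - d <= x <= c + d.
      rewrite ltr_norml => td; have [h1|h1] := leP c x; have [h2|h2] := leP c (x + t).
      + by move=> n; exfalso; apply: n.
      + by move=> _; lra.
      + by move=> _; lra.
      + by move=> n; exfalso; apply: n.
    have [e1|n1] := pselect (a <= p.1 + s.1 <-> a <= p.1); last first.
      by left; split; rewrite /= in_itv/=; [exact: key s1 n1|case: Sp => _; rewrite /= in_itv].
    have [f1|n2] := pselect (b <= p.2 + s.2 <-> b <= p.2); last first.
      by right; split; rewrite /= in_itv/=; [case: Sp; rewrite /= in_itv|exact: key s2 n2].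
    by case: H => -[[/= h1 h2] n]; exfalso; apply: n; split; tauto.
apply: (@le_trans _ _ (plane_borel B1 + plane_borel B2)%E); first exact: measureU2.
rewrite !plane_borel_rect; [|lra..].
rewrite -EFinD lee_fin.
have E : e = 8 * M * d by rewrite /d; field; rewrite gt_eqF.
by rewrite [leRHS]E le_eqVlt; apply/orP; left; apply/eqP; ring.
Qed.

(** Dynkin's theorem: the quadrants are stable under intersection and generate the Borel sets, and
    the property passes to complements and countable unions. *)
Lemma shift_small_measurable A : measurable A -> shift_small A.
Proof.
pose G : set (set P) := [set A | exists a b : R, A = [set p | a <= p.1 /\ b <= p.2]].
have G1 a : <<s G >> [set p : P | a <= p.1].
  rewrite (_ : [set _ | _] = \bigcup_n [set p : P | a <= p.1 /\ - n%:R <= p.2]); last first.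
    apply/seteqP; split => [p /= ap|p [n _ []]//].
    exists (Num.truncn `|p.2|).+1 => //=; split => //.
    rewrite lerNl (le_trans (ler_norm _))// normrN ltW//; exact: truncnS_gt.
  apply: sigma_algebra_bigcup => n; apply: sub_sigma_algebra; by exists a, (- n%:R).
have G2 a : <<s G >> [set p : P | a <= p.2].
  rewrite (_ : [set _ | _] = \bigcup_n [set p : P | - n%:R <= p.1 /\ a <= p.2]); last first.
    apply/seteqP; split => [p /= ap|p [n _ []]//].
    exists (Num.truncn `|p.1|).+1 => //=; split => //.
    rewrite lerNl (le_trans (ler_norm _))// normrN ltW//; exact: truncnS_gt.
  apply: sigma_algebra_bigcup => n; apply: sub_sigma_algebra; by exists (- n%:R), a.
have GE : (measurable : set (set P)) = <<s G >>.
  apply/seteqP; split.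
    by apply: measurable_plane_gen => //; exact: smallest_sigma_algebra.
  apply: smallest_sub; first exact: sigma_algebra_measurable.
  by move=> _ [a [b ->]]; apply: measurableI; [exact: measurable_fst_ge|exact: measurable_snd_ge].
move=> mA; have : <<s G >> A by rewrite -GE.
move: A {mA}; apply: dynkin_induction => //.
- move=> _ _ [a1 [b1 ->]] [a2 [b2 ->]]; exists (Num.max a1 a2), (Num.max b1 b2).
  apply/seteqP; split => p /=; rewrite !ge_max; first by move=> [[-> ->] [-> ->]].
  by move=> [/andP[-> ->] /andP[-> ->]].
- move=> M e e0; exists 1 => // s _ _.
  by rewrite /shift_diff preimage_setT setDv setU0 setI0 measure0 lee_fin ltW.
- by move=> _ [a [b ->]]; exact: shift_small_quadrant.
- move=> B mB sB M e e0; have [d d0 H] := sB M e e0; exists d => // s s1 s2.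
  rewrite (_ : shift_diff (~` B) s = shift_diff B s); first exact: H.
  rewrite /shift_diff preimage_setC !setDE !setCK setUC.
  by congr (_ `|` _); rewrite setIC.
- by move=> F mF _; exact: shift_small_bigcup.
Qed.

End TranslationContinuity.

(** * Translates of integrable functions *)

Section L1Translation.
Import HBSimple.
Context {R : realType}.
Local Notation P := (measurableTypeR R * measurableTypeR R)%type.
Local Notation lam := (@plane_borel R).
Implicit Types (k : P -> R) (s : P).

Lemma plane_integral_translate (f : P -> \bar R) s : measurable_fun [set: P] f ->
  (forall p, 0 <= f p)%E ->
  (\int[lam]_p f (translate s p) = \int[lam]_p f p)%E.
Proof.
move=> mf f0; have mt := measurable_translate s.
have := @ge0_integral_pushforward _ _ _ _ _ _ mt lam setT f measurableT mf (fun y _ => f0 y).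
rewrite preimage_setT => <-; apply: eq_measure_integral => A mA _.
exact: plane_borel_translate.
Qed.

Lemma sfun_approx k e : lam.-integrable setT (EFin \o k) -> 0 < e ->
  exists g : P -> R, [/\ measurable_fun setT g, finite_set (range g) &
    (\int[lam]_p `|k p - g p|%:E < e%:E)%E].
Proof.
move=> ik e0; have [g [_ _ cg]] := approximation_sfun_integrable measurableT ik.
have [n Hn] := ecvg0_lt cg e0.
by exists (HBSimple.SimpleFun.sort (g n)); split.
Qed.

(** Where [g (translate s p)] differs from [g p], the point [p] lies in the [shift_diff] of the
    level set of [g p]. There are finitely many level sets, and the integrand is at most twice the
    sum of the moduli of the values. *)
Lemma sfun_translation (g : P -> R) M : measurable_fun setT g -> finite_set (range g) ->
  (forall p, ~ square M p -> g p = 0) ->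
  forall e, 0 < e -> exists2 d : R, 0 < d & forall s, `|s.1| < d -> `|s.2| < d ->
    (\int[lam]_p `|g (translate s p) - g p|%:E <= e%:E)%E.
Proof.
move=> mg /finite_seqP[rs rsE] gM e e0.
pose Q := square (M + 1); have mQ : measurable Q by exact: measurable_square.
have mA r : measurable (g @^-1` [set r]).
  by rewrite -[X in measurable X]setTI; apply: mg.
pose B s := \big[setU/set0]_(r <- rs) shift_diff (g @^-1` [set r]) s.
have mB s : measurable (B s).
  by rewrite /B; apply: bigsetU_measurable => r _; exact: measurable_shift_diff.
pose C := 2 * \sum_(r <- rs) `|r| + 1.
have C0 : 0 < C by rewrite ltr_wpDl// mulr_ge0// sumr_ge0.
have gC p : `|g p| <= \sum_(r <- rs) `|r|.
  have : g p \in rs by have : range g (g p) by []; rewrite rsE.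
  by move=> h; rewrite (big_rem _ h)/= lerDl sumr_ge0.
have small : forall e', 0 < e' -> exists2 d : R, 0 < d & forall s, `|s.1| < d -> `|s.2| < d ->
    (lam (Q `&` B s) <= e'%:E)%E.
  rewrite /B; elim: (rs) => [|r qs IH] e' e'0.
    by exists 1 => // s _ _; rewrite big_nil setI0 measure0 lee_fin ltW.
  have e2 : 0 < e' / 2 by rewrite divr_gt0.
  have [d1 d10 H1] := shift_small_measurable (mA r) (M + 1) e2.
  have [d2 d20 H2] := IH _ e2.
  exists (Num.min d1 d2); first by rewrite lt_min d10.
  move=> s; rewrite !lt_min => /andP[s1 s1'] /andP[s2 s2'].
  rewrite big_cons setIUr (splitr e') EFinD.
  apply: (le_trans (measureU2 _ _ _)).
  - by apply: measurableI => //; exact: measurable_shift_diff.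
  - apply: measurableI => //; apply: bigsetU_measurable => r' _; exact: measurable_shift_diff.
  - by apply: leeD; [exact: H1|exact: H2].
have [d d0 H] := small _ (divr_gt0 e0 C0).
exists (Num.min d 1); first by rewrite lt_min d0 ltr01.
move=> s; rewrite !lt_min => /andP[s1 s1'] /andP[s2 s2'].
have mgs : measurable_fun setT (fun p => g (translate s p)).
  by apply: measurableT_comp => //; exact: measurable_translate.
apply: (@le_trans _ _ (\int[lam]_p (C%:E * (\1_(Q `&` B s) p)%:E))%E).
  apply: ge0_le_integral => //.
  - by apply/measurable_EFinP; apply: measurableT_comp => //; exact: measurable_funB.
  - apply: measurable_funeM; apply/measurable_EFinP; apply: measurable_indic.
    exact: measurableI.
  move=> p _; rewrite -EFinM lee_fin.
  have [E|nE] := eqVneq (g (translate s p)) (g p).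
    by rewrite E subrr normr0 mulr_ge0// ltW.
  have -> : \1_(Q `&` B s) p = 1 :> R.
    rewrite indicE mem_set//; split.
      have [Mp|nM] := pselect (square M p).
        by move/squareP : Mp => [p1 p2]; apply/squareP; split; lra.
      have [/squareP[Mp1 Mp2]|nMs] := pselect (square M (translate s p)); last first.
        by move: nE; rewrite !gM// eqxx.
      apply/squareP; rewrite -[p.1](addrK s.1) -[p.2](addrK s.2).
      by split; rewrite (le_trans (ler_normB _ _))// lerD// ltW.
    have gp : g p \in rs by have : range g (g p) by []; rewrite rsE.
    rewrite /B (big_rem _ gp)/=; left; right; split => //=.
    by apply/eqP.
  rewrite mulr1 (le_trans (ler_normB _ _))// (le_trans (lerD (gC _) (gC _)))//.
  by rewrite /C mulr2n mulrDl mul1r lerDl.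
rewrite ge0_integralZl//; last 2 first.
- by apply/measurable_EFinP; apply: measurable_indic; exact: measurableI.
- by rewrite lee_fin ltW.
rewrite integral_indic//; last exact: measurableI.
rewrite setIT -lee_pdivlMl// -EFinM mulrC; exact: H.
Qed.

Lemma L1_translation k M : measurable_fun setT k -> lam.-integrable setT (EFin \o k) ->
  (forall p, ~ square M p -> k p = 0) ->
  forall e, 0 < e -> exists2 d : R, 0 < d & forall s, `|s.1| < d -> `|s.2| < d ->
    (\int[lam]_p `|k (translate s p) - k p|%:E <= e%:E)%E.
Proof.
move=> mk ik kM e e0; have e3 : 0 < e / 3 by rewrite divr_gt0.
have [g0 [mg0 fg0 kg0]] := sfun_approx ik e3.
(* As [k] vanishes off the square, cutting the approximation off there does not increase its
   distance to [k]. *)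
pose g p := g0 p * \1_(square M) p.
have mg : measurable_fun setT g.
  by apply: measurable_funM => //; apply: measurable_indic; exact: measurable_square.
have gM p : ~ square M p -> g p = 0 by move=> np; rewrite /g indicE memNset ?mulr0.
have fg : finite_set (range g).
  apply: (@sub_finite_set _ _ (range g0 `|` [set 0])); last by rewrite finite_setU; split.
  move=> _ [p _ <-]; rewrite /g indicE; have [Mp|nM] := pselect (square M p).
    by left; rewrite mem_set// mulr1; exists p.
  by right; rewrite memNset// mulr0.
have mkg : measurable_fun setT (fun p => `|k p - g p|%:E).
  by apply/measurable_EFinP; apply: measurableT_comp => //; exact: measurable_funB.
have kg : (\int[lam]_p `|k p - g p|%:E <= (e / 3)%:E)%E.
  apply: le_trans (ltW kg0); apply: ge0_le_integral => //.
    by apply/measurable_EFinP; apply: measurableT_comp => //; exact: measurable_funB.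
  move=> p _; rewrite lee_fin /g indicE; have [Mp|nM] := pselect (square M p).
    by rewrite mem_set// mulr1.
  by rewrite memNset// mulr0 subr0 kM// normr0.
have [d d0 H] := sfun_translation mg fg gM e3.
exists d => // s s1 s2; have mt := measurable_translate s.
have mgs : measurable_fun setT (fun p => `|g (translate s p) - g p|%:E).
  apply/measurable_EFinP; apply: measurableT_comp => //; apply: measurable_funB => //.
  exact: measurableT_comp.
have mkgs : measurable_fun setT (fun p => `|k (translate s p) - g (translate s p)|%:E).
  exact: (measurableT_comp mkg mt).
apply: (@le_trans _ _ (\int[lam]_p (`|k (translate s p) - g (translate s p)|%:E +
   (`|g (translate s p) - g p|%:E + `|k p - g p|%:E)))%E).
  apply: ge0_le_integral => //.
  - apply/measurable_EFinP; apply: measurableT_comp => //; apply: measurable_funB => //.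
    exact: measurableT_comp.
  - by apply: emeasurable_funD => //; exact: emeasurable_funD.
  move=> p _; rewrite -!EFinD lee_fin.
  have -> : k (translate s p) - k p = (k (translate s p) - g (translate s p)) +
     ((g (translate s p) - g p) - (k p - g p)) by ring.
  by rewrite (le_trans (ler_normD _ _))// lerD2l (le_trans (ler_normB _ _)).
rewrite ge0_integralD//; last 2 first.
- by move=> p _; rewrite -EFinD lee_fin addr_ge0.
- exact: emeasurable_funD.
rewrite ge0_integralD//.
have -> : e%:E = ((e / 3)%:E + ((e / 3)%:E + (e / 3)%:E))%E by rewrite -!EFinD; congr EFin; field.
apply: leeD; last by apply: leeD => //; exact: H.
by rewrite (plane_integral_translate (f := fun p => `|k p - g p|%:E)).
Qed.

End L1Translation.

(** * Composition with expanding maps *)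

Section MeasureComparison.
Context {R : realType}.
Local Notation P := (measurableTypeR R * measurableTypeR R)%type.
Local Notation lam := (@plane_borel R).
Implicit Types (A B : set P) (p q : P) (n m : nat).

(* The dyadic grid of mesh [2^-n], and the sets that are unions of its cells. *)
Definition grid n p : int * int := (Num.floor (2 ^+ n * p.1), Num.floor (2 ^+ n * p.2)).

Definition gridded n A := forall p q, grid n p = grid n q -> A p -> A q.

Definition dyadic A := exists n, gridded n A.

Lemma floor_halve (x y : R) : Num.floor (2 * x) = Num.floor (2 * y) -> Num.floor x = Num.floor y.
Proof.
move=> E; suff W (u v : R) : Num.floor (2 * u) = Num.floor (2 * v) -> (Num.floor u <= Num.floor v)%R.
  by apply/eqP; rewrite eq_le !W.
move=> {}E; rewrite Num.Theory.floor_ge_int.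
have : (2 * Num.floor u)%:~R <= 2 * u by rewrite intrM ler_pM2l// Num.Theory.floor_le.
by rewrite -(Num.Theory.floor_ge_int (2 * u)) E Num.Theory.floor_ge_int intrM ler_pM2l.
Qed.

Lemma grid_refine n m p q : (n <= m)%N -> grid m p = grid m q -> grid n p = grid n q.
Proof.
move=> /subnK <-; elim: (m - n)%N => // k IH; rewrite addSn /grid !exprS -!mulrA.
by move=> [/floor_halve h1 /floor_halve h2]; apply: IH; rewrite /grid h1 h2.
Qed.

Lemma gridded_refine n m A : (n <= m)%N -> gridded n A -> gridded m A.
Proof. by move=> nm gA p q /(grid_refine nm); exact: gA. Qed.

Lemma dyadicT : dyadic setT. Proof. by exists 0%N. Qed.

Lemma dyadicD A B : dyadic A -> dyadic B -> dyadic (A `\` B).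
Proof.
move=> [n gA] [m gB]; exists (maxn n m) => p q pq [Ap nB].
have [hn hm] := (leq_maxl n m, leq_maxr n m).
split; first exact: gridded_refine hn gA _ _ pq Ap.
by move=> Bq; apply: nB; exact: gridded_refine hm gB _ _ (esym pq) Bq.
Qed.

Lemma dyadicI A B : dyadic A -> dyadic B -> dyadic (A `&` B).
Proof. by move=> dA dB; rewrite -setDD; apply: dyadicD => //; exact: dyadicD. Qed.

Lemma dyadicU A B : dyadic A -> dyadic B -> dyadic (A `|` B).
Proof.
move=> dA dB; rewrite -[A `|` B]setCK setCU -!setTD.
by apply: dyadicD; [exact: dyadicT|apply: dyadicI; apply: dyadicD => //; exact: dyadicT].
Qed.

(** An inequality [a <= h p] holds if and only if [2 ^+ n * a] and [2 ^+ n * h p] have ordered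
    floors for every [n], which makes half-planes countable intersections of dyadic sets. The
    sigma-ring is the form in which the monotone class theorem is applied below. *)
Lemma measurable_sub_dyadic : (measurable : set (set P)) `<=` <<sr dyadic >>.
Proof.
have [S0 SD SU] := smallest_sigma_ring dyadic.
have ST : <<sr dyadic >> setT by apply: sub_g_sigma_ring; exact: dyadicT.
have SI (F : (set P)^nat) : (forall n, <<sr dyadic >> (F n)) -> <<sr dyadic >> (\bigcap_n F n).
  move=> SF; rewrite -[X in _ X]setCK setC_bigcap -setTD; apply: (SD) => //.
  by apply: (SU) => n; rewrite -setTD; exact: SD.
have half (h : P -> R) (j : int * int -> int) : (forall n p, j (grid n p) = Num.floor (2 ^+ n * h p)) ->
    forall a, <<sr dyadic >> [set p | a <= h p].
  move=> jE a.
  rewrite (_ : [set _ | _] = \bigcap_n [set p | (Num.floor (2 ^+ n * a) <= Num.floor (2 ^+ n * h p))%R]).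
    apply: SI => n; apply: sub_g_sigma_ring; exists n => p q /(congr1 j).
    by rewrite !jE /= => ->.
  apply/seteqP; split => [p /= ap n _|p /= H].
    by apply: le_floor; rewrite ler_pM2l// exprn_gt0.
  rewrite leNgt; apply/negP => pa.
  have pa0 : 0 < a - h p by rewrite subr_gt0.
  (* At this scale [a] and [h p] differ by more than one mesh, so that their floors differ. *)
  pose n := (Num.truncn (a - h p)^-1).+1.
  have h1 : 1 < 2 ^+ n * (a - h p).
    rewrite -ltr_pdivrMr// mul1r (lt_trans (truncnS_gt _))//.
    by rewrite -natrX ltr_nat ltn_expl.
  have := H n I => /=; rewrite leNgt => /negP; apply.
  have h2 : 2 ^+ n * h p <= 2 ^+ n * a - 1 by rewrite lerBrDr -lerBrDl -mulrBr ltW.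
  rewrite Num.Theory.floor_lt_int (le_lt_trans h2)// ltrBlDr.
  by have := Num.Theory.floorD1_gt (2 ^+ n * a); rewrite intrD.
apply: measurable_plane_gen.
- by split=> // A SA; exact: SD.
- exact: (half fst fst).
- exact: (half snd snd).
Qed.

Definition cell n (k : int * int) : set P :=
  `[k.1%:~R / 2 ^+ n, (k.1 + 1)%:~R / 2 ^+ n[ `*` `[k.2%:~R / 2 ^+ n, (k.2 + 1)%:~R / 2 ^+ n[.

Lemma measurable_cell n k : measurable (cell n k).
Proof. by apply: measurableX; exact: measurable_itv. Qed.

Lemma cellP n k p : cell n k p <-> grid n p = k.
Proof.
have key (x : R) (i : int) : (i%:~R / 2 ^+ n <= x < (i + 1)%:~R / 2 ^+ n) = (Num.floor (2 ^+ n * x) == i).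
  rewrite ler_pdivrMr ?exprn_gt0// ltr_pdivlMr ?exprn_gt0// mulrC.
  by rewrite -real_floor_eq ?num_real.
rewrite /cell/= !in_itv/= !key /grid; case: k => i j /=.
by split => [[/eqP -> /eqP ->]|[-> ->]].
Qed.

Lemma measurable_dyadic A : dyadic A -> measurable A.
Proof.
move=> [n gA].
have [g gP] : exists g : nat -> option (int * int), forall k, exists i, g i = Some k.
  by exists unpickle => k; exists (pickle k); rewrite pickleK.
have -> : A = \bigcup_i (if g i is Some k then
    (if `[< exists2 p, A p & grid n p = k >] then cell n k else set0) else set0).
  apply/seteqP; split => [p Ap|p [i _]].
    have [i gi] := gP (grid n p); exists i => //; rewrite gi ifT; first exact/cellP.
    by apply/asboolP; exists p.
  case: (g i) => // k; case: asboolP => // -[q Aq qk] /cellP pk.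
  by apply: gA Aq; rewrite qk pk.
apply: bigcupT_measurable => i; case: (g i) => // k; case: ifP => // _; exact: measurable_cell.
Qed.

Lemma plane_borel_cell n k : lam (cell n k) = ((2 ^+ n)^-1 ^+ 2)%:E.
Proof.
have E (i : int) : lebesgue_measure (`[i%:~R / 2 ^+ n, (i + 1)%:~R / 2 ^+ n[ : set (measurableTypeR R)) = ((2 ^+ n)^-1)%:E.
  rewrite lebesgue_measure_itv/= lte_fin ltr_pM2r ?invr_gt0 ?exprn_gt0// ltr_int ltzD1 lexx.
  by rewrite -EFinB -mulrBl intrD addrAC subrr add0r mul1r.
rewrite /cell /plane_borel product_measure1E; [|exact: measurable_itv|exact: measurable_itv].
by rewrite expr2 EFinM; congr (_ * _)%E; exact: E.
Qed.

Section Comparison.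
Variables (E : set P) (T : P -> P) (L M : R).
Hypothesis mE : measurable E.
Hypothesis mT : measurable_fun setT T.
Hypothesis L0 : 0 <= L.
(** Stated in the sup norm, for which cells are balls: the part of [E] sent into one cell then fits
    into a square. *)
Hypothesis expanding : forall p q d, E p -> E q ->
  `|(T p).1 - (T q).1| <= d -> `|(T p).2 - (T q).2| <= d ->
  `|p.1 - q.1| <= L * d /\ `|p.2 - q.2| <= L * d.
Hypothesis TE : forall p, E p -> square M (T p).

Let nu A := lam (E `&` T @^-1` A).
(** The part of [E] sent into a cell of side [d] lies in a square of side [2 * L * d] around any of
    its points, and that square has [4 * L ^+ 2] times the area of the cell. *)
Let C : R := 4 * L ^+ 2.
Let C0 : 0 <= C. Proof. by rewrite /C mulr_ge0// sqr_ge0. Qed.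

Let mpre A : measurable A -> measurable (E `&` T @^-1` A).
Proof. by move=> mA; apply: measurableI => //; rewrite -[X in measurable X]setTI; exact: mT. Qed.

Let nu_cell n k : (nu (cell n k) <= C%:E * lam (cell n k))%E.
Proof.
have [[p [Ep Tp]]|nex] := pselect (exists p, E p /\ cell n k (T p)); last first.
  rewrite /nu (_ : _ `&` _ = set0) ?measure0; last first.
    by apply/seteqP; split => // p [Ep Tp]; apply: nex; exists p.
  by rewrite mule_ge0// lee_fin.
pose d : R := (2 ^+ n)^-1; have d0 : 0 <= d by rewrite invr_ge0 exprn_ge0.
have Ld : 0 <= L * d by rewrite mulr_ge0.
pose Q : set P := `[(p.1 - L * d), (p.1 + L * d)] `*` `[(p.2 - L * d), (p.2 + L * d)].
apply: (@le_trans _ _ (lam Q)).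
  apply: le_measure; rewrite ?inE; first by apply: mpre; exact: measurable_cell.
    by apply: measurableX; exact: measurable_itv.
  have near (x y : R) (i : int) : i%:~R / 2 ^+ n <= x < (i + 1)%:~R / 2 ^+ n ->
      i%:~R / 2 ^+ n <= y < (i + 1)%:~R / 2 ^+ n -> `|x - y| <= d.
    by rewrite intrD mulrDl mul1r -/d ler_norml => /andP[a1 a2] /andP[b1 b2]; apply/andP; split; lra.
  move=> q [Eq]; move: Tp; rewrite /cell/= !in_itv/= => -[t1 t2] [u1 u2].
  have [v1 v2] := expanding Eq Ep (near _ _ _ u1 t1) (near _ _ _ u2 t2).
  by split; rewrite /= in_itv/=; rewrite -ler_distl.
rewrite plane_borel_rect; [|lra..].
rewrite plane_borel_cell -EFinM lee_fin -/d /C.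
by rewrite le_eqVlt; apply/orP; left; apply/eqP; ring.
Qed.

Let nu_dyadic A : measurable A -> dyadic A -> (nu A <= C%:E * lam A)%E.
Proof.
move=> mA [n gA].
(* [pickle_inv] lists each cell exactly once, which makes the decomposition of [A] disjoint. *)
have [g [gP gI]] : exists g : nat -> option (int * int), (forall k, exists i, g i = Some k) /\
    (forall i j k, g i = Some k -> g j = Some k -> i = j).
  exists (@pickle_inv (int * int)%type); split => [k|i j k gi gj].
    by exists (pickle k); exact: pickleK_inv.
  have := @pickle_invK (int * int)%type i; have := @pickle_invK (int * int)%type j.
  by rewrite gi gj /= => <- <-.
pose F i := if g i is Some k then (if `[< exists2 p, A p & grid n p = k >] then cell n k else set0) else set0.
have FE i p : F i p -> A p /\ g i = Some (grid n p).
  rewrite /F; case: (g i) => // k; case: asboolP => // -[q Aq qk] /cellP pk.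
  by split; [apply: gA Aq; rewrite qk pk|rewrite pk].
have mF i : measurable (F i).
  by rewrite /F; case: (g i) => // k; case: ifP => // _; exact: measurable_cell.
have AF : A = \bigcup_i F i.
  apply/seteqP; split => [p Ap|p [i _ /FE[]]//].
  have [i gi] := gP (grid n p); exists i => //; rewrite /F gi ifT; first exact/cellP.
  by apply/asboolP; exists p.
have tF : trivIset setT F.
  apply/trivIsetP => i j _ _ ij; apply/seteqP; split => // p [/FE[_ pi] /FE[_ pj]].
  by move/eqP: ij; apply; exact: gI pi pj.
rewrite /nu AF preimage_bigcup setI_bigcupr measure_semi_bigcup//; last 3 first.
- by move=> i; exact: mpre.
- apply/trivIsetP => i j _ _ ij; apply/seteqP; split => // p [[_ Fi] [_ Fj]].
  by have /trivIsetP/(_ i j I I ij) := tF; move=> /seteqP[/(_ (T p)) + _]; apply.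
- by apply: bigcupT_measurable => i; exact: mpre.
rewrite measure_semi_bigcup//; last by rewrite -AF.
rewrite -nneseriesZl//; last first.
apply: lee_nneseries => // i _; rewrite /F; case: (g i) => [k|]; last first.
  by rewrite preimage_set0 setI0 measure0 mule0.
by case: ifP => _; [exact: nu_cell|rewrite preimage_set0 setI0 measure0 mule0].
Qed.

(** Monotone class argument from dyadic sets to Borel sets. Decreasing limits require finite
    measure, so the right-hand side is first confined to a bounded dyadic set [Q] that contains the
    image of [E]. *)
Lemma measure_comparison A : measurable A -> (lam (E `&` T @^-1` A) <= C%:E * lam A)%E.
Proof.
(* [N] exceeds [M], so the unit cells with indices from [- N] to [N - 1] cover the square that
   contains the image. *)
pose N : int := Num.floor M + 2.
pose Q : set P := [set p | (- N <= (grid 0 p).1 < N) /\ (- N <= (grid 0 p).2 < N)].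
have dQ : dyadic Q by exists 0%N => p q pq; rewrite /Q /mkset pq.
have Qle p : Q p -> square (N%:~R + 1) p.
  rewrite /Q /grid/= !expr0 !mul1r => -[/andP[a1 a2] /andP[b1 b2]].
  have key (x : R) : (- N <= Num.floor x)%R -> (Num.floor x < N)%R -> `|x| <= N%:~R + 1.
    move=> h1 h2; rewrite ler_norml; apply/andP; split.
      by have := h1; rewrite Num.Theory.floor_ge_int mulrNz => h; lra.
    have : x < (Num.floor x + 1)%:~R by exact: Num.Theory.floorD1_gt.
    have : (Num.floor x + 1)%:~R <= (N%:~R : R) by rewrite ler_int lezD1.
    lra.
  by apply/squareP; split; exact: key.
have EQ p : E p -> Q (T p).
  move=> /TE/squareP[h1 h2].
  have key (x : R) : `|x| <= M -> (- N <= Num.floor x < N)%R.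
    rewrite ler_norml => /andP[l1 l2].
    have MN : M + 1 < N%:~R.
      rewrite /N intrD; have := Num.Theory.floorD1_gt M; rewrite intrD; lra.
    rewrite Num.Theory.floor_ge_int Num.Theory.floor_lt_int mulrNz; apply/andP; split; lra.
  by rewrite /Q /grid/= !expr0 !mul1r; split; exact: key.
have mQ : measurable Q by exact: measurable_dyadic.
have Qfin : (lam Q < +oo)%E.
  apply: le_lt_trans (square_fin (N%:~R + 1)); apply: le_measure; rewrite ?inE//.
  exact: measurable_square.
(* The bound by the measure of the part of [A] inside [Q] is the one that survives decreasing
   limits. *)
pose G := [set A : set P | measurable A /\ (nu A <= C%:E * lam (A `&` Q))%E].
have mG : monotone G.
  split => F mF GF.
    split; first by apply: bigcupT_measurable => n; have [] := GF n.
    have cF : nu (F n) @[n --> \oo] --> nu (\bigcup_n F n).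
      rewrite /nu preimage_bigcup setI_bigcupr; apply: nondecreasing_cvg_mu.
      - by move=> n; apply: mpre; have [] := GF n.
      - by apply: bigcupT_measurable => n; apply: mpre; have [] := GF n.
      - move=> n m nm; apply/subsetPset => p [Ep Fp]; split => //.
        by have /subsetPset := mF _ _ nm; exact.
    rewrite -(cvg_lim _ cF)//; apply: lime_le; first by apply/cvg_ex; eexists; exact: cF.
    near=> n; have [mFn H] := GF n; apply: (le_trans H); apply: lee_wpmul2l; rewrite ?lee_fin//.
    apply: le_measure; rewrite ?inE; first exact: measurableI.
      by apply: measurableI => //; apply: bigcupT_measurable => k; have [] := GF k.
    by apply: setSI => p Fp; exists n.
  have mcap : measurable (\bigcap_n F n) by apply: bigcapT_measurable => n; have [] := GF n.
  split => //.
  have cF : lam (F n `&` Q) @[n --> \oo] --> lam (\bigcap_n F n `&` Q).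
    rewrite -bigcapIl//; apply: nonincreasing_cvg_mu.
    - apply: le_lt_trans Qfin; apply: le_measure; rewrite ?inE//.
      by apply: measurableI => //; have [] := GF 0%N.
    - by move=> n; apply: measurableI => //; have [] := GF n.
    - by apply: bigcapT_measurable => n; apply: measurableI => //; have [] := GF n.
    - move=> n m nm; apply/subsetPset; apply: setSI.
      by apply/subsetPset; exact: mF.
  have cCF : (C%:E * lam (F n `&` Q))%E @[n --> \oo] --> (C%:E * lam (\bigcap_n F n `&` Q))%E.
    exact: cvgeZl.
  rewrite -(cvg_lim _ cCF)//; apply: lime_ge; first by apply/cvg_ex; eexists; exact: cCF.
  near=> n; have [mFn H] := GF n; apply: le_trans H; apply: le_measure; rewrite ?inE.
  - exact: mpre.
  - exact: mpre.
  - by apply: setIS => p /(_ n I).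
have GA : measurable `<=` G.
  apply: subset_trans measurable_sub_dyadic _.
  apply: monotone_setring_sub_g_sigma_ring => //.
  - by split; [exists 0%N => //|move=> A' B'; exact: dyadicU|move=> A' B'; exact: dyadicD].
  - move=> B dB; split; first exact: measurable_dyadic.
    rewrite (_ : nu B = nu (B `&` Q)).
      by have dBQ := dyadicI dB dQ; apply: nu_dyadic => //; exact: measurable_dyadic.
    rewrite /nu; congr (lam _); apply/seteqP; split => p [Ep]; last by case.
    by move=> Bp; split => //; split => //; exact: EQ.
move=> /GA[mA H]; apply: (le_trans H); rewrite lee_wpmul2l ?lee_fin//.
by apply: le_measure; rewrite ?inE//; exact: measurableI.
Unshelve. all: by end_near. Qed.

Import HBNNSimple.

(** A simple function below the restriction of [f] to [E] vanishes off [E], so its integrals against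
    the two measures agree; then take suprema. *)
Lemma le_integral_mrestr (f : P -> \bar R) : (forall p, 0 <= f p)%E ->
  (\int[lam]_(p in E) f p <= \int[mrestr lam mE]_p f p)%E.
Proof.
move=> f0; have f0E (D : set P) x : D x -> (0 <= f x)%E by move=> _; exact: f0.
rewrite (ge0_integralE _ (f0E E)) (ge0_integralE _ (f0E setT)).
apply: ge_ereal_sup => _ [h /= hf <-].
rewrite (_ : sintegral lam h = sintegral (mrestr lam mE) h).
  apply: ereal_sup_ubound; exists h => //= p; rewrite patchT ?inE//.
  apply: (le_trans (hf p)); rewrite patchE; case: ifP => // _; exact: f0.
rewrite !sintegralE; apply: eq_fsbigr => r _.
have [->|r0] := eqVneq r 0; first by rewrite !mul0e.
congr (_ * _)%E; rewrite /mrestr; congr (lam _).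
apply/esym/setIidl => p /= hp; apply: contrapT => nE.
have := hf p; rewrite patchE memNset// hp lee_fin => rle0.
have : 0 <= h p by []. rewrite hp => r0'; move: r0; rewrite eq_le rle0 r0'.
by [].
Qed.

(** The right-hand sides of [measure_comparison] say that the pushforward by [T] of the restriction
    of [lam] to [E] is dominated by [C * lam]; integrals of nonnegative functions are monotone in
    the measure. *)
Lemma integral_comparison (f : P -> \bar R) : measurable_fun setT f -> (forall p, 0 <= f p)%E ->
  (\int[lam]_(p in E) f (T p) <= C%:E * \int[lam]_p f p)%E.
Proof.
move=> mf f0; apply: (le_trans (le_integral_mrestr (fun p => f0 (T p)))).
have := @ge0_integral_pushforward _ _ _ _ _ _ mT (mrestr lam mE) setT f measurableT mf (fun y _ => f0 y).
rewrite preimage_setT => <-.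
have := @ge0_integral_mscale _ _ _ lam setT measurableT (NngNum C0) f mf (fun p _ => f0 p).
move=> /= <-.
apply: ge0_le_measure_integral => // S mS.
by have := measure_comparison mS; rewrite setIC.
Qed.

End Comparison.
End MeasureComparison.

(** * Borel versions of Lebesgue measurable functions *)

Section CompletedMeasure.
Context {R : realType}.
Local Notation P := (measurableTypeR R * measurableTypeR R)%type.
Local Notation lam := (@plane_borel R).
Local Notation pl := (@plane_lebesgue R).

Lemma borel_lebesgue_measurable (A : set P) : measurable A -> measurable (A : set (plane R)).
Proof. exact: caratheodory_measurable_mu_ext. Qed.

Lemma borel_lebesgue_measure (A : set P) : measurable A -> pl A = lam A.
Proof. exact: measurable_mu_extE. Qed.

Lemma lebesgue_outer_approx (A : set P) (e : R) : (pl A < +oo)%E -> 0 < e ->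
  exists B : set P, [/\ measurable B, A `<=` B & (lam B <= pl A + e%:E)%E].
Proof.
move=> Afin e0.
have Afn : pl A \is a fin_num by rewrite ge0_fin_numE//; exact: mu_ext_ge0.
have [_ [F [mF AF] <-] Fe] := lb_ereal_inf_adherent e0 Afn.
exists (\bigcup_k F k); split => //; first exact: bigcupT_measurable.
apply: le_trans (ltW Fe).
have := measure_sigma_subadditive lam mF (bigcupT_measurable _ mF) (@subset_refl _ _).
exact.
Qed.

Lemma lebesgue_hull (A : set P) : (pl A < +oo)%E ->
  exists B : set P, [/\ measurable B, A `<=` B & lam B = pl A].
Proof.
move=> Afin.
have /choice[B HB] : forall n : nat, exists B : set P,
    [/\ measurable B, A `<=` B & (lam B <= pl A + (n.+1%:R^-1)%:E)%E].
  by move=> n; apply: lebesgue_outer_approx.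
have mB : measurable (\bigcap_n B n) by apply: bigcapT_measurable => n; have [] := HB n.
have AB : A `<=` \bigcap_n B n by move=> p Ap n _; have [_ + _] := HB n; exact.
exists (\bigcap_n B n); split => //.
apply/eqP; rewrite eq_le; apply/andP; split; last first.
  by rewrite -borel_lebesgue_measure//; apply: le_outer_measure.
apply/lee_addgt0Pr => e e0.
have [n ne] : exists n : nat, n.+1%:R^-1 < e.
  exists (Num.truncn e^-1); rewrite -[ltRHS]invrK ltf_pV2 ?posrE ?invr_gt0//.
  exact: truncnS_gt.
have [mBn _ H] := HB n; apply: (@le_trans _ _ (lam (B n))).
  by apply: le_measure; rewrite ?inE//; exact: bigcap_inf.
by apply: (le_trans H); rewrite leeD2l// lee_fin ltW.
Qed.

Lemma null_cover (A : set P) : pl A = 0 -> exists N : set P, [/\ measurable N, A `<=` N & lam N = 0].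
Proof.
move=> A0; have [|N [mN AN N0]] := @lebesgue_hull A; first by rewrite A0 ltry.
by exists N; split => //; rewrite N0.
Qed.

Lemma lam_null_bigcup (N : (set P)^nat) : (forall n, measurable (N n)) -> (forall n, lam (N n) = 0) ->
  lam (\bigcup_n N n) = 0.
Proof.
move=> mN N0; apply/eqP; rewrite eq_le measure_ge0 andbT.
apply: (le_trans (measure_sigma_subadditive lam mN (bigcupT_measurable _ mN) _)) => //.
by rewrite eseries0// => n _ _; exact: N0.
Qed.

(** A set of finite measure differs from its Borel hull by a null set, and this lies in a Borel null
    set. Squares reduce the general case to finite measure. *)
Lemma borel_approx (A : set P) : measurable (A : set (plane R)) ->
  exists B N : set P, [/\ measurable B, measurable N, lam N = 0 &
    forall p, ~ N p -> A p <-> B p].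
Proof.
move=> mA.
have /choice[B HB] : forall n : nat, exists BN : set P * set P,
    [/\ measurable BN.1, measurable BN.2, lam BN.2 = 0 &
     forall p, ~ BN.2 p -> (A `&` square n%:R) p <-> BN.1 p].
  move=> n; pose An : set P := A `&` square n%:R.
  have mS := borel_lebesgue_measurable (measurable_square (n%:R : R)).
  have mAn : measurable (An : set (plane R)) by exact: measurableI.
  have Anfin : (pl An < +oo)%E.
    apply: le_lt_trans (square_fin (n%:R : R)).
    rewrite -borel_lebesgue_measure; last exact: measurable_square.
    by apply: le_outer_measure; exact: subIsetr.
  have [B [mB AB BE]] := lebesgue_hull Anfin.
  have mB' := borel_lebesgue_measurable mB.
  have D0 : pl (B `\` An) = 0.
    have plB : pl B = pl An by rewrite -BE; exact: borel_lebesgue_measure.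
    have Bfin : (pl B < +oo)%E by rewrite plB.
    have := measureD mB' mAn Bfin; rewrite setIidr// => E.
    apply: (etrans E); rewrite [X in (X - _)%E](_ : _ = pl An)//.
    by rewrite subee// ge0_fin_numE//; exact: mu_ext_ge0.
  have [N [mN DN N0]] := null_cover D0.
  exists (B, N); split => //= p nN; split; first exact: AB.
  by move=> Bp; apply: contrapT => nA; apply: nN; exact: DN.
exists (\bigcup_n (B n).1), (\bigcup_n (B n).2); split.
- by apply: bigcupT_measurable => n; have [] := HB n.
- by apply: bigcupT_measurable => n; have [] := HB n.
- by apply: lam_null_bigcup => n; have [] := HB n.
- move=> p nN; split => [Ap|[n _ Bn]]; last first.
    have [_ _ _ H] := HB n; have [|_ /(_ Bn)[]//] := H p.
    by move=> Nn; apply: nN; exists n.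
  pose n := (Num.truncn (`|p.1| + `|p.2|)).+1.
  have [_ _ _ H] := HB n; exists n => //; apply/H.
    by move=> Nn; apply: nN; exists n.
  split => //; apply/squareP.
  have : `|p.1| + `|p.2| < n%:R by exact: truncnS_gt.
  by have := normr_ge0 p.1; have := normr_ge0 p.2; lra.
Qed.

(** The superlevel sets at rational levels are replaced by Borel sets, and [N] collects the
    countably many exceptional sets. The freedom to enlarge [N] lets the real and the imaginary part
    share one exceptional set. *)
Lemma borel_version (U : set P) (h : P -> R) : measurable U ->
  measurable_fun (U : set (plane R)) (h : plane R -> R) ->
  exists N : set P, [/\ measurable N, lam N = 0 &
   forall N' : set P, measurable N' -> N `<=` N' ->
    measurable_fun [set: P] (fun p => h p * \1_(U `\` N') p)].
Proof.
move=> mU mh; have mU' := borel_lebesgue_measurable mU.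
have /choice[B HB] : forall q : rat, exists BN : set P * set P,
    [/\ measurable BN.1, measurable BN.2, lam BN.2 = 0 &
     forall p, ~ BN.2 p -> (U `&` h @^-1` `]ratr q, +oo[) p <-> BN.1 p].
  move=> q; have mA : measurable ((U `&` h @^-1` `]ratr q, +oo[) : set (plane R)).
    by apply: mh => //; exact: measurable_itv.
  by have [B [N [mB mN N0 H]]] := borel_approx mA; exists (B, N).
have [g gP] : exists g : nat -> rat, forall q, exists n, g n = q.
  by exists (fun n => odflt 0 (unpickle n)) => q; exists (pickle q); rewrite pickleK.
exists (\bigcup_n (B (g n)).2); split.
- by apply: bigcupT_measurable => n; have [] := HB (g n).
- by apply: lam_null_bigcup => n; have [] := HB (g n).
move=> N' mN' NN'.
apply: (@measurability _ _ P (measurableTypeR R) setT _ _ (RGenOInfty.measurableE R)).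
move=> _ [_ [a ->] <-]; rewrite setTI.
have -> : (fun p => h p * \1_(U `\` N') p) @^-1` `]a, +oo[ =
    (\bigcup_n (if a < ratr (g n) then (B (g n)).1 `\` N' else set0)) `|`
    (if a < 0 then ~` (U `\` N') else set0).
  apply/seteqP; split => [p|p].
    rewrite /= in_itv/= andbT indicE => ap.
    have [UN|nUN] := pselect ((U `\` N') p); last first.
      by right; move: ap; rewrite memNset// mulr0 => ->.
    left; move: ap; rewrite mem_set// mulr1 => ap.
    have [q] := rat_in_itvoo ap; rewrite in_itv/= => /andP[aq qh].
    have [n gn] := gP q; exists n => //; rewrite gn aq; split; last by case: UN.
    have [_ _ _ H] := HB q; apply/H; last by split; [case: UN|rewrite /= in_itv/= qh].
    by move=> Nq; have [_] := UN; apply; apply: NN'; exists n => //; rewrite gn.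
  case=> [[n _]|]; rewrite /= in_itv/= andbT indicE.
    case: ifP => // an [Bp nN].
    have [_ _ _ H] := HB (g n); have [|_ /(_ Bp)[Up]] := H p.
      by move=> Nn; apply: nN; apply: NN'; exists n.
    rewrite /= in_itv/= andbT => gh; rewrite mem_set ?mulr1; last by split.
    exact: lt_trans gh.
  by case: ifP => // a0 nUN; rewrite memNset// mulr0.
apply: measurableU.
  apply: bigcupT_measurable => n; case: ifP => // _.
  by apply: measurableD => //; have [] := HB (g n).
by case: ifP => // _; apply: measurableC; exact: measurableD.
Qed.

Lemma plane_lebesgue_complete : measure_is_complete pl.
Proof. exact: measure_is_complete_caratheodory. Qed.

(** [lam] is the pushforward of [pl] along the identity, which is measurable from the Lebesgue to
    the Borel sets. *)
Lemma ge0_integral_lebesgue_borel (D : set P) (f : P -> \bar R) : measurable D ->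
  measurable_fun [set: P] f -> (forall p, 0 <= f p)%E ->
  (\int[pl]_(p in D) f p = \int[lam]_(p in D) f p)%E.
Proof.
move=> mD mf f0.
have mid : measurable_fun [set: plane R] (fun p : plane R => (p : P)).
  by move=> _ Y mY; rewrite setTI; exact: borel_lebesgue_measurable.
have H := @ge0_integral_pushforward _ _ _ _ _ _ mid pl D f mD (measurable_funTS mf) (fun y _ => f0 y).
rewrite [LHS](_ : _ = (\int[pushforward pl (fun p : plane R => (p : P))]_(y in D) f y)%E); last by rewrite H.
by apply: eq_measure_integral => A mA _; exact: borel_lebesgue_measure.
Qed.

(** The bridge between the integrals over [U] of the definitions and Borel integrals over the whole
    plane: [K] and [Kb] agree almost everywhere on [U], and [Kb] vanishes off [U]. *)
Lemma transfer (U N : set P) (K : P -> R) (Kb : P -> R) : measurable U ->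
  measurable N -> lam N = 0 -> measurable_fun [set: P] Kb ->
  (forall p, U p -> ~ N p -> K p = Kb p) -> (forall p, ~ U p -> Kb p = 0) ->
  (pl.-integrable U (EFin \o K) <-> lam.-integrable setT (EFin \o Kb)) /\
  Rintegral pl U K = Rintegral lam setT Kb.
Proof.
move=> mU mN N0 mKb KKb Kb0.
have mU' := borel_lebesgue_measurable mU.
have mid : measurable_fun [set: plane R] (fun p : plane R => (p : P)).
  by move=> _ Y mY; rewrite setTI; exact: borel_lebesgue_measurable.
have mKb' : measurable_fun (U : set (plane R)) (EFin \o Kb : plane R -> \bar R).
  apply/measurable_EFinP; apply: measurable_funTS.
  exact: (@measurableT_comp _ _ _ _ _ _ Kb _ (fun p : plane R => (p : P))).
have ae : ae_eq pl U (EFin \o Kb) (EFin \o K).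
  exists N; split; first exact: borel_lebesgue_measurable.
    exact: etrans (borel_lebesgue_measure mN) N0.
  move=> p /= H; apply: contrapT => Np; apply: H => Up.
  by rewrite /= KKb.
have mK : measurable_fun (U : set (plane R)) (EFin \o K : plane R -> \bar R).
  by apply: (ae_measurable_fun plane_lebesgue_complete ae).
have I0 (f : P -> \bar R) : measurable_fun [set: P] f -> (forall p, 0 <= f p)%E ->
    (forall p, ~ U p -> f p = 0%E) -> (\int[pl]_(p in U) f p = \int[lam]_p f p)%E.
  move=> mf f0 fU; rewrite ge0_integral_lebesgue_borel// integral_mkcond.
  apply: eq_integral => p _; rewrite patchE; case: ifPn => // /negP nU.
  by rewrite fU// => Up; apply: nU; rewrite inE.
have mEKb : measurable_fun [set: P] (EFin \o Kb) by exact/measurable_EFinP.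
have aeabs : (\int[pl]_(p in U) `|(EFin \o K) p| = \int[lam]_p `|(EFin \o Kb) p|)%E.
  rewrite -I0//; last 2 first.
  - exact: measurableT_comp.
  - by move=> p nU /=; rewrite Kb0// normr0.
  have mabs (k : plane R -> \bar R) : measurable_fun (U : set (plane R)) k ->
      measurable_fun (U : set (plane R)) (fun p => `|k p|%E).
    by move=> mk; exact: measurableT_comp.
  exact: (ge0_ae_eq_integral mU' (mabs _ mK) (mabs _ mKb') (fun _ _ => abse_ge0 _)
    (fun _ _ => abse_ge0 _) (ae_eq_abse (ae_eq_sym ae))).
split.
  split=> /integrableP[_ fin]; apply/integrableP; split => //.
    by rewrite -aeabs.
  by rewrite aeabs.
rewrite /Rintegral; congr fine.
have -> : (\int[pl]_(p in U) (K p)%:E = \int[pl]_(p in U) (Kb p)%:E)%E.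
  by apply: ae_eq_integral => //; exact: ae_eq_sym.
rewrite [LHS]integralE [RHS]integralE; congr (_ - _)%E.
  apply: I0; [exact: measurable_funepos|by []|].
  by move=> p nU; rewrite funeposE/= Kb0// maxxx.
apply: I0; [exact: measurable_funeneg|by []|].
by move=> p nU; rewrite funenegE/= Kb0// oppr0 maxxx.
Qed.

End CompletedMeasure.

(** * Local behaviour of holomorphic maps *)

Section LocalExpansion.
Context {R : realType}.
Implicit Types (f : Cplx R -> Cplx R) (z w : Cplx R).

Lemma eps_is_derive (g : R -> R) (x d : R) :
  (forall e, 0 < e -> exists2 k : R, 0 < k & forall v, `|v - x| < k ->
    `|g v - g x - d * (v - x)| <= e * `|v - x|) -> is_derive x 1 g d.
Proof.
move=> H.
have cv : h^-1 *: ((g \o shift x) (h *: 1) - g x) @[h --> 0^'] --> d.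
  apply/cvgrPdist_le => e e0; have [k k0 {}H] := H e e0.
  rewrite near_withinE; apply/nbhs_ballP; exists k => // h.
  rewrite /ball/= sub0r normrN => hk h0.
  rewrite -[h *: (1 : R)]/(h * 1) mulr1 -[_ *: _]/(_ * _).
  rewrite -(ler_pM2r (_ : 0 < `|h|)) ?normr_gt0// -normrM mulrBl mulrAC mulVf// mul1r distrC.
  by have := H (h + x); rewrite addrK; apply.
by split; [apply/cvg_ex; exists d|exact: cvg_lim cv].
Qed.

Lemma rdiff_is_derivel (A : R -> R -> R) x y p q : rdiff A x y p q -> is_derive x 1 (A ^~ y) p.
Proof.
move=> dA; apply: eps_is_derive => e e0; have [k k0 H] := dA e e0; exists k => // v vx.
have := H v y vx; rewrite subrr normr0 mulr0 subr0 addr0; exact.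
Qed.

Lemma rdiff_is_deriver (A : R -> R -> R) x y p q : rdiff A x y p q -> is_derive y 1 (A x) q.
Proof.
move=> dA; apply: eps_is_derive => e e0; have [k k0 H] := dA e e0; exists k => // v vy.
have := H x v; rewrite subrr normr0 mulr0 subr0 add0r; exact.
Qed.

Lemma cdiff2_plane f x y c : cdiff f (x +i* y) c ->
  cdiff2 (fun u v => f (u +i* v)) x y c (c * 'i).
Proof.
move=> df e e0; have e2 : 0 < e / 2 by rewrite divr_gt0.
have [d d0 H] := df (e / 2) e2; exists (d / 2); first by rewrite divr_gt0.
move=> u v ud vd.
have E : (u +i* v) - (x +i* y) = (u - x)%:C + 'i * (v - y)%:C :> R[i].
  by apply: complex_ext; rewrite ?(reB, imB, reD, imD, reM, imM)/=; ring.
have N : normc ((u +i* v : R[i]) - (x +i* y)) <= `|u - x| + `|v - y|.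
  by rewrite (le_trans (normc_le_reim _))// reB imB/=.
have nd : `|u - x| + `|v - y| < d by rewrite (splitr d) ltrD.
have {}H := H (u +i* v) (le_lt_trans N nd).
rewrite (_ : _ - _ - c * (u - x)%:C - c * 'i * (v - y)%:C =
  f (u +i* v) - f (x +i* y) - c * ((u +i* v) - (x +i* y))); last by rewrite E; ring.
rewrite (le_trans H)// ler_pM ?normc_ge0 ?(ltW e2)//.
by rewrite ler_pdivrMr// ler_peMr ?(ltW e0)// ler1n.
Qed.

(** The real mean value theorem along the segment, for the real and the imaginary part separately;
    hence the factor [2]. *)
Lemma mean_value_bound f z (r M : R) :
  (forall w, normc (w - z) < r -> derivable f w 1 /\ normc ('D_1 f w) <= M) ->
  forall w1 w2, normc (w1 - z) < r -> normc (w2 - z) < r ->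
    normc (f w2 - f w1) <= 2 * M * normc (w2 - w1).
Proof.
move=> H w1 w2 w1r w2r.
pose g (t : R) := w1 + t%:C * (w2 - w1).
have gr t : 0 <= t <= 1 -> normc (g t - z) < r.
  move=> /andP[t0 t1]; have -> : g t - z = (1 - t)%:C * (w1 - z) + t%:C * (w2 - z).
    by rewrite /g rmorphB/=; ring.
  rewrite (le_lt_trans (ler_normcD _ _))// !normcMr !normc_real !ger0_norm ?subr_ge0//.
  have [h|h] := leP (normc (w1 - z)) (normc (w2 - z)).
    apply: le_lt_trans w2r; apply: (@le_trans _ _ ((1 - t) * normc (w2 - z) + t * normc (w2 - z))).
      by rewrite lerD2r ler_wpM2l// subr_ge0.
    by rewrite -mulrDl subrK mul1r.
  apply: le_lt_trans w1r; apply: (@le_trans _ _ ((1 - t) * normc (w1 - z) + t * normc (w1 - z))).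
    by rewrite lerD2l ler_wpM2l// ltW.
  by rewrite -mulrDl subrK mul1r.
have dg t : 0 <= t <= 1 -> cdiff2 (fun u _ => f (g u)) t 0 ('D_1 f (g t) * (w2 - w1)) 0.
  move=> t01; have [df _] := H _ (gr t t01).
  have d1 := cdiff2D (cdiff2_cst w1 t 0) (cdiff2M (cdiff2_fst t 0) (cdiff2_cst (w2 - w1) t 0)).
  have := cdiff2_comp d1 (derivable_cdiff df).
  by rewrite !(mul0r, mulr0, addr0, add0r, mul1r).
have key (S : R[i] -> R) : (forall a b c d (G : R -> R -> R[i]), cdiff2 G a b c d ->
      rdiff (fun u v => S (G u v)) a b (S c) (S d)) ->
    (forall a, `|S a| <= normc a) ->
    `|S (f w2) - S (f w1)| <= M * normc (w2 - w1).
  move=> Sd Sn.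
  have dS (t : R) : 0 <= t <= 1 -> is_derive t 1 (fun u => S (f (g u))) (S ('D_1 f (g t) * (w2 - w1))).
    by move=> t01; exact: rdiff_is_derivel (Sd _ _ _ _ _ (dg t t01)).
  have [||c c01] := @MVT_segment _ (fun u => S (f (g u))) (fun t => S ('D_1 f (g t) * (w2 - w1))) 0 1 ler01.
  - by move=> t; rewrite in_itv/= => /andP[t0 t1]; apply: dS; rewrite !ltW.
  - apply: continuous_itv_within => t t01; apply: differentiable_continuous.
    by apply/derivable1_diffP; case: (dS t t01).
  have -> : g 1 = w2 by rewrite /g mul1r addrC subrK.
  have -> : g 0 = w1 by rewrite /g mul0r addr0.
  move=> ->; rewrite subr0 mulr1 (le_trans (Sn _))// normcMr ler_wpM2r ?normc_ge0//.
  by have [_] := H _ (gr c c01).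
rewrite (le_trans (normc_le_reim _))// reB imB.
have -> : 2 * M * normc (w2 - w1) = M * normc (w2 - w1) + M * normc (w2 - w1) by ring.
apply: lerD; apply: key => [a b c d G /cdiff2_rdiff[]//|]; [exact: normc_re|exact: normc_im].
Qed.

(** By continuity of the derivative, [f w - a * w] has a derivative of modulus at most [normc a / 4]
    near [z], hence is Lipschitz with constant [normc a / 2]. So [f] keeps at least half of the
    linear growth [normc a], and [L = 2 / normc a]. *)
Lemma locally_expanding f z (r : R) : 0 < r ->
  (forall w, normc (w - z) < r -> derivable f w 1) -> 'D_1 f z != 0 ->
  exists (d L : R), [/\ 0 < d, 0 < L & forall w1 w2, normc (w1 - z) < d -> normc (w2 - z) < d ->
    normc (w2 - w1) <= L * normc (f w2 - f w1)].
Proof.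
move=> r0 fd fz; set a := 'D_1 f z; have a0 : 0 < normc a by rewrite normc_gt0.
have cf' := cdiff_continuous (derivable_cdiff (derivable_derive r0 fd)).
have a4 : 0 < normc a / 4 by rewrite divr_gt0.
have [d d0 Hd] := continuousC_eps cf' a4.
exists (Num.min d r), (2 / normc a); split; [by rewrite lt_min d0|by rewrite divr_gt0|].
move=> w1 w2 w1d w2d.
pose g (w : Cplx R) := f w - a * w.
have dg w : normc (w - z) < Num.min d r -> cdiff g w ('D_1 f w - a).
  rewrite lt_min => /andP[_ wr].
  have := cdiffD (derivable_cdiff (fd w wr)) (cdiffZ (- a) (cdiff_id w)).
  by rewrite mulr1; apply: near_cdiff; apply/nbhs_normc; exists 1 => // v _; rewrite mulNr.
have gb w : normc (w - z) < Num.min d r -> derivable g w 1 /\ normc ('D_1 g w) <= normc a / 4.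
  move=> wd; have H := dg w wd; split; first exact: cdiff_derivable H.
  rewrite (cdiff_derive H); apply/ltW/Hd.
  by move: wd; rewrite lt_min => /andP[].
have := mean_value_bound gb w1d w2d.
have -> : 2 * (normc a / 4) = normc a / 2 by field.
have -> : g w2 - g w1 = (f w2 - f w1) - a * (w2 - w1) by rewrite /g; ring.
move=> B; have := ler_normc_dist (a * (w2 - w1)) (f w2 - f w1).
rewrite normcBC normcMr => B2.
have B3 : normc a * normc (w2 - w1) - normc (f w2 - f w1) <= normc a / 2 * normc (w2 - w1).
  exact: le_trans B2 B.
rewrite mulrAC ler_pdivlMr//; rewrite mulrAC in B3; move: B3.
by move: (normc _) (normc _) (normc _) => s t u; lra.
Qed.

End LocalExpansion.

(** * From local to global on compact sets *)

Section CompactInduction.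
Import finmap.
Context {R : realType}.

(** A finite subcover, merged by [QU]. Used for the local integrability of [h], for the local bounds
    on composition with [f], and for a uniform radius around a compact set. *)
Lemma compact_ind_open (K : set (Cplx R)) (Q : set (Cplx R) -> Prop) : compact K ->
  Q set0 -> (forall A B, Q A -> Q B -> Q (A `|` B)) ->
  (forall z, K z -> exists A, [/\ open A, A z & Q A]) ->
  exists A, [/\ open A, K `<=` A & Q A].
Proof.
move=> cK Q0 QU QK.
have /choice[A HA] : forall z, exists A, K z -> [/\ open A, A z & Q A].
  by move=> z; have [/QK[A H]|nK] := pselect (K z); [exists A|exists set0].
have := cK; rewrite compact_cover => /(_ _ K A)[||D DK KD].
- by move=> z /HA[].
- by move=> z Kz; exists z => //; have [] := HA z Kz.
have oD : open (\bigcup_(i in [set` D]) A i).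
  by apply: bigcup_open => i /DK/set_mem/HA[].
exists (\bigcup_(i in [set` D]) A i); split => //.
rewrite bigcup_fset; rewrite big_seq.
elim/big_ind : _ => // i /DK/set_mem/HA[] //.
Qed.

End CompactInduction.

(** * Integration by parts *)

Section CompactlySupported.
Context {R : realType}.
Local Notation P := (measurableTypeR R * measurableTypeR R)%type.
Local Notation lam := (@plane_borel R).
Implicit Types (k g : P -> R).

Lemma bounded_integrable k M C : measurable_fun setT k -> (forall p, `|k p| <= C) ->
  (forall p, ~ square M p -> k p = 0) -> lam.-integrable setT (EFin \o k).
Proof.
move=> mk kC k0.
have -> : EFin \o k = (EFin \o k) \_ (square M).
  apply/funext => p; rewrite /patch; case: ifPn => // /negP pM /=.
  by rewrite k0// => h; apply: pM; rewrite inE.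
apply/(integrable_mkcond _ (measurable_square M)).
apply: measurable_bounded_integrable => //.
- exact: measurable_square.
- exact: square_fin.
- exact: measurable_funS mk.
- exists C; split; first exact: num_real.
  by move=> B CB p _; exact: le_trans (kC p) (ltW CB).
Qed.

Lemma square_bounded k M : continuous (k : R * R -> R) ->
  (forall p, ~ square M p -> k p = 0) -> exists2 C, 0 < C & forall p, `|k p| <= C.
Proof.
move=> ck k0.
have cS : compact ((k : R * R -> R) @` (square M : set (R * R))).
  apply: continuous_compact.
    exact: continuous_subspaceT.
  by apply: compact_setX; exact: segment_compact.
have [C [_ HC]] := compact_bounded cS.
exists (`|C| + 1); first by rewrite ltr_wpDl.
move=> p; have [Mp|nM] := pselect (square M p).
  apply: (HC (`|C| + 1)); last by exists p.
  by rewrite (le_lt_trans (ler_norm _))// ltrDl.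
by rewrite k0// normr0 addr_ge0.
Qed.

Lemma continuous_integrable k M : continuous (k : R * R -> R) ->
  (forall p, ~ square M p -> k p = 0) -> lam.-integrable setT (EFin \o k).
Proof.
move=> ck k0; have [C _ kC] := square_bounded ck k0.
exact: bounded_integrable (continuous_plane_measurable ck) kC k0.
Qed.

Lemma integral_derivative (u v : R -> R) (M : R) : (forall t : R, is_derive t 1 u (v t)) ->
  continuous v -> (forall t, M < `|t| -> u t = 0) -> (forall t, M < `|t| -> v t = 0) ->
  (\int[@lebesgue_measure R]_t (v t)%:E = 0)%E.
Proof.
(* [a] exceeds both [0] and [M]: the interval is nondegenerate and [u] vanishes at both ends. *)
move=> du cv u0 v0; pose a : R := `|M| + 1.
have a0 : 0 < a by rewrite ltr_wpDl.
have Ma : M < a by rewrite (le_lt_trans (ler_norm _))// ltrDl.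
have out t : ~ `[(- a), a]%classic t -> v t = 0.
  by rewrite /= in_itv/= -ler_norml => /negP; rewrite -ltNge => h; apply: v0; exact: lt_trans h.
have cu : continuous u.
  by move=> t; apply: differentiable_continuous; apply/derivable1_diffP; case: (du t).
transitivity (\int[@lebesgue_measure R]_(t in `[(- a)%R, a]) (v t)%:E)%E.
  rewrite [RHS]integral_mkcond; apply: eq_integral => t _; rewrite /patch.
  by case: ifPn => // /negP tn; rewrite out// => h; apply: tn; rewrite inE.
rewrite (@continuous_FTC2 _ v u).
- have -> : u a = 0 by apply: u0; rewrite gtr0_norm.
  have -> : u (- a) = 0 by apply: u0; rewrite normrN gtr0_norm.
  by rewrite subee.
- by rewrite (lt_trans _ a0)// oppr_lt0.
- exact: continuous_subspaceT.
- split.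
  + by move=> t _; case: (du t).
  + by apply: cvg_at_right_filter; exact: cu.
  + by apply: cvg_at_left_filter; exact: cu.
- by move=> t _; rewrite derive1E; case: (du t).
Qed.

Lemma continuous_pairl (y : R) : continuous (fun t : R => ((t, y) : R * R)).
Proof. by move=> t; apply: (@cvg_pair _ _ _ (nbhs t) (nbhs t) (nbhs y)); [exact: cvg_id|exact: cvg_cst]. Qed.

Lemma continuous_pairr (x : R) : continuous (fun t : R => ((x, t) : R * R)).
Proof. by move=> t; apply: (@cvg_pair _ _ _ (nbhs t) (nbhs x) (nbhs t)); [exact: cvg_cst|exact: cvg_id]. Qed.

Lemma integral_partial_x g gx M : (forall x y : R, is_derive x 1 (fun t : R => g (t, y)) (gx (x, y))) ->
  continuous (gx : R * R -> R) -> (forall p, ~ square M p -> g p = 0) ->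
  (forall p, ~ square M p -> gx p = 0) -> (\int[lam]_p (gx p)%:E = 0)%E.
Proof.
move=> dg cgx g0 gx0; have ig := continuous_integrable cgx gx0.
rewrite -[LHS]/(\int[(@lebesgue_measure R \x @lebesgue_measure R)%E]_p (EFin \o gx) p)%E.
rewrite -integral21_prod_meas1//.
rewrite integral0_eq// => y _ /=; apply: (@integral_derivative (fun t : R => g (t, y)) (fun t : R => gx (t, y)) M).
- move=> t; apply: (@continuous_comp _ _ _ (fun t => (t, y)) (gx : R * R -> R)); last exact: cgx.
  exact: (@continuous_pairl y t).
- by move=> t tM; apply: g0 => /squareP[/=]; rewrite leNgt tM.
- by move=> t tM; apply: gx0 => /squareP[/=]; rewrite leNgt tM.
Qed.

Lemma integral_partial_y g gy M : (forall x y : R, is_derive y 1 (fun t : R => g (x, t)) (gy (x, y))) ->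
  continuous (gy : R * R -> R) -> (forall p, ~ square M p -> g p = 0) ->
  (forall p, ~ square M p -> gy p = 0) -> (\int[lam]_p (gy p)%:E = 0)%E.
Proof.
move=> dg cgx g0 gx0; have ig := continuous_integrable cgx gx0.
rewrite -[LHS]/(\int[(@lebesgue_measure R \x @lebesgue_measure R)%E]_p (EFin \o gy) p)%E.
rewrite -integral12_prod_meas1//.
rewrite integral0_eq// => x _ /=; apply: (@integral_derivative (fun t : R => g (x, t)) (fun t : R => gy (x, t)) M).
- move=> t; apply: (@continuous_comp _ _ _ (fun t => (x, t)) (gy : R * R -> R)); last exact: cgx.
  exact: (@continuous_pairr x t).
- by move=> t tM; apply: g0 => /squareP[_ /=]; rewrite leNgt tM.
- by move=> t tM; apply: gx0 => /squareP[_ /=]; rewrite leNgt tM.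
Qed.

End CompactlySupported.

(** * Holomorphic functions are weak solutions *)

Section WeakHolomorphic.
Context {R : realType}.
Local Notation P := (measurableTypeR R * measurableTypeR R)%type.
Local Notation lam := (@plane_borel R).
Implicit Types (F eta : Cplx R -> Cplx R) (V : set (Cplx R)) (z w : Cplx R).

Lemma bounded_normc V : bounded_set V -> exists M : R, forall z, V z -> normc z <= M.
Proof.
move=> [M [Mr HM]]; exists (re (M + 1)) => z Az.
have := HM (M + 1) _ z Az; rewrite ltrDl ltr01 => /(_ isT).
by rewrite /= normcC lecE /= => /andP[_].
Qed.

Lemma bounded_in_square V : bounded_set V ->
  exists M : R, forall p : P, V (p.1 +i* p.2) -> square M p.
Proof.
move=> /bounded_normc[M HM]; exists M => p /HM pM; apply/squareP; split.
  exact: le_trans (normc_re _) pM.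
exact: le_trans (normc_im _) pM.
Qed.

Lemma compact_in_square (K : set (Cplx R)) : compact K ->
  exists M : R, forall p : P, K (p.1 +i* p.2) -> square M p.
Proof.
move=> cK.
have bd (h : Cplx R -> R) : continuous h -> exists M : R, forall z, K z -> `|h z| <= M.
  move=> ch; have cS : compact (h @` K).
    by apply: continuous_compact => //; exact: continuous_subspaceT.
  have [C [_ HC]] := compact_bounded cS; exists (C + 1) => z Kz.
  by apply: (HC (C + 1)); [rewrite ltrDl|exists z].
have [M1 H1] := bd _ continuous_re; have [M2 H2] := bd _ continuous_im.
exists (Num.max M1 M2) => p /[dup] /H1 p1 /H2 p2; apply/squareP.
by rewrite !le_max p1 p2 orbT.
Qed.

Lemma is_derive_near0 (u : R -> R) (x : R) : (\forall t \near x, u t = 0) -> is_derive x 1 u 0.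
Proof.
move=> u0; apply: eps_is_derive => e e0.
have ux : u x = 0 by exact: nbhs_singleton u0.
have /nbhs_ballP[k k0 H] := u0; exists k => // v vk.
rewrite ux H; first by rewrite mul0r !subr0 normr0 mulr_ge0// ltW.
by rewrite /ball/= distrC.
Qed.

Lemma near_horizontal (Q : Cplx R -> Prop) z : (\forall w \near z, Q w) ->
  \forall t \near re z, Q (t +i* im z).
Proof.
move=> /nbhs_normc[r r0 H]; apply/nbhs_ballP; exists r => // t tr; apply: H.
rewrite (le_lt_trans (normc_le_reim _))// reB imB/= subrr normr0 addr0.
by move: tr; rewrite /ball/= distrC.
Qed.

Lemma near_vertical (Q : Cplx R -> Prop) z : (\forall w \near z, Q w) ->
  \forall t \near im z, Q (re z +i* t).
Proof.
move=> /nbhs_normc[r r0 H]; apply/nbhs_ballP; exists r => // t tr; apply: H.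
rewrite (le_lt_trans (normc_le_reim _))// reB imB/= subrr normr0 add0r.
by move: tr; rewrite /ball/= distrC.
Qed.

Lemma near0_rpartial (phi : Cplx R -> R) z : (\forall w \near z, phi w = 0) ->
  rpartial_x phi z = 0 /\ rpartial_y phi z = 0.
Proof.
move=> H; rewrite /rpartial_x /rpartial_y !derive1E; split.
  by have := is_derive_near0 (near_horizontal H); case.
by have := is_derive_near0 (near_vertical H); case.
Qed.

Lemma continuous_reim F : continuous (fun z => re (F z)) -> continuous (fun z => im (F z)) ->
  continuous F.
Proof.
move=> cr ci z; apply: eps_continuousC => e e0.
have e2 : 0 < e / 2 by rewrite divr_gt0.
have /cvgrPdist_le/(_ _ e2)/nbhs_normc[d1 d10 H1] := cr z.
have /cvgrPdist_le/(_ _ e2)/nbhs_normc[d2 d20 H2] := ci z.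
exists (Num.min d1 d2); first by rewrite lt_min d10.
move=> w; rewrite lt_min => /andP[w1 w2].
rewrite (le_trans (normc_le_reim _))// reB imB (splitr e) lerD// distrC.
  exact: H1.
exact: H2.
Qed.

Lemma dbar_near0 eta z : (\forall w \near z, eta w = 0) ->
  [/\ partial_x eta z = 0, partial_y eta z = 0 & dbar eta z = 0].
Proof.
move=> H.
have [rx ry] : rpartial_x (fun w => re (eta w)) z = 0 /\ rpartial_y (fun w => re (eta w)) z = 0.
  by apply: near0_rpartial; apply: filterS H => w ->.
have [ix iy] : rpartial_x (fun w => im (eta w)) z = 0 /\ rpartial_y (fun w => im (eta w)) z = 0.
  by apply: near0_rpartial; apply: filterS H => w ->.
have px : partial_x eta z = 0 by rewrite /partial_x rx ix.
have py : partial_y eta z = 0 by rewrite /partial_y ry iy.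
by split => //; rewrite /dbar px py mulr0 addr0 mulr0.
Qed.

Lemma support_near0 eta z : ~ Defs.support eta z -> \forall w \near z, eta w = 0.
Proof.
move=> nS; have oS : open (~` Defs.support eta) by apply: closed_openC; exact: closed_closure.
apply: filterS (open_nbhs_nbhs (conj oS nS)) => w nw.
by apply/eqP; apply: contra_notT nw => h; exact: subset_closure.
Qed.

Lemma smooth_continuous eta : smooth eta ->
  [/\ continuous eta, continuous (partial_x eta) & continuous (partial_y eta)].
Proof.
move=> [sr si]; split; apply: continuous_reim.
- by have [] := sr [::].
- by have [] := si [::].
- by have [] := sr [:: true].
- by have [] := si [:: true].
- by have [] := sr [:: false].
- by have [] := si [:: false].
Qed.

Lemma continuous_dbar eta : smooth eta -> continuous (dbar eta).
Proof.
move=> /smooth_continuous[_ cx cy] z.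
have cc (c : Cplx R) : {for z, continuous (fun=> c : Cplx R)}.
  exact: cdiff_continuous (cdiff_cst c z).
exact: (cvgM (cc _) (cvgD (cx z) (cvgM (cc _) (cy z)))).
Qed.

Lemma near0_continuous F z : (\forall w \near z, F w = 0) -> {for z, continuous F}.
Proof.
move=> H; apply: eps_continuousC => e e0; have F0 := nbhs_singleton H.
have /nbhs_normc[d d0 {}H] := H; exists d => // w /H ->.
by rewrite F0 subrr normc_real normr0 ltW.
Qed.

Lemma continuous_plane F : continuous F ->
  continuous (fun p : R * R => re (F (p.1 +i* p.2))) /\
  continuous (fun p : R * R => im (F (p.1 +i* p.2))).
Proof.
move=> cF; split => p.
  apply: (@continuous_comp _ _ _ (fun p : R * R => F (p.1 +i* p.2)) (fun z : Cplx R => re z)).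
    by apply: (@continuous_comp _ _ _ (fun p : R * R => (p.1 +i* p.2 : Cplx R)) F); [exact: continuous_complex|exact: cF].
  exact: continuous_re.
apply: (@continuous_comp _ _ _ (fun p : R * R => F (p.1 +i* p.2)) (fun z : Cplx R => im z)).
  by apply: (@continuous_comp _ _ _ (fun p : R * R => (p.1 +i* p.2 : Cplx R)) F); [exact: continuous_complex|exact: cF].
exact: continuous_im.
Qed.

(** [F] is controlled on [V] only; at the other points the product vanishes in a neighbourhood. *)
Lemma continuousM_near0 F eta V : (forall z, V z -> {for z, continuous F}) -> continuous eta ->
  (forall z, ~ V z -> \forall w \near z, eta w = 0) -> continuous (fun z => F z * eta z).
Proof.
move=> cF ce e0 z; have [Vz|nV] := pselect (V z); first exact: (cvgM (cF z Vz) (ce z)).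
by apply: near0_continuous; apply: filterS (e0 z nV) => w ->; rewrite mulr0.
Qed.

Definition is_cderive (a : R -> R[i]) (x : R) (c : R[i]) : Prop :=
  is_derive x 1 (fun t => re (a t)) (re c) /\ is_derive x 1 (fun t => im (a t)) (im c).

Lemma is_cderiveM (a b : R -> R[i]) (x : R) (c d : R[i]) : is_cderive a x c -> is_cderive b x d ->
  is_cderive (fun t => a t * b t) x (c * b x + a x * d).
Proof.
move=> [ar ai] [br bi]; split.
  rewrite (_ : (fun t => _) = (fun t => re (a t) * re (b t) - im (a t) * im (b t))); last first.
    by apply/funext => t; rewrite reM.
  apply: is_derive_eq (is_deriveB (is_deriveM ar br) (is_deriveM ai bi)) _.
  by rewrite reD !reM -![_ *: _]/(_ * _); ring.
rewrite (_ : (fun t => _) = (fun t => re (a t) * im (b t) + im (a t) * re (b t))); last first.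
  by apply/funext => t; rewrite imM.
apply: is_derive_eq (is_deriveD (is_deriveM ar bi) (is_deriveM ai br)) _.
by rewrite imD !imM -![_ *: _]/(_ * _); ring.
Qed.

Lemma is_cderive_near0 (a : R -> R[i]) (x : R) : (\forall t \near x, a t = 0) -> is_cderive a x 0.
Proof.
by move=> H; split; apply: is_derive_near0; apply: filterS H => t ->.
Qed.

Lemma cdiff_is_cderive F x y c : cdiff F (x +i* y) c ->
  is_cderive (fun t => F (t +i* y)) x c /\ is_cderive (fun t => F (x +i* t)) y (c * 'i).
Proof.
move=> /cdiff2_plane/cdiff2_rdiff[dr di]; split; split.
- exact: rdiff_is_derivel dr.
- exact: rdiff_is_derivel di.
- exact: rdiff_is_deriver dr.
- exact: rdiff_is_deriver di.
Qed.

Lemma smooth_is_cderive eta x y : smooth eta ->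
  is_cderive (fun t => eta (t +i* y)) x (partial_x eta (x +i* y)) /\
  is_cderive (fun t => eta (x +i* t)) y (partial_y eta (x +i* y)).
Proof.
move=> [sr si]; have [_ /(_ (x +i* y))[rx ry]] := sr [::].
have [_ /(_ (x +i* y))[ix iy]] := si [::].
have H (u : R -> R) (t : R) : derivable u t 1 -> is_derive t 1 u (derive1 u t).
  by rewrite derive1E; exact: derivableP.
by split; split; [exact: (H _ _ rx)|exact: (H _ _ ix)|exact: (H _ _ ry)|exact: (H _ _ iy)].
Qed.

Lemma test_function_out V eta : open V -> test_function V eta ->
  forall z, ~ V z -> \forall w \near z, eta w = 0.
Proof. by move=> oV [_ _ SV] z nV; apply: support_near0 => /SV. Qed.

(** With [G = F * eta], the terms in ['D_1 F] cancel in [Gx + i Gy] because [i^2 = -1], so that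
    [F * dbar eta] is half of that sum. The partials [Gx] and [Gy] of the compactly supported [G]
    integrate to 0; their continuity rests on that of ['D_1 F], that is on [derivable_derive]. *)
Lemma weak_holomorphic V F eta : open V -> (forall z, V z -> derivable F z 1) ->
  test_function V eta ->
  [/\ continuous (fun z => F z * dbar eta z),
      (\int[lam]_p (re (F (p.1 +i* p.2) * dbar eta (p.1 +i* p.2)))%:E = 0)%E &
      (\int[lam]_p (im (F (p.1 +i* p.2) * dbar eta (p.1 +i* p.2)))%:E = 0)%E].
Proof.
move=> oV dF te; have out := test_function_out oV te; have [se cS SV] := te.
have [ce cx cy] := smooth_continuous se.
have outx z : ~ V z -> \forall w \near z, [/\ partial_x eta w = 0, partial_y eta w = 0 & dbar eta w = 0].
  move=> nV; have /nbhs_normc[r r0 H] := out z nV; apply/nbhs_normc; exists r => // w wr.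
  apply: dbar_near0; apply/nbhs_normc; exists (r - normc (w - z)); first by rewrite subr_gt0.
  move=> v vw; apply: H; rewrite (_ : v - z = (v - w) + (w - z)); last by ring.
  by rewrite (le_lt_trans (ler_normcD _ _))// -ltrBrDr.
have cF z : V z -> {for z, continuous F}.
  by move=> Vz; exact: cdiff_continuous (derivable_cdiff (dF z Vz)).
have cF' z : V z -> {for z, continuous (fun w => 'D_1 F w)}.
  move=> Vz; have [r r0 Vr] := open_normc oV Vz.
  apply: cdiff_continuous; apply: derivable_cdiff; apply: (derivable_derive r0) => w wr.
  exact/dF/Vr.
pose G z := F z * eta z.
pose Gx z := 'D_1 F z * eta z + F z * partial_x eta z.
pose Gy z := 'D_1 F z * 'i * eta z + F z * partial_y eta z.
have cD : continuous (fun z => F z * dbar eta z).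
  apply: (continuousM_near0 cF (continuous_dbar se)) => z /outx.
  by apply: filterS => w [].
have cGx : continuous Gx.
  move=> z; apply: (@cvgD _ (Cplx R) _ (nbhs z)).
    exact: (continuousM_near0 cF' ce out).
  by apply: (continuousM_near0 cF cx) => w /outx; apply: filterS => v [].
have cGy : continuous Gy.
  move=> z; apply: (@cvgD _ (Cplx R) _ (nbhs z)).
    apply: (@continuousM_near0 (fun z => 'D_1 F z * 'i) _ _ _ ce out) => w Vw.
    exact: (cvgM (cF' w Vw) (cdiff_continuous (cdiff_cst 'i w))).
  by apply: (continuousM_near0 cF cy) => w /outx; apply: filterS => v [].
have dG x y : is_cderive (fun t => G (t +i* y)) x (Gx (x +i* y)) /\
              is_cderive (fun t => G (x +i* t)) y (Gy (x +i* y)).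
  have [ex ey] := smooth_is_cderive x y se.
  have [Vz|nV] := pselect (V (x +i* y)).
    have [fx fy] := cdiff_is_cderive (derivable_cdiff (dF _ Vz)).
    by split; apply: is_cderiveM.
  have G0 : \forall w \near ((x +i* y) : Cplx R), G w = 0.
    by apply: filterS (out _ nV) => w; rewrite /G => ->; rewrite mulr0.
  have [px py _] := nbhs_singleton (outx _ nV).
  have e0 := nbhs_singleton (out _ nV).
  rewrite /Gx /Gy px py e0 !mulr0 addr0; split; apply: is_cderive_near0.
    exact: (near_horizontal G0).
  exact: (near_vertical G0).
have [M SM] := compact_in_square cS.
have ps (p : P) : ~ square M p -> [/\ G (p.1 +i* p.2) = 0, Gx (p.1 +i* p.2) = 0 & Gy (p.1 +i* p.2) = 0].
  move=> nM; have nS : ~ Defs.support eta (p.1 +i* p.2) by move=> /SM.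
  have e0 := support_near0 nS; have [px py _] := dbar_near0 e0.
  by rewrite /G /Gx /Gy px py (nbhs_singleton e0) !mulr0 addr0.
have [cGxr cGxi] := continuous_plane cGx.
have [cGyr cGyi] := continuous_plane cGy.
have E z : F z * dbar eta z = 2^-1 * (Gx z + (0 +i* 1) * Gy z).
  have key (d e q r u : R[i]) : u * (2^-1 * (q + (0 +i* 1) * r)) =
      2^-1 * ((d * e + u * q) + (0 +i* 1) * (d * (0 +i* 1) * e + u * r)).
    have ii : (0 +i* 1) * (0 +i* 1) = -1 :> R[i].
      by apply: complex_ext; rewrite ?(reM, imM, reN, imN)/=; ring.
    move: (0 +i* 1 : R[i]) ii => j ii.
    rewrite (_ : j * (d * j * e + u * r) = (j * j) * d * e + j * u * r); last by ring.
    by rewrite ii; ring.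
  exact: key.
have half (z : R[i]) : re (2^-1 * z) = 2^-1 * re z /\ im (2^-1 * z) = 2^-1 * im z.
  have -> : (2^-1 : R[i]) = (2^-1)%:C by rewrite fmorphV/= rmorph_nat.
  by rewrite reM imM/= !mul0r subr0 addr0.
have reI (z : R[i]) : re ((0 +i* 1) * z) = - im z /\ im ((0 +i* 1) * z) = re z.
  by rewrite reM imM/= !mul0r !mul1r sub0r add0r.
have ifin (k : P -> R) : continuous (k : R * R -> R) -> (forall p, ~ square M p -> k p = 0) ->
   lam.-integrable setT (EFin \o k) by move=> ck k0; exact: continuous_integrable ck k0.
have lin (a b : P -> R) (s : R) : lam.-integrable setT (EFin \o a) -> lam.-integrable setT (EFin \o b) ->
    (\int[lam]_p (a p)%:E = 0)%E -> (\int[lam]_p (b p)%:E = 0)%E ->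
    (\int[lam]_p (2^-1 * (a p + s * b p))%:E = 0)%E.
  move=> ia ib a0 b0.
  transitivity (\int[lam]_p (((2^-1)%:E * (a p)%:E) + ((2^-1 * s)%:E * (b p)%:E)))%E.
    by apply: eq_integral => p _; rewrite -!EFinM -EFinD; congr (_%:E); ring.
  rewrite integralD//; [|exact: integrableZl|exact: integrableZl].
  by rewrite !integralZl// a0 b0 !mule0 adde0.
have ir : lam.-integrable setT (EFin \o (fun p : P => re (Gx (p.1 +i* p.2)))).
  by apply: (ifin _ cGxr) => p /ps[_ -> _].
have ii : lam.-integrable setT (EFin \o (fun p : P => im (Gx (p.1 +i* p.2)))).
  by apply: (ifin _ cGxi) => p /ps[_ -> _].
have jr : lam.-integrable setT (EFin \o (fun p : P => re (Gy (p.1 +i* p.2)))).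
  by apply: (ifin _ cGyr) => p /ps[_ _ ->].
have ji : lam.-integrable setT (EFin \o (fun p : P => im (Gy (p.1 +i* p.2)))).
  by apply: (ifin _ cGyi) => p /ps[_ _ ->].
have zx (S : R[i] -> R) : continuous (fun p : R * R => S (Gx (p.1 +i* p.2))) -> S 0 = 0 ->
    (forall x y : R, is_derive x 1 (fun t : R => S (G (t +i* y))) (S (Gx (x +i* y)))) ->
    (\int[lam]_p (S (Gx (p.1 +i* p.2)))%:E = 0)%E.
  move=> cS0 S0 dS; apply: (@integral_partial_x _ (fun p => S (G (p.1 +i* p.2))) _ M) => //.
  - by move=> p /ps[->].
  - by move=> p /ps[_ ->].
have zy (S : R[i] -> R) : continuous (fun p : R * R => S (Gy (p.1 +i* p.2))) -> S 0 = 0 ->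
    (forall x y : R, is_derive y 1 (fun t : R => S (G (x +i* t))) (S (Gy (x +i* y)))) ->
    (\int[lam]_p (S (Gy (p.1 +i* p.2)))%:E = 0)%E.
  move=> cS0 S0 dS; apply: (@integral_partial_y _ (fun p => S (G (p.1 +i* p.2))) _ M) => //.
  - by move=> p /ps[->].
  - by move=> p /ps[_ _ ->].
have r0 := zx (@complex.Re R) cGxr erefl (fun x y => (dG x y).1.1).
have i0 := zx (@complex.Im R) cGxi erefl (fun x y => (dG x y).1.2).
have s0 := zy (@complex.Re R) cGyr erefl (fun x y => (dG x y).2.1).
have j0 := zy (@complex.Im R) cGyi erefl (fun x y => (dG x y).2.2).
split => //.
- rewrite -[RHS](lin _ _ (-1) ir ji r0 j0); apply: eq_integral => p _.
  by rewrite E (half _).1 reD (reI _).1 mulN1r.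
- rewrite -[RHS](lin _ _ 1 ii jr i0 s0); apply: eq_integral => p _.
  by rewrite E (half _).2 imD (reI _).2 mul1r.
Qed.

End WeakHolomorphic.

(** * Local integrability of weak solutions *)

Section WeakPair.
Context {R : realType}.
Local Notation P := (measurableTypeR R * measurableTypeR R)%type.
Local Notation lam := (@plane_borel R).
Local Notation pl := (@plane_lebesgue R).
Implicit Types (U O : set (Cplx R)) (k : P -> R).

Definition in_plane U : set P := [set p | U (p.1 +i* p.2)].

Lemma open_in_plane_nbhs U : open U -> open (in_plane U : set (R * R)).
Proof. by move=> oU; apply: open_comp oU => p _; exact: continuous_complex. Qed.

Lemma open_in_plane U : open U -> measurable (in_plane U).
Proof. by move=> oU; apply: open_plane_measurable; exact: open_in_plane_nbhs. Qed.

(* [h = k1 + i k2] is a weak solution when tested against the tensor products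
   [u(x)v(y)] supported in [O]. *)
Definition weak_pair O k1 k2 := forall (a b c d : R) (u v : R -> R), bump_function a b u -> bump_function c d v ->
  box a b c d `<=` O ->
  let X p := k1 p * (derive1 u p.1 * v p.2) - k2 p * (u p.1 * derive1 v p.2) in
  let Y p := k1 p * (u p.1 * derive1 v p.2) + k2 p * (derive1 u p.1 * v p.2) in
  [/\ lam.-integrable setT (EFin \o X), lam.-integrable setT (EFin \o Y),
      Rintegral lam setT X = 0 & Rintegral lam setT Y = 0].

Lemma bump_plane_continuous a b c d (u v : R -> R) : bump_function a b u -> bump_function c d v ->
  continuous (fun p : R * R => u p.1 * v p.2).
Proof.
move=> bu bv p; apply: cvgM.
  by apply: (@continuous_comp _ _ _ (fst : R * R -> R) u); [exact: cvg_fst|exact: bump_continuous bu _].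
by apply: (@continuous_comp _ _ _ (snd : R * R -> R) v); [exact: cvg_snd|exact: bump_continuous bv _].
Qed.

Lemma bump_plane_measurable a b c d (u v : R -> R) : bump_function a b u -> bump_function c d v ->
  measurable_fun [set: P] (fun p : P => u p.1 * v p.2).
Proof. by move=> bu bv; apply: continuous_plane_measurable; exact: bump_plane_continuous bu bv. Qed.

Lemma weak_pair_borel U (h : Cplx R -> Cplx R) : open U -> measurable_on U h ->
  weak_dbar_solution U h -> exists (N : set P) (k1 k2 : P -> R),
  [/\ measurable N /\ lam N = 0,
      measurable_fun setT k1 /\ measurable_fun setT k2,
      forall p, ~ in_plane U p -> k1 p = 0 /\ k2 p = 0,
      forall p, in_plane U p -> ~ N p -> k1 p = re (h (p.1 +i* p.2)) /\ k2 p = im (h (p.1 +i* p.2)) &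
      weak_pair U k1 k2].
Proof.
move=> oU [m1 m2] wU; have mU := open_in_plane oU.
have [N1 [mN1 N10 H1]] := borel_version mU m1.
have [N2 [mN2 N20 H2]] := borel_version mU m2.
pose N := N1 `|` N2; have mN : measurable N by exact: measurableU.
have N0 : lam N = 0.
  apply/eqP; rewrite eq_le measure_ge0 andbT.
  have H : (lam N <= lam N1 + lam N2)%E := measureU2 lam mN1 mN2.
  by rewrite (le_trans H)// N10 N20 adde0.
have k1m := H1 N mN (@subsetUl _ _ _); have k2m := H2 N mN (@subsetUr _ _ _).
pose k1 p := re (h (of_plane p)) * \1_(in_plane U `\` N) p.
pose k2 p := im (h (of_plane p)) * \1_(in_plane U `\` N) p.
have out p : ~ in_plane U p -> k1 p = 0 /\ k2 p = 0.
  by move=> nU; rewrite /k1 /k2 indicE memNset ?mulr0// => -[].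
have kE p : in_plane U p -> ~ N p -> k1 p = re (h (p.1 +i* p.2)) /\ k2 p = im (h (p.1 +i* p.2)).
  by move=> Up nN; rewrite /k1 /k2 indicE mem_set// !mulr1.
exists N, k1, k2; split => //.
move=> a b c d u v bu bv bU X Y.
have [[i1 i2] I0] := wU _ (tensor_test_function bu bv bU).
have [du bdu] := bump_derive bu; have [dv bdv] := bump_derive bv.
have mX : measurable_fun setT X.
  apply: measurable_funB; apply: measurable_funM => //.
    exact: bump_plane_measurable bdu bv.
  exact: bump_plane_measurable bu bdv.
have mY : measurable_fun setT Y.
  apply: measurable_funD; apply: measurable_funM => //.
    exact: bump_plane_measurable bu bdv.
  exact: bump_plane_measurable bdu bv.
pose eta z : Cplx R := (tensor u v z)%:C.
(* [S] will be the real or the imaginary part and [Z] the corresponding [X] or [Y]; [2^-1] is the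
   factor in [dbar]. *)
have key (S : R[i] -> R) (Z : P -> R) : measurable_fun setT Z ->
    (forall p, in_plane U p -> ~ N p -> S (h (of_plane p) * dbar eta (of_plane p)) = 2^-1 * Z p) ->
    (forall p, ~ in_plane U p -> Z p = 0) ->
    pl.-integrable (of_plane @^-1` U) (fun w => (S (h (of_plane w) * dbar eta (of_plane w)))%:E) ->
    Rintegral pl (of_plane @^-1` U) (fun w => S (h (of_plane w) * dbar eta (of_plane w))) = 0 ->
    lam.-integrable setT (EFin \o Z) /\ Rintegral lam setT Z = 0.
  move=> mZ ZE Z0 iZ I.
  have mZ2 : measurable_fun setT (fun p => 2^-1 * Z p) by apply: measurable_funM.
  have Z20 p : ~ in_plane U p -> 2^-1 * Z p = 0 by move=> /Z0 ->; rewrite mulr0.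
  have [[J _] E] := transfer mU mN N0 mZ2 ZE Z20.
  have iZ2 : lam.-integrable setT (EFin \o (fun p => 2^-1 * Z p)) by exact: J.
  have iZ' : lam.-integrable setT (EFin \o Z).
    have := integrableZl measurableT 2 iZ2; congr (lam.-integrable _ _).
    by apply/funext => p /=; rewrite -EFinM mulrA mulfV// mul1r.
  split => //; have : Rintegral lam setT (fun p => 2^-1 * Z p) = 0 by rewrite -E.
  rewrite RintegralZl// => /eqP; rewrite mulf_eq0 invr_eq0 pnatr_eq0 /=.
  by move=> /eqP.
have half (z : R[i]) : re (2^-1 * z) = 2^-1 * re z /\ im (2^-1 * z) = 2^-1 * im z.
  have -> : (2^-1 : R[i]) = (2^-1)%:C by rewrite fmorphV/= rmorph_nat.
  by rewrite reM imM/= !mul0r subr0 addr0.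
have dE p : dbar eta (of_plane p) =
    2^-1 * (derive1 u p.1 * v p.2 +i* (u p.1 * derive1 v p.2)).
  by rewrite /eta (dbar_tensor _ bu bv).
have [J1 I1] : lam.-integrable setT (EFin \o X) /\ Rintegral lam setT X = 0.
  apply: (key (@complex.Re R)) => //.
  - move=> p Up nN; have [k1E k2E] := kE p Up nN.
    by rewrite dE mulrCA (half _).1 reM /X k1E k2E.
  - by move=> p /out[k10 k20]; rewrite /X k10 k20 !mul0r subr0.
  - by move: I0 => /(congr1 (@complex.Re R)).
have [J2 I2] : lam.-integrable setT (EFin \o Y) /\ Rintegral lam setT Y = 0.
  apply: (key (@complex.Im R)) => //.
  - move=> p Up nN; have [k1E k2E] := kE p Up nN.
    by rewrite dE mulrCA (half _).2 imM /Y k1E k2E.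
  - by move=> p /out[k10 k20]; rewrite /Y k10 k20 !mul0r addr0.
  - by move: I0 => /(congr1 (@complex.Im R)).
by split.
Qed.

Lemma integrableM_bounded (D : set P) (k m : P -> R) (C : R) : measurable D ->
  lam.-integrable D (EFin \o k) ->
  measurable_fun D m -> (forall p, D p -> `|m p| <= C) ->
  lam.-integrable D (EFin \o (fun p => k p * m p)).
Proof.
move=> mD ik mm mC; have bm : [bounded m x | x in D].
  exists C; split; first exact: num_real.
  by move=> B CB p Dp; exact: le_trans (mC p Dp) (ltW CB).
by have := integrableMl mD ik mm bm.
Qed.

Lemma bump_plane_bounded a b c d (u v : R -> R) : bump_function a b u -> bump_function c d v ->
  exists2 C, 0 < C & forall p : P, `|u p.1 * v p.2| <= C.
Proof.
move=> /bump_bounded[A A0 HA] /bump_bounded[B B0 HB]; exists (A * B); first exact: mulr_gt0.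
by move=> p; rewrite normrM ler_pM.
Qed.

(** With [d1 = u' v] and [d2 = u v'], the functions [X = k1 d1 - k2 d2] and [Y = k1 d2 + k2 d1] are
    integrable by assumption. Solving for the pair, [k1 (d1^2 + d2^2) = X d1 + Y d2] and
    [k2 (d1^2 + d2^2) = Y d1 - X d2], and [d1^2 + d2^2] is bounded below where [d1 > k]. *)
Lemma weak_pair_locally_integrable U k1 k2 z : open U -> measurable_fun setT k1 ->
  measurable_fun setT k2 -> weak_pair U k1 k2 -> U z ->
  exists A, [/\ open A, A z & lam.-integrable (in_plane A) (EFin \o k1) /\
    lam.-integrable (in_plane A) (EFin \o k2)].
Proof.
move=> oU mk1 mk2 wU Uz; have [r r0 Hr] := open_normc oU Uz.
(* Both coordinates of a point of the box differ from those of [z] by at most [2 * e], so its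
   distance to [z] is at most [4 * e < r]. *)
pose e : R := r / 5; have e0 : 0 < e by rewrite divr_gt0.
pose x := re z; pose y := im z.
(* The interval is not centred at [x]: at its midpoint the derivative of the bump would vanish,
   whereas here it is positive. *)
pose u := flat_bump (x - e) (x + 2 * e) 0 0; pose v := flat_bump (y - e) (y + 2 * e) 0 0.
have bu : bump_function (x - e) (x + 2 * e) u by constructor.
have bv : bump_function (y - e) (y + 2 * e) v by constructor.
have bU : box (x - e) (x + 2 * e) (y - e) (y + 2 * e) `<=` U.
  move=> w [/andP[w1 w2] /andP[w3 w4]]; apply: Hr.
  have h1 : `|re w - x| <= 2 * e by rewrite ler_norml; apply/andP; split; lra.
  have h2 : `|im w - y| <= 2 * e by rewrite ler_norml; apply/andP; split; lra.
  rewrite (le_lt_trans (normc_le_reim _))// reB imB (le_lt_trans (lerD h1 h2))// /e; lra.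
have [du bdu] := bump_derive bu; have [dv bdv] := bump_derive bv.
have pos (t : R) : 0 < flat_bump (t - e) (t + 2 * e) 0 0 t.
  by rewrite /flat_bump mulr_gt0// flat_gt0//; lra.
have dpos (t : R) : 0 < derive1 (flat_bump (t - e) (t + 2 * e) 0 0) t.
  rewrite derive1E; have [_ ->] := is_derive_flat_bump (t - e) (t + 2 * e) 0 0 t.
  rewrite /flat_bump; have -> : t - (t - e) = e by ring.
  have -> : t + 2 * e - t = 2 * e by ring.
  rewrite oppr0 !mul0r !addr0 mulN1r subr_gt0.
  have e2 : 0 < 2 * e by rewrite mulr_gt0.
  rewrite /flat e0 e2 !expr0 !mul1r.
  rewrite (_ : e^-1 = 2 * (2 * e)^-1); last by field; rewrite gt_eqF.
  have i0 : 0 < (2 * e)^-1 by rewrite invr_gt0.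
  have := expR_gt0 (- (2 * (2 * e)^-1)); have := expR_gt0 (- (2 * e)^-1).
  move: (expR (- (2 * (2 * e)^-1))) (expR _) => s q s0 q0.
  rewrite -subr_gt0 (_ : _ - _ = 3 * (2 * e)^-1 ^+ 2 * (s * q)); last by ring.
  by rewrite mulr_gt0// ?mulr_gt0// exprn_gt0.
pose k := derive1 u x * v y / 2.
have k0 : 0 < k by rewrite divr_gt0// mulr_gt0// ?dpos ?pos.
pose d1 (p : P) := derive1 u p.1 * v p.2; pose d2 (p : P) := u p.1 * derive1 v p.2.
have [C1 C10 d1C] := bump_plane_bounded bdu bv; have [C2 C20 d2C] := bump_plane_bounded bu bdv.
have md1 := bump_plane_measurable bdu bv; have md2 := bump_plane_measurable bu bdv.
pose A := [set w : Cplx R | k < derive1 u (re w) * v (im w)].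
have oA : open A.
  apply: (@open_comp _ _ (tensor (derive1 u) v) [set t | k < t]); last exact: open_gt.
  by move=> w _; apply: continuous_tensor; [exact: bump_continuous bdu|exact: bump_continuous bv].
have mA := open_in_plane oA.
have [iX iY _ _] := wU _ _ _ _ _ _ bu bv bU.
exists A; split => //.
  rewrite /A /= -/x -/y /k ltr_pdivrMr// ltr_pMr ?ltr1n//.
  by rewrite mulr_gt0// ?dpos ?pos.
pose X p := k1 p * d1 p - k2 p * d2 p; pose Y p := k1 p * d2 p + k2 p * d1 p.
have sub (k' : P -> \bar R) : lam.-integrable setT k' -> lam.-integrable (in_plane A) k'.
  by apply: integrableS.
have iXd (d : P -> R) (C : R) : measurable_fun setT d -> (forall p, `|d p| <= C) ->
    lam.-integrable (in_plane A) (EFin \o (fun p => X p * d p)).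
  by move=> md dC; apply: sub; apply: (integrableM_bounded measurableT iX md (fun p _ => dC p)).
have iYd (d : P -> R) (C : R) : measurable_fun setT d -> (forall p, `|d p| <= C) ->
    lam.-integrable (in_plane A) (EFin \o (fun p => Y p * d p)).
  by move=> md dC; apply: sub; apply: (integrableM_bounded measurableT iY md (fun p _ => dC p)).
have main (k' Z : P -> R) : measurable_fun setT k' -> lam.-integrable (in_plane A) (EFin \o Z) ->
    (forall p, k' p * (d1 p ^+ 2 + d2 p ^+ 2) = Z p) ->
    lam.-integrable (in_plane A) (EFin \o k').
  move=> mk' iZ ZE.
  have iZ2 : lam.-integrable (in_plane A) (EFin \o (fun p => (k ^+ 2)^-1 * Z p)).
    by have := integrableZl mA (k ^+ 2)^-1 iZ.
  apply: le_integrable iZ2 => //.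
    by apply/measurable_EFinP; exact: measurable_funS mk'.
  move=> p Ap; rewrite !abse_EFin lee_fin -ZE normrM.
  rewrite [X in _ <= X * _]ger0_norm ?invr_ge0 ?exprn_ge0// ?(ltW k0)//.
  rewrite ler_pdivlMl ?exprn_gt0// normrM mulrC ler_wpM2l//.
  rewrite ger0_norm ?addr_ge0 ?sqr_ge0// (@le_trans _ _ (d1 p ^+ 2))// ?lerDl ?sqr_ge0//.
  by rewrite lerXn2r ?nnegrE ?(ltW k0) ?(ltW (lt_trans k0 Ap))// (ltW Ap).
split.
- apply: (main _ (fun p => X p * d1 p + Y p * d2 p) mk1) => [|p]; last by rewrite /X /Y; ring.
  exact: (integrableD mA (iXd _ _ md1 d1C) (iYd _ _ md2 d2C)).
- apply: (main _ (fun p => Y p * d1 p - X p * d2 p) mk2) => [|p]; last by rewrite /X /Y; ring.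
  exact: (integrableB mA (iYd _ _ md1 d1C) (iXd _ _ md2 d2C)).
Qed.

Lemma integrable_setU (A B : set P) k : measurable_fun setT k -> measurable A -> measurable B ->
  lam.-integrable A (EFin \o k) -> lam.-integrable B (EFin \o k) ->
  lam.-integrable (A `|` B) (EFin \o k).
Proof.
move=> mk mA mB /integrableP[_ Ak] /integrableP[_ Bk].
have mk' D : measurable_fun D (EFin \o k) by apply/measurable_EFinP; exact: measurable_funS mk.
apply/integrableP; split => //.
rewrite -(setDUK (@subsetUl _ A B)) ge0_integral_setU //.
- apply: lte_add_pinfty => //; apply: le_lt_trans Bk; apply: ge0_subset_integral => //.
  + by apply: measurableD => //; exact: measurableU.
  + exact: measurableT_comp.
  + by move=> p [[]].
- by apply: measurableD => //; exact: measurableU.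
- exact: measurableT_comp.
- by apply/disj_setPS => p [Ap []].
Qed.

Lemma weak_pair_integrable_nbhs U k1 k2 (K : set (Cplx R)) : open U -> measurable_fun setT k1 ->
  measurable_fun setT k2 -> weak_pair U k1 k2 -> compact K -> K `<=` U ->
  exists A, [/\ open A, K `<=` A & lam.-integrable (in_plane A) (EFin \o k1) /\
    lam.-integrable (in_plane A) (EFin \o k2)].
Proof.
move=> oU mk1 mk2 wU cK KU.
pose Q (A : set (Cplx R)) := measurable (in_plane A) /\ lam.-integrable (in_plane A) (EFin \o k1) /\
    lam.-integrable (in_plane A) (EFin \o k2).
have QU A B : Q A -> Q B -> Q (A `|` B).
  move=> [mA [A1 A2]] [mB [B1 B2]]; split; first exact: measurableU.
  by split; apply: integrable_setU.
have [||A [A1 A2 [_ A3]]] := compact_ind_open cK (Q := Q) _ QU; last by exists A.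
  by split; [exact: measurable0|split; exact: integrable_set0].
move=> z /KU Uz; have [A [oA Az iA]] := weak_pair_locally_integrable oU mk1 mk2 wU Uz.
by exists A; split => //; split => //; exact: open_in_plane.
Qed.

(** Continuity of translations asks for global integrability and a bounded support. The cut-off to
    [O] keeps the equation for boxes inside [O], since a product bump vanishes there with its
    derivatives outside its box. *)
Lemma weak_pair_localize U (h : Cplx R -> Cplx R) (K : set (Cplx R)) : open U -> bounded_set U ->
  measurable_on U h -> weak_dbar_solution U h -> compact K -> K `<=` U ->
  exists (N : set P) (k1 k2 : P -> R) (O : set (Cplx R)) (M : R),
  [/\ measurable N /\ lam N = 0,
      [/\ open O, K `<=` O & O `<=` U],
      [/\ measurable_fun setT k1, measurable_fun setT k2, lam.-integrable setT (EFin \o k1) &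
          lam.-integrable setT (EFin \o k2)],
      forall p, ~ square M p -> k1 p = 0 /\ k2 p = 0 &
      (forall p, in_plane O p -> ~ N p -> k1 p = re (h (p.1 +i* p.2)) /\ k2 p = im (h (p.1 +i* p.2))) /\
      weak_pair O k1 k2].
Proof.
move=> oU bU mh wh cK KU.
have [N [l1 [l2 [mN [ml1 ml2] lU lh wl]]]] := weak_pair_borel oU mh wh.
have [A [oA KA [i1 i2]]] := weak_pair_integrable_nbhs oU ml1 ml2 wl cK KU.
have [M UM] := bounded_in_square bU.
pose O := A `&` U; have oO : open O by exact: openI.
have mO := open_in_plane oO; have mA := open_in_plane oA.
pose k1 := l1 \_ (in_plane O); pose k2 := l2 \_ (in_plane O).
have inO (l : P -> R) p : in_plane O p -> (l \_ (in_plane O)) p = l p.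
  by move=> Op; rewrite patchE mem_set.
have outO (l : P -> R) p : ~ in_plane O p -> (l \_ (in_plane O)) p = 0.
  by move=> Op; rewrite patchE memNset.
have mk (l : P -> R) : measurable_fun setT l -> measurable_fun setT (l \_ (in_plane O)).
  by move=> ml; apply/(measurable_restrictT _ mO); exact: measurable_funS ml.
have ik (l : P -> R) : lam.-integrable (in_plane A) (EFin \o l) ->
    lam.-integrable setT (EFin \o (l \_ (in_plane O))).
  move=> il; rewrite -restrict_EFin; apply/(integrable_mkcond _ mO).
  by apply: integrableS il => //; move=> p [].
exists N, k1, k2, O, M; split => //.
- by split => //; [move=> z Kz; split; [exact: KA|exact: KU]|exact: subIsetr].
- by split; [exact: mk|exact: mk|exact: ik|exact: ik].
- by move=> p pM; rewrite /k1 /k2 !outO// => -[_ /UM].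
split.
  by move=> p Op nN; rewrite /k1 /k2 !inO//; apply: lh => //; case: Op.
move=> a b c d u v bu bv bO.
have bO' : box a b c d `<=` U by move=> w /bO[].
have [H1 H2 H3 H4] := wl _ _ _ _ _ _ bu bv bO'.
have [_ bdu] := bump_derive bu; have [_ bdv] := bump_derive bv.
have out p : ~ in_plane O p -> (u p.1 = 0 /\ derive1 u p.1 = 0) \/ (v p.2 = 0 /\ derive1 v p.2 = 0).
  move=> nO; have [/andP[a1 b1]|n1] := pselect (a < p.1 < b); last first.
    by left; rewrite (bump_out bu n1) (bump_out bdu n1).
  have [/andP[c1 d1]|n2] := pselect (c < p.2 < d); last first.
    by right; rewrite (bump_out bv n2) (bump_out bdv n2).
  by exfalso; apply: nO; apply: bO; rewrite /box/= !ltW.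
have EX : (fun p => k1 p * (derive1 u p.1 * v p.2) - k2 p * (u p.1 * derive1 v p.2)) =
          (fun p => l1 p * (derive1 u p.1 * v p.2) - l2 p * (u p.1 * derive1 v p.2)).
  apply/funext => p; have [Op|nO] := pselect (in_plane O p).
    by rewrite /k1 /k2 !inO.
  by case: (out p nO) => -[-> ->]; rewrite ?(mulr0, mul0r).
have EY : (fun p => k1 p * (u p.1 * derive1 v p.2) + k2 p * (derive1 u p.1 * v p.2)) =
          (fun p => l1 p * (u p.1 * derive1 v p.2) + l2 p * (derive1 u p.1 * v p.2)).
  apply/funext => p; have [Op|nO] := pselect (in_plane O p).
    by rewrite /k1 /k2 !inO.
  by case: (out p nO) => -[-> ->]; rewrite ?(mulr0, mul0r).
by move=> X Y; rewrite /X /Y EX EY.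
Qed.

End WeakPair.

(** * Mollification *)

Section Mollify.
Context {R : realType}.
Local Notation P := (measurableTypeR R * measurableTypeR R)%type.
Local Notation lam := (@plane_borel R).
Implicit Types (O : set (Cplx R)) (k : P -> R) (u v : R -> R).

Lemma bump_shift a b u (x : R) : bump_function a b u -> bump_function (a + x) (b + x) (fun t => u (t - x)).
Proof.
elim=> [m n|u1 u2 _ b1 _ b2|c u1 _ b1]; [|exact: bump_add|exact: bump_scale].
rewrite (_ : (fun t => _) = flat_bump (a + x) (b + x) m n); first by constructor.
by apply/funext => t; rewrite /flat_bump; congr (flat _ _ * flat _ _); ring.
Qed.

Lemma derive1_shift a b u (x t : R) : bump_function a b u ->
  derive1 (fun s => u (s - x)) t = derive1 u (t - x).
Proof.
by move=> /bump_derive[du _]; rewrite [LHS]derive1E; have [_ ->] := is_derive_shift (du (t - x)).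
Qed.

Lemma bump_plane_taylor a b c d u v : bump_function a b u -> bump_function c d v -> exists2 C : R, 0 < C &
  forall s t h l : R, `|u (s + h) * v (t + l) - u s * v t - derive1 u s * v t * h
    - u s * derive1 v t * l| <= C * (`|h| + `|l|) ^+ 2.
Proof.
move=> bu bv; have [_ bdu] := bump_derive bu.
have [A A0 uA] := bump_bounded bu; have [B B0 vB] := bump_bounded bv.
have [D D0 uD] := bump_bounded bdu.
have [M M0 uM] := bump_taylor bu; have [N N0 vN] := bump_taylor bv.
have [L L0 vL] := bump_lipschitz bv.
exists (M * B + D * L + A * N); first by rewrite !addr_gt0// mulr_gt0.
move=> s t h l.
rewrite (_ : _ - _ - _ - _ = (u (s + h) - u s - derive1 u s * h) * v (t + l)
   + derive1 u s * h * (v (t + l) - v t) + u s * (v (t + l) - v t - derive1 v t * l)); last by ring.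
have e1 : `|(u (s + h) - u s - derive1 u s * h) * v (t + l)| <= M * `|h| ^+ 2 * B.
  by rewrite normrM ler_pM// real_normK ?num_real.
have e2 : `|derive1 u s * h * (v (t + l) - v t)| <= D * `|h| * (L * `|l|).
  rewrite normrM ler_pM//; first by rewrite normrM ler_wpM2r.
  by rewrite (le_trans (vL _ _))// addrAC subrr add0r.
have e3 : `|u s * (v (t + l) - v t - derive1 v t * l)| <= A * (N * `|l| ^+ 2).
  by rewrite normrM ler_pM// real_normK ?num_real.
rewrite (le_trans (ler_normD _ _))// (le_trans (lerD (ler_normD _ _) (lexx _)))//.
rewrite (le_trans (lerD (lerD e1 e2) e3))//.
have := normr_ge0 h; have := normr_ge0 l; move: `|h| `|l| => x y y0 x0.
rewrite -subr_ge0 (_ : _ - _ = (M * B) * (2 * x * y + y ^+ 2) + (D * L) * (x ^+ 2 + x * y + y ^+ 2)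
   + (A * N) * (x ^+ 2 + 2 * x * y)); last by ring.
by rewrite !addr_ge0// !mulr_ge0 ?addr_ge0 ?mulr_ge0 ?sqr_ge0// ltW// mulr_gt0.
Qed.

(** A correlation: the kernel is a plain translate of the bump, hence itself an admissible test
    function. Differentiation in [x] or [y] therefore brings a minus sign. *)
Definition mollify k u v (x y : R) : R :=
  Rintegral lam setT (fun w => k w * (u (w.1 - x) * v (w.2 - y))).

Lemma shift_kernel a b c d u v (x y : R) : bump_function a b u -> bump_function c d v ->
  measurable_fun [set: P] (fun w : P => u (w.1 - x) * v (w.2 - y)) /\
  exists C, forall w : P, `|u (w.1 - x) * v (w.2 - y)| <= C.
Proof.
move=> bu bv; have bu' := bump_shift x bu; have bv' := bump_shift y bv.
split; first exact: bump_plane_measurable bu' bv'.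
by have [C _ HC] := bump_plane_bounded bu' bv'; exists C.
Qed.

Lemma mollify_integrable k a b c d u v (x y : R) : bump_function a b u -> bump_function c d v ->
  lam.-integrable setT (EFin \o k) ->
  lam.-integrable setT (EFin \o (fun w => k w * (u (w.1 - x) * v (w.2 - y)))).
Proof.
move=> bu bv ik; have [m [C HC]] := shift_kernel x y bu bv.
by apply: (integrableM_bounded measurableT ik m) => p _; exact: HC.
Qed.

(** The uniform quadratic remainder of the kernel, integrated against [|k|]. *)
Lemma mollify_taylor k a b c d u v : bump_function a b u -> bump_function c d v ->
  lam.-integrable setT (EFin \o k) -> exists2 C : R, 0 < C & forall x y x' y',
  `|mollify k u v x' y' - mollify k u v x y + mollify k (derive1 u) v x y * (x' - x)
    + mollify k u (derive1 v) x y * (y' - y)| <= C * (`|x' - x| + `|y' - y|) ^+ 2.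
Proof.
move=> bu bv ik; have [_ bdu] := bump_derive bu; have [_ bdv] := bump_derive bv.
have [C C0 HC] := bump_plane_taylor bu bv.
pose I := Rintegral lam setT (fun w => `|k w|).
have I0 : 0 <= I by apply: Rintegral_ge0.
have ik' : lam.-integrable setT (EFin \o (fun w => `|k w|)) by exact: integrable_norm ik.
exists (C * (I + 1)); first by rewrite mulr_gt0// ltr_wpDl.
move=> x y x' y'.
have i1 := mollify_integrable x' y' bu bv ik.
have i2 := mollify_integrable x y bu bv ik.
have i3 := mollify_integrable x y bdu bv ik.
have i4 := mollify_integrable x y bu bdv ik.
rewrite /mollify -RintegralZr// -[X in _ + X]RintegralZr//.
have i3' := integrableZr measurableT (x' - x) i3.
have i4' := integrableZr measurableT (y' - y) i4.
rewrite -RintegralB// -RintegralD//; last first.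
  exact: (integrableB measurableT i1 i2).
rewrite -RintegralD//; last first.
  exact: (integrableD measurableT (integrableB measurableT i1 i2) i3').
have iall := integrableD measurableT (integrableD measurableT (integrableB measurableT i1 i2) i3') i4'.
rewrite (le_trans (le_normr_Rintegral measurableT iall))//.
set D := (`|x' - x| + `|y' - y|) ^+ 2.
apply: (@le_trans _ _ (Rintegral lam setT (fun w => C * D * `|k w|))).
  apply: le_Rintegral => //.
  - exact: integrable_norm iall.
  - exact: (integrableZl measurableT (C * D) ik').
  - move=> w _ /=.
    rewrite (_ : _ + _ = k w * (u (w.1 - x') * v (w.2 - y') - u (w.1 - x) * v (w.2 - y) -
      derive1 u (w.1 - x) * v (w.2 - y) * (- (x' - x)) - u (w.1 - x) * derive1 v (w.2 - y) * (- (y' - y)))); last by ring.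
    rewrite normrM mulrC ler_wpM2r// /D -(normrN (x' - x)) -(normrN (y' - y)).
    have := HC (w.1 - x) (w.2 - y) (- (x' - x)) (- (y' - y)).
    by rewrite !opprB !addrA !subrK.
rewrite RintegralZl// -/I mulrAC ler_wpM2r ?sqr_ge0// ler_wpM2l ?(ltW C0)//.
by rewrite lerDl.
Qed.

Lemma mollify_rdiff k a b c d u v x y : bump_function a b u -> bump_function c d v ->
  lam.-integrable setT (EFin \o k) ->
  rdiff (mollify k u v) x y (- mollify k (derive1 u) v x y) (- mollify k u (derive1 v) x y).
Proof.
move=> bu bv ik e e0; have [C C0 HC] := mollify_taylor bu bv ik.
exists (e / (2 * C)); first by rewrite divr_gt0// mulr_gt0.
move=> x' y' xd yd; rewrite !mulNr !opprK (le_trans (HC x y x' y'))//.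
rewrite expr2 mulrA ler_wpM2r ?addr_ge0// mulrC -ler_pdivlMr//.
rewrite (@le_trans _ _ (e / (2 * C) + e / (2 * C)))//; first by rewrite lerD// ltW.
by rewrite le_eqVlt; apply/orP; left; apply/eqP; field; rewrite gt_eqF.
Qed.

Lemma mollify_continuous k a b c d u v : bump_function a b u -> bump_function c d v ->
  lam.-integrable setT (EFin \o k) -> continuous (fun p : R * R => mollify k u v p.1 p.2).
Proof.
move=> bu bv ik p; apply/cvgrPdist_le => e e0.
have [r r0 H] := rdiff_continuous (mollify_rdiff p.1 p.2 bu bv ik) e0.
exists (ball p.1 r, ball p.2 r); first by split; exact: nbhsx_ballx.
by move=> q [/= q1 q2]; rewrite distrC; apply: H; rewrite distrC.
Qed.

Lemma mollify_cdiff O k1 k2 a b c d u v (x y : R) : bump_function a b u -> bump_function c d v ->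
  lam.-integrable setT (EFin \o k1) -> lam.-integrable setT (EFin \o k2) ->
  weak_pair O k1 k2 -> box (a + x) (b + x) (c + y) (d + y) `<=` O ->
  cdiff (fun z : Cplx R => mollify k1 u v (re z) (im z) +i* mollify k2 u v (re z) (im z)) (x +i* y)
    (- mollify k1 (derive1 u) v x y +i* (- mollify k2 (derive1 u) v x y)).
Proof.
move=> bu bv i1 i2 wk bO.
have [_ bdu] := bump_derive bu; have [_ bdv] := bump_derive bv.
have [_ _] := wk _ _ _ _ _ _ (bump_shift x bu) (bump_shift y bv) bO.
under eq_Rintegral do rewrite (derive1_shift _ _ bu) (derive1_shift _ _ bv).
rewrite RintegralB//; [|exact: mollify_integrable bdu bv i1|exact: mollify_integrable bu bdv i2].
rewrite -/(mollify _ _ _ _ _) -/(mollify _ _ _ _ _) => E1.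
under eq_Rintegral do rewrite (derive1_shift _ _ bu) (derive1_shift _ _ bv).
rewrite RintegralD//; [|exact: mollify_integrable bu bdv i1|exact: mollify_integrable bdu bv i2].
rewrite -/(mollify _ _ _ _ _) -/(mollify _ _ _ _ _) => E2.
(* Two real remainders, each at most [e / 4] times a sum of two coordinates that are bounded by the
   modulus: [2 * 2 * (e / 4) = e]. *)
move=> e e0; have e2 : 0 < e / 4 by rewrite divr_gt0.
have [d1 d10 H1] := mollify_rdiff x y bu bv i1 e2.
have [d2 d20 H2] := mollify_rdiff x y bu bv i2 e2.
exists (Num.min d1 d2); first by rewrite lt_min d10.
move=> w; rewrite lt_min => /andP[w1 w2].
have nr : `|re w - x| <= normc (w - (x +i* y)).
  by have := normc_re (w - (x +i* y)); rewrite reB.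
have ni : `|im w - y| <= normc (w - (x +i* y)).
  by have := normc_im (w - (x +i* y)); rewrite imB.
have {}H1 := H1 (re w) (im w) (le_lt_trans nr w1) (le_lt_trans ni w1).
have {}H2 := H2 (re w) (im w) (le_lt_trans nr w2) (le_lt_trans ni w2).
(* [E1] and [E2] are the Cauchy-Riemann equations of the mollified pair. *)
have {}E1 : mollify k1 (derive1 u) v x y = mollify k2 u (derive1 v) x y by apply/eqP; rewrite -subr_eq0 E1.
have {}E2 : mollify k1 u (derive1 v) x y = - mollify k2 (derive1 u) v x y by apply/eqP; rewrite -addr_eq0 E2.
rewrite (le_trans (normc_le_reim _))// !reB !imB reM imM reB imB /=.
move: H1 H2; rewrite E2 -E1; move: (mollify k1 u v _ _) (mollify k1 u v _ _) => p2 p1.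
move: (mollify k2 u v _ _) (mollify k2 u v _ _) => q2 q1.
move: (mollify _ _ _ _ _) (mollify _ _ _ _ _) => m2 m1 H1 H2.
rewrite (_ : p1 - p2 - (_ - _) = p1 - p2 - - m1 * (re w - x) - - - m2 * (im w - y)); last by ring.
rewrite (_ : q1 - q2 - _ = q1 - q2 - - m2 * (re w - x) - - m1 * (im w - y)); last by ring.
rewrite (le_trans (lerD H1 H2))//.
have := ler_wpM2l (ltW e2) (lerD nr ni).
by lra.
Qed.

Lemma integrable_translate k s : measurable_fun setT k -> lam.-integrable setT (EFin \o k) ->
  lam.-integrable setT (EFin \o (k \o translate s)).
Proof.
move=> mk /integrableP[_ ik]; apply/integrableP; split.
  by apply/measurable_EFinP; apply: measurableT_comp => //; exact: measurable_translate.
rewrite -(plane_integral_translate s (f := fun p => `|(k p)%:E|%E)) in ik => //.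
by apply: measurableT_comp => //; apply/measurable_EFinP.
Qed.

Lemma Rintegral_translate k s : measurable_fun setT k ->
  Rintegral lam setT (k \o translate s) = Rintegral lam setT k.
Proof.
move=> mk; rewrite /Rintegral integralE [in RHS]integralE; congr (fine (_ - _)).
  rewrite -[RHS](plane_integral_translate s)//; first by apply: eq_integral => x _; rewrite ?funeposE ?funenegE.
  by apply: measurable_funepos; apply/measurable_EFinP.
rewrite -[RHS](plane_integral_translate s)//; first by apply: eq_integral => x _; rewrite ?funeposE ?funenegE.
by apply: measurable_funeneg; apply/measurable_EFinP.
Qed.

(** The substitution [w = s + p] moves the translation from the kernel to [k], where
    [L1_translation] can act on it. *)
Lemma mollify_translate k a b c d u v (p : P) : bump_function a b u -> bump_function c d v ->
  measurable_fun setT k ->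
  mollify k u v p.1 p.2 = Rintegral lam setT (fun s => k (translate p s) * (u s.1 * v s.2)).
Proof.
move=> bu bv mk; rewrite /mollify -(Rintegral_translate p).
  by congr Rintegral; apply/funext => s; rewrite /translate/= !addrK.
apply: measurable_funM => //.
by have [] := shift_kernel p.1 p.2 bu bv.
Qed.

End Mollify.

(** Tonelli's theorem on [P * P], used in [mollify_L1], rests on this instance. *)
Lemma plane_borel_sigma_finite (R : realType) : sigma_finite setT (@plane_borel R).
Proof.
exists (fun n => square n%:R).
  apply/seteqP; split => // p _; have [n [p1 p2]] : exists n : nat, `|p.1| <= n%:R /\ `|p.2| <= n%:R.
    exists (Num.bound `|p.1| + Num.bound `|p.2|)%N; rewrite natrD; split.
      by rewrite (le_trans (ltW (archi_boundP _)))// lerDl.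
    by rewrite (le_trans (ltW (archi_boundP _)))// lerDr.
  by exists n => //; apply/squareP.
by move=> n; split; [exact: measurable_square|exact: square_fin].
Qed.

HB.instance Definition _ (R : realType) :=
  Measure_isSigmaFinite.Build _ _ _ (@plane_borel R) (@plane_borel_sigma_finite R).

(** * Convergence of mollifications in L1 *)

Section MollifyL1.
Context {R : realType}.
Local Notation P := (measurableTypeR R * measurableTypeR R)%type.
Local Notation lam := (@plane_borel R).
Implicit Types (k : P -> R).

(** Not normalised: [mollifier_mass] is carried along and divided out at the very end. *)
Definition mollifier (e : R) : R -> R := flat_bump 0 e 0 0.

Definition mollifier_mass (e : R) : R :=
  Rintegral lam setT (fun s : P => mollifier e s.1 * mollifier e s.2).

Lemma bump_mollifier (e : R) : bump_function 0 e (mollifier e).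
Proof. by constructor. Qed.

Lemma mollifier_ge0 (e t : R) : 0 <= mollifier e t.
Proof. by rewrite /mollifier /flat_bump mulr_ge0// flat_ge0. Qed.

Lemma mollifier_integrable (e : R) :
  lam.-integrable setT (EFin \o (fun s : P => mollifier e s.1 * mollifier e s.2)).
Proof.
apply: (@continuous_integrable _ _ `|e|).
  exact: bump_plane_continuous (bump_mollifier e) (bump_mollifier e).
move=> p /squareP pe; have out t : ~ `|t| <= `|e| -> mollifier e t = 0.
  move=> te; apply: (bump_out (bump_mollifier e)) => /andP[t0 te']; apply: te.
  by rewrite (gtr0_norm t0) (gtr0_norm (lt_trans t0 te')) ltW.
have [p1|/out ->] := pselect (`|p.1| <= `|e|); last by rewrite mul0r.
have [p2|/out ->] := pselect (`|p.2| <= `|e|); last by rewrite mulr0.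
by exfalso; apply: pe.
Qed.

Lemma mollifier_mass_gt0 (e : R) : 0 < e -> 0 < mollifier_mass e.
Proof.
(* On [[e / 4, e / 2]] both [t] and [e - t] are at least [e / 4], so each of the two flat factors is
   at least [exp (- 4 / e)]. *)
move=> e0; pose c : R := expR (- (e / 4)^-1) ^+ 2; have c0 : 0 < c by rewrite exprn_gt0// expR_gt0.
have low t : e / 4 <= t -> expR (- (e / 4)^-1) <= flat 0 t.
  move=> et; have e4 : 0 < e / 4 by rewrite divr_gt0.
  have t0 : 0 < t by exact: lt_le_trans et.
  by rewrite /flat t0 expr0 mul1r ler_expR lerN2 lef_pV2.
have bl t : e / 4 <= t <= e / 2 -> c <= mollifier e t.
  move=> /andP[t1 t2]; rewrite /c expr2 /mollifier /flat_bump ler_pM ?expR_ge0//.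
    by apply: low; rewrite subr0.
  by apply: low; lra.
pose S : set P := `[e / 4, e / 2] `*` `[e / 4, e / 2].
have mS : measurable S by apply: measurableX; exact: measurable_itv.
have mf := bump_plane_measurable (bump_mollifier e) (bump_mollifier e).
have f0 (s : P) : (0 <= (mollifier e s.1 * mollifier e s.2)%:E)%E by rewrite lee_fin mulr_ge0// mollifier_ge0.
have E : (mollifier_mass e)%:E = (\int[lam]_s (mollifier e s.1 * mollifier e s.2)%:E)%E.
  by rewrite fineK//; exact: (integrable_fin_num measurableT (mollifier_integrable e)).
rewrite -lte_fin E; apply: (@lt_le_trans _ _ (\int[lam]_(s in S) (c ^+ 2)%:E)%E).
  have e42 : e / 4 <= e / 2 by lra.
  have e24 : 0 < e / 2 - e / 4 by lra.
  have SE : lam S = ((e / 2 - e / 4) * (e / 2 - e / 4))%:E by exact: plane_borel_rect.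
  have -> : (\int[lam]_(s in S) (c ^+ 2)%:E = (c ^+ 2)%:E * lam S)%E by exact: integral_cst.
  by rewrite SE -EFinM lte_fin; apply: mulr_gt0; [exact: exprn_gt0|exact: mulr_gt0].
apply: (@le_trans _ _ (\int[lam]_(s in S) (mollifier e s.1 * mollifier e s.2)%:E)%E).
  apply: ge0_le_integral => //.
  - by move=> s _; rewrite lee_fin sqr_ge0.
  - by apply/measurable_EFinP; exact: measurable_funS mf.
  - move=> s; rewrite /S /= !in_itv/= => -[s1 s2].
    by rewrite lee_fin expr2 ler_pM ?(ltW c0)// bl.
apply: ge0_subset_integral => //.
by apply/measurable_EFinP; exact: mf.
Qed.

(** The difference at [w] is at most the integral over [s] of [|k(w + s) - k(w)| phi(s)]. Tonelli's
    theorem lets [w] be integrated first, and [L1_translation] bounds the result by [d * phi(s)]. *)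
Lemma mollify_L1 k M (d : R) : measurable_fun setT k -> lam.-integrable setT (EFin \o k) ->
  (forall p, ~ square M p -> k p = 0) -> 0 < d ->
  exists2 e0, 0 < e0 & forall e : R, 0 < e -> e < e0 ->
  (\int[lam]_w `|mollify k (mollifier e) (mollifier e) w.1 w.2 - mollifier_mass e * k w|%:E
    <= (d * mollifier_mass e)%:E)%E.
Proof.
move=> mk ik k0 d0; have [e0 e00 He] := L1_translation mk ik k0 d0.
exists e0 => // e epos ee0.
have bm := bump_mollifier e.
pose phi (s : P) := mollifier e s.1 * mollifier e s.2.
have phi0 s : 0 <= phi s by rewrite mulr_ge0// mollifier_ge0.
have mphi : measurable_fun setT phi := bump_plane_measurable bm bm.
have [C _ phiC] := bump_plane_bounded bm bm.
have iphi := mollifier_integrable e.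
pose F (ws : P * P) : R := `|k (translate ws.2 ws.1) - k ws.1| * phi ws.2.
have mF : measurable_fun [set: P * P] (fun ws => (F ws)%:E).
  apply/measurable_EFinP; apply: measurable_funM; last first.
    by apply: (measurableT_comp mphi); exact: measurable_snd.
  apply: measurableT_comp => //; apply: measurable_funB; last first.
    by apply: (measurableT_comp mk); exact: measurable_fst.
  apply: (measurableT_comp mk).
  by apply: measurable_fun_pair; apply: measurable_funD; apply: measurableT_comp.
have F0 ws : (0 <= (F ws)%:E)%E by rewrite lee_fin mulr_ge0.
have FT : (\int[lam]_w \int[lam]_s (F (w, s))%:E = \int[lam]_s \int[lam]_w (F (w, s))%:E)%E.
  exact: (@fubini_tonelli _ _ P P R lam lam (fun ws => (F ws)%:E) mF F0).
have mFw : measurable_fun setT (fun w => \int[lam]_s (F (w, s))%:E)%E.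
  exact: (@measurable_fun_fubini_tonelli_F _ _ P P R lam (fun ws => (F ws)%:E) mF F0).
have mFs : measurable_fun setT (fun s => \int[lam]_w (F (w, s))%:E)%E.
  exact: (@measurable_fun_fubini_tonelli_G _ _ P P R lam (fun ws => (F ws)%:E) mF F0).
apply: (@le_trans _ _ (\int[lam]_w \int[lam]_s (F (w, s))%:E)%E).
  apply: ge0_le_integral.
  - exact: measurableT.
  - by move=> w _; rewrite lee_fin normr_ge0.
  - apply/measurable_EFinP; apply: measurableT_comp; first exact: normr_measurable.
    apply: measurable_funB.
      by apply: continuous_plane_measurable; exact: (mollify_continuous bm bm ik).
    by apply: measurable_funM.
  - exact: mFw.
  - move=> w _; rewrite (mollify_translate w bm bm mk).
    have it := integrable_translate w mk ik.
    have i1 : lam.-integrable setT (EFin \o (fun s => k (translate w s) * phi s)).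
      by apply: (integrableM_bounded measurableT it mphi) => p _; exact: phiC.
    have i1' : lam.-integrable setT (EFin \o (fun s => phi s * k w)).
      exact: (integrableZr measurableT (k w) iphi).
    have -> : mollifier_mass e * k w = Rintegral lam setT (fun s => phi s * k w).
      have ZZ := RintegralZr (k w) measurableT iphi.
      exact: (esym ZZ).
    have EB := RintegralB measurableT i1 i1'; rewrite -EB.
    have iB := integrableB measurableT i1 i1'.
    have EN := EFin_normr_Rintegral measurableT iB; rewrite EN {EN}.
    apply: (le_trans (le_abse_integral lam measurableT (measurable_int _ iB))).
    rewrite le_eqVlt; apply/orP; left; apply/eqP; apply: eq_integral => s _.
    rewrite abse_EFin /F /= -(mulrC (k w)) -mulrBl normrM (ger0_norm (phi0 s)).
    by congr (`|k _ - _| * _)%:E; rewrite /translate (addrC w.1) (addrC w.2).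
rewrite FT; apply: (@le_trans _ _ (\int[lam]_s (d * phi s)%:E)%E).
  apply: ge0_le_integral.
  - exact: measurableT.
  - by move=> s _; apply: integral_ge0 => w _; exact: F0.
  - exact: mFs.
  - by apply/measurable_EFinP; apply: measurable_funM.
  - move=> s _.
    have ms : measurable_fun setT (fun w => `|k (translate s w) - k w|%:E).
      apply/measurable_EFinP; apply: measurableT_comp; first exact: normr_measurable.
      apply: measurable_funB; last exact: mk.
      exact: (measurableT_comp mk (measurable_translate s)).
    have -> : (\int[lam]_w (F (w, s))%:E =
        (phi s)%:E * \int[lam]_w `|k (translate s w) - k w|%:E)%E.
      have n0 w : (0 <= `|k (translate s w) - k w|%:E)%E by rewrite lee_fin normr_ge0.
      have ps0 : (0 <= (phi s)%:E)%E by rewrite lee_fin phi0.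
      rewrite -(ge0_integralZl lam measurableT ms (fun w _ => n0 w) ps0).
      by apply: eq_integral => w _; rewrite -EFinM mulrC.
    have -> : (d * phi s)%:E = ((phi s)%:E * d%:E)%E by rewrite -EFinM mulrC.
    (* [L1_translation] concerns small [s] only; where [phi s] is nonzero both coordinates of [s]
       lie between [0] and [e < e0]. *)
    have [->|ps] := eqVneq (phi s) 0; first by rewrite !mul0e.
    have small t : mollifier e t != 0 -> `|t| < e0.
      apply: contra_neqP => te; apply: (bump_out bm) => /andP[t0 te']; apply: te.
      by rewrite (gtr0_norm t0); exact: lt_trans te' ee0.
    move: ps; rewrite mulf_eq0 negb_or => /andP[/small s1 /small s2].
    by apply: lee_wpmul2l; [rewrite lee_fin phi0|exact: He].
have -> : (\int[lam]_s (d * phi s)%:E = d%:E * \int[lam]_s (phi s)%:E)%E.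
  have ZZ := integralZl measurableT iphi d.
  by rewrite -ZZ; apply: eq_integral => s _; rewrite EFinM.
have -> : (\int[lam]_s (phi s)%:E = (mollifier_mass e)%:E)%E.
  have FF := fineK (integrable_fin_num measurableT iphi).
  exact: esym FF.
by rewrite EFinM.
Qed.

End MollifyL1.

(** * Pulling back *)

Lemma open_normc_ball {R : realType} (z : Cplx R) (e : R) : open [set w : Cplx R | normc (w - z) < e].
Proof.
rewrite openE => w /= we; apply/nbhs_normc; exists (e - normc (w - z)); first by rewrite subr_gt0.
move=> v vw /=; rewrite (_ : v - z = (v - w) + (w - z)); last by ring.
by rewrite (le_lt_trans (ler_normcD _ _))// -ltrBrDr.
Qed.

Lemma compact_in_plane {R : realType} (E : set (Cplx R)) : compact E -> measurable (in_plane E).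
Proof.
move=> cE; have oE : open (~` E).
  by apply: closed_openC; apply: compact_closed => //; exact: norm_hausdorff.
by rewrite -[in_plane E]setCK; apply: measurableC; exact: open_in_plane oE.
Qed.

Section CompactComparison.
Context {R : realType}.
Local Notation P := (measurableTypeR R * measurableTypeR R)%type.
Local Notation lam := (@plane_borel R).
Variables (V : set (Cplx R)) (f : Cplx R -> Cplx R).
Hypothesis oV : open V.
Hypothesis hf : holomorphic_on V f.

(** The map [f] in real coordinates, extended by 0 off [V] so as to be a Borel map of the whole
    plane. *)
Definition push (p : P) : P :=
  (((fun q : P => re (f (q.1 +i* q.2))) \_ (in_plane V)) p,
   ((fun q : P => im (f (q.1 +i* q.2))) \_ (in_plane V)) p).

Lemma pushE p : in_plane V p -> push p = (re (f (p.1 +i* p.2)), im (f (p.1 +i* p.2))).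
Proof. by move=> Vp; rewrite /push !patchE mem_set. Qed.

Lemma push_complex p : in_plane V p -> (push p).1 +i* (push p).2 = f (p.1 +i* p.2).
Proof. by move=> Vp; rewrite pushE//= -complex_eta. Qed.

Lemma measurable_push : measurable_fun setT push.
Proof.
have mV := open_in_plane oV.
have cf (q : R * R) : V (q.1 +i* q.2) -> {for q, continuous (fun q : R * R => f (q.1 +i* q.2))}.
  move=> Vq; apply: (@continuous_comp _ _ _ (fun p : R * R => (p.1 +i* p.2 : Cplx R)) f).
    exact: continuous_complex.
  exact: cdiff_continuous (derivable_cdiff (hf Vq)).
apply: measurable_fun_pair; apply/(measurable_restrictT _ mV).
  apply: open_fun_measurable; first exact: open_in_plane_nbhs.
  move=> q Vq; apply: (@continuous_comp _ _ _ (fun q : R * R => f (q.1 +i* q.2)) (fun z : Cplx R => re z)).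
    exact: cf.
  exact: continuous_re.
apply: open_fun_measurable; first exact: open_in_plane_nbhs.
move=> q Vq; apply: (@continuous_comp _ _ _ (fun q : R * R => f (q.1 +i* q.2)) (fun z : Cplx R => im z)).
  exact: cf.
exact: continuous_im.
Qed.

(** Near each point [locally_expanding] provides the hypothesis of [integral_comparison]. The
    constants of a finite cover of [E] add up, however often [f] takes a value. *)
Lemma compact_comparison (E : set (Cplx R)) : compact E -> E `<=` V ->
  (forall z, V z -> 'D_1 f z != 0) -> bounded_set (f @` V) ->
  exists2 C : R, 0 <= C & forall F : P -> \bar R, measurable_fun setT F -> (forall p, 0 <= F p)%E ->
    (\int[lam]_(p in in_plane E) F (push p) <= C%:E * \int[lam]_p F p)%E.
Proof.
move=> cE EV f'0 bf.
have [M0 UM] := bounded_in_square bf.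
(* The induction ranges over arbitrary sets [A], hence the measurable superset [B]. *)
pose Q (A : set (Cplx R)) := exists (C : R) (B : set P), [/\ 0 <= C, measurable B, in_plane A `<=` B &
  forall F : P -> \bar R, measurable_fun setT F -> (forall p, 0 <= F p)%E ->
    (\int[lam]_(p in B) F (push p) <= C%:E * \int[lam]_p F p)%E].
have mFp (F : P -> \bar R) B : measurable_fun setT F -> measurable_fun B (F \o push).
  by move=> mF; apply: (measurable_funS measurableT) => //; exact: measurableT_comp mF measurable_push.
have Q0 : Q set0.
  exists 0, set0; split => //.
  by move=> F mF F0; rewrite integral_set0 mul0e.
have QU A1 A2 : Q A1 -> Q A2 -> Q (A1 `|` A2).
  move=> [C1 [B1 [C10 mB1 AB1 H1]]] [C2 [B2 [C20 mB2 AB2 H2]]].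
  exists (C1 + C2), (B1 `|` B2); split; [exact: addr_ge0|exact: measurableU| |].
    by move=> p [/AB1|/AB2]; [left|right].
  move=> F mF F0; have mD : measurable ((B1 `|` B2) `\` B1) by apply: measurableD => //; exact: measurableU.
  have E12 : (\int[lam]_(p in B1 `|` B2) F (push p) =
      \int[lam]_(p in B1) F (push p) + \int[lam]_(p in (B1 `|` B2) `\` B1) F (push p))%E.
    rewrite -{1}(setDUK (@subsetUl _ B1 B2)); apply: ge0_integral_setU => //.
    - exact: mFp.
    - by apply/disj_setPS => p [Bp []].
  rewrite E12 EFinD ge0_muleDl ?lee_fin//; apply: leeD; first exact: H1.
  apply: le_trans (H2 F mF F0); apply: ge0_subset_integral => //; first exact: mFp.
  by move=> p [[]].
have QE z : E z -> exists A, [/\ open A, A z & Q A].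
  move=> /EV Vz; have [r r0 Vr] := open_normc oV Vz.
  have dz w : normc (w - z) < r -> derivable f w 1 by move=> /Vr/hf.
  have [d [L [d0 L0 HL]]] := locally_expanding r0 dz (f'0 z Vz).
  pose e := Num.min d r; have e0 : 0 < e by rewrite lt_min d0.
  pose A : set (Cplx R) := [set w | normc (w - z) < e].
  have oA : open A by exact: open_normc_ball.
  have AV p : in_plane A p -> in_plane V p /\ normc ((p.1 +i* p.2 : R[i]) - z) < d.
    by rewrite /in_plane /A/= lt_min => /andP[pd /Vr].
  have mA := open_in_plane oA.
  exists A; split => //; first by rewrite /A/= subrr normc_real normr0.
  (* [2 * L] because two coordinate differences of at most [s] only bound the modulus by [2 * s]. *)
  exists (4 * (2 * L) ^+ 2), (in_plane A); split => //; first by rewrite mulr_ge0// sqr_ge0.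
  move=> F mF F0; apply: (@integral_comparison _ _ push (2 * L) M0) => //.
  - exact: measurable_push.
  - by rewrite mulr_ge0// ltW.
  - move=> p q s /AV[Vp pd] /AV[Vq qd]; rewrite !pushE//= => h1 h2.
    have H := HL _ _ qd pd.
    have B : normc ((p.1 +i* p.2 : R[i]) - (q.1 +i* q.2)) <= 2 * L * s.
      rewrite (le_trans H)// mulrAC -mulrA mulrC mulrA ler_wpM2r ?(ltW L0)//.
      rewrite (le_trans (normc_le_reim _))// reB imB (le_trans (lerD h1 h2))//.
      by rewrite mulrC mulr2n mulrDr mulr1.
    split; rewrite (le_trans _ B)//.
      by have := normc_re ((p.1 +i* p.2 : R[i]) - (q.1 +i* q.2)); rewrite reB.
    by have := normc_im ((p.1 +i* p.2 : R[i]) - (q.1 +i* q.2)); rewrite imB.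
  - by move=> p /AV[Vp _]; apply: UM; rewrite push_complex//; exists (p.1 +i* p.2).
have [A [_ EA [C [B [C0 mB AB HC]]]]] := compact_ind_open cE Q0 QU QE.
exists C => // F mF F0; apply: le_trans (HC F mF F0).
apply: ge0_subset_integral => //.
- exact: compact_in_plane.
- exact: mFp.
- by move=> p Ep; apply/AB/EA.
Qed.

End CompactComparison.

(** * Weighted composition in L1 *)

Section PushIntegral.
Context {R : realType}.
Local Notation P := (measurableTypeR R * measurableTypeR R)%type.
Local Notation lam := (@plane_borel R).
Variables (E : set P) (T : P -> P) (C B : R) (m : P -> R).
Hypothesis mE : measurable E.
Hypothesis mT : measurable_fun setT T.
Hypothesis C0 : 0 <= C.
Hypothesis B0 : 0 <= B.
Hypothesis compare : forall F : P -> \bar R, measurable_fun setT F -> (forall p, 0 <= F p)%E ->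
    (\int[lam]_(p in E) F (T p) <= C%:E * \int[lam]_p F p)%E.
Hypothesis mm : measurable_fun setT m.
Hypothesis mB : forall p, `|m p| <= B.
Hypothesis m0 : forall p, ~ E p -> m p = 0.

(** The weight [m] is bounded and vanishes off [E], so the integral reduces to [E], where [compare]
    applies. *)
Lemma push_norm (l : P -> R) (D : R) : measurable_fun setT l ->
  (\int[lam]_p `|l p|%:E <= D%:E)%E ->
  (\int[lam]_p `|l (T p) * m p|%:E <= (B * (C * D))%:E)%E.
Proof.
move=> ml lD.
have mlT : measurable_fun setT (fun p => `|l (T p)|).
  by apply: measurableT_comp; [exact: normr_measurable|exact: (measurableT_comp ml mT)].
have mlTm : measurable_fun setT (fun p => `|l (T p) * m p|).
  apply: measurableT_comp; first exact: normr_measurable.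
  by apply: measurable_funM => //; exact: (measurableT_comp ml mT).
have mlE : measurable_fun E (fun p => `|l (T p)|%:E).
  by apply/measurable_EFinP; exact: measurable_funS mlT.
have -> : (\int[lam]_p `|l (T p) * m p|%:E = \int[lam]_(p in E) `|l (T p) * m p|%:E)%E.
  rewrite [RHS]integral_mkcond; apply: eq_integral => p _; rewrite patchE.
  by case: ifPn => // /negP nE; rewrite m0 ?mulr0 ?normr0// => Ep; apply: nE; rewrite inE.
apply: (@le_trans _ _ (\int[lam]_(p in E) (B%:E * `|l (T p)|%:E))%E).
  apply: ge0_le_integral => //.
  - by apply/measurable_EFinP; exact: measurable_funS mlTm.
  - exact: measurable_funeM.
  - by move=> p _; rewrite -EFinM lee_fin normrM mulrC ler_wpM2r.
have n0 p : E p -> (0 <= `|l (T p)|%:E)%E by rewrite lee_fin normr_ge0.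
have Bp : (0 <= B%:E)%E by rewrite lee_fin.
rewrite (ge0_integralZl lam mE mlE n0 Bp) EFinM; apply: lee_wpmul2l => //.
have mF : measurable_fun setT (fun p => `|l p|%:E).
  by apply/measurable_EFinP; apply: measurableT_comp => //; exact: normr_measurable.
have l0 p : (0 <= `|l p|%:E)%E by rewrite lee_fin normr_ge0.
apply: (le_trans (compare mF l0)).
by rewrite EFinM; apply: lee_wpmul2l => //; rewrite lee_fin.
Qed.

Lemma push_integrable (l : P -> R) : lam.-integrable setT (EFin \o l) ->
  lam.-integrable setT (EFin \o (fun p => l (T p) * m p)).
Proof.
move=> il; have ml : measurable_fun setT l by apply/measurable_EFinP; exact: measurable_int il.
have fl : (\int[lam]_p `|l p|%:E)%E \is a fin_num.
  exact: (integrable_fin_num measurableT (integrable_norm il)).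
have H : (\int[lam]_p `|l p|%:E <= (fine (\int[lam]_p `|l p|%:E))%:E)%E by rewrite (fineK fl).
apply/integrableP; split.
  by apply/measurable_EFinP; apply: measurable_funM => //; exact: (measurableT_comp ml mT).
exact: (le_lt_trans (push_norm ml H) (ltry _)).
Qed.

Lemma push_bound (l : P -> R) (D : R) : lam.-integrable setT (EFin \o l) ->
  (\int[lam]_p `|l p|%:E <= D%:E)%E ->
  `|Rintegral lam setT (fun p => l (T p) * m p)| <= B * (C * D).
Proof.
move=> il lD; have ml : measurable_fun setT l by apply/measurable_EFinP; exact: measurable_int il.
have ilT := push_integrable il.
have EN := EFin_normr_Rintegral measurableT ilT.
rewrite -lee_fin EN; apply: le_trans (push_norm ml lD).
exact: (le_abse_integral lam measurableT (measurable_int _ ilT)).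
Qed.

End PushIntegral.

(** A Lebesgue number that serves a whole open neighbourhood [A] of [K]; the preimage of [A] by [f]
    will be the domain on which to test. *)
Lemma compact_uniform_ball {R : realType} (K O : set (Cplx R)) : compact K -> open O -> K `<=` O ->
  exists (A : set (Cplx R)) (d : R), [/\ open A, K `<=` A, 0 < d &
    forall z w, A z -> normc (w - z) < d -> O w].
Proof.
move=> cK oO KO.
pose Q (A : set (Cplx R)) := exists2 d : R, 0 < d & forall z w, A z -> normc (w - z) < d -> O w.
have Q0 : Q set0 by exists 1.
have QU A B : Q A -> Q B -> Q (A `|` B).
  move=> [d d0 H] [e e0 H']; exists (Num.min d e); first by rewrite lt_min d0.
  by move=> z w [Az|Bz]; rewrite lt_min => /andP[h1 h2]; [exact: H h1|exact: H' h2].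
have QK z : K z -> exists A, [/\ open A, A z & Q A].
  move=> /KO Oz; have [r r0 Hr] := open_normc oO Oz.
  have r2 : 0 < r / 2 by rewrite divr_gt0.
  exists [set w | normc (w - z) < r / 2]; split; first exact: open_normc_ball.
    by rewrite /= subrr normc_real normr0.
  exists (r / 2) => // w v /= wz vw; apply: Hr.
  rewrite (_ : v - z = (v - w) + (w - z)); last by ring.
  by rewrite (le_lt_trans (ler_normcD _ _))// (splitr r) ltrD.
by have [A [oA KA [d d0 H]]] := compact_ind_open cK Q0 QU QK; exists A, d; split.
Qed.

(** * The mollified equation and its limit *)

Section Pullback.
Context {R : realType}.
Local Notation P := (measurableTypeR R * measurableTypeR R)%type.
Local Notation lam := (@plane_borel R).
Implicit Types (U V O : set (Cplx R)) (f h eta : Cplx R -> Cplx R) (k : P -> R).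

Lemma eq0_small (x c : R) : 0 <= c -> (forall d, 0 < d -> `|x| <= c * d) -> x = 0.
Proof.
move=> c0 H; apply/eqP; rewrite -normr_le0; apply/ler_addgt0Pl => e e0; rewrite addr0.
have c1 : 0 < c + 1 by rewrite ltr_wpDl.
have e1 : 0 < e / (c + 1) by rewrite divr_gt0.
rewrite (le_trans (H _ e1))// mulrA ler_pdivrMr// mulrC ler_wpM2l ?(ltW e0)//.
by rewrite lerDl.
Qed.

Lemma holomorphic_derive V f z : open V -> holomorphic_on V f -> V z ->
  cdiff (fun w => 'D_1 f w) z ('D_1 (fun w => 'D_1 f w) z).
Proof.
move=> oV hf Vz; have [r r0 Hr] := open_normc oV Vz.
by apply: derivable_cdiff; apply: (derivable_derive r0) => w /Hr/hf.
Qed.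

(** The weight against which [h \o f] is integrated. Grouped in this way, it is continuous with
    compact support. *)
Definition pull_density f eta z : Cplx R := 'D_1 f z * dbar eta z.

Lemma pull_density_continuous V f eta : open V -> holomorphic_on V f -> test_function V eta ->
  continuous (pull_density f eta).
Proof.
move=> oV hf te; have [se _ SV] := te.
apply: (@continuousM_near0 _ _ _ V) => [z Vz| |z nV].
- exact: cdiff_continuous (holomorphic_derive oV hf Vz).
- exact: continuous_dbar.
- have oS : open (~` Defs.support eta) by apply: closed_openC; exact: closed_closure.
  have nS : (~` Defs.support eta) z by move=> /SV.
  by apply: filterS (open_nbhs_nbhs (conj oS nS)) => w /support_near0/dbar_near0[].
Qed.

Lemma pull_density_out f eta z : ~ Defs.support eta z -> pull_density f eta z = 0.
Proof. by move=> /support_near0/dbar_near0[_ _ d0]; rewrite /pull_density d0 mulr0. Qed.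

Lemma mollified_pullback V f eta O A k1 k2 (d e : R) : open V -> holomorphic_on V f ->
  test_function V eta -> open A -> f @` Defs.support eta `<=` A ->
  (forall z w, A z -> normc (w - z) < d -> O w) -> 0 < e -> 2 * e < d ->
  lam.-integrable setT (EFin \o k1) -> lam.-integrable setT (EFin \o k2) ->
  weak_pair O k1 k2 ->
  let g k p := mollify k (mollifier e) (mollifier e) (push V f p).1 (push V f p).2 in
  let m1 (p : P) := re (pull_density f eta (p.1 +i* p.2)) in
  let m2 (p : P) := im (pull_density f eta (p.1 +i* p.2)) in
  Rintegral lam setT (fun p => g k1 p * m1 p - g k2 p * m2 p) = 0 /\
  Rintegral lam setT (fun p => g k1 p * m2 p + g k2 p * m1 p) = 0.
Proof.
move=> oV hf te oA KA AO e0 ed i1 i2 wk g m1 m2; have [se cS SV] := te.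
pose H : Cplx R -> Cplx R := fun z => mollify k1 (mollifier e) (mollifier e) (re z) (im z) +i*
  mollify k2 (mollifier e) (mollifier e) (re z) (im z).
have bm := bump_mollifier e.
(* The mollifier placed at [z] lives on the square of side [e] with lower left corner [z], whose
   points are within [2 * e] of [z]. *)
have dH z : A z -> derivable H z 1.
  move=> Az; rewrite (complex_eta z); apply: cdiff_derivable; apply: (mollify_cdiff bm bm i1 i2 wk).
  move=> w; rewrite /box/= !add0r => -[/andP[w1 w2] /andP[w3 w4]]; apply: AO Az _.
  rewrite (le_lt_trans (normc_le_reim _))// reB imB !ger0_norm ?subr_ge0//.
  by apply: le_lt_trans ed; lra.
(* On [V'] both [f] and [H \o f] are differentiable, and [eta] is still a test function there. *)
pose V' : set (Cplx R) := V `&` f @^-1` A.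
have cf z : V z -> {for z, continuous f} by move=> /hf/derivable_cdiff; exact: cdiff_continuous.
have oV' : open V'.
  rewrite openE => z [Vz Az]; apply: filterI; first exact: open_nbhs_nbhs.
  by apply: (cf z Vz); exact: open_nbhs_nbhs.
have te' : test_function V' eta.
  by split => // z Sz; split; [exact: SV|apply: KA; exists z].
pose F : Cplx R -> Cplx R := fun z => 'D_1 f z * H (f z).
have dF z : V' z -> derivable F z 1.
  move=> [Vz Az]; apply: (@cdiff_derivable _ _ _ _).
  apply: (cdiffM (holomorphic_derive oV hf Vz)).
  exact: (cdiff_comp (derivable_cdiff (hf z Vz)) (derivable_cdiff (dH _ Az))).
have [_ Er Ei] := weak_holomorphic oV' dF te'.
have FE p : F (p.1 +i* p.2) * dbar eta (p.1 +i* p.2) =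
    (g k1 p +i* g k2 p) * pull_density f eta (p.1 +i* p.2).
  have [Vp|nV] := pselect (in_plane V p).
    rewrite /F /pull_density /g pushE//= -/(H (f (p.1 +i* p.2))).
    by move: (H _) => c; ring.
  have nS : ~ Defs.support eta (p.1 +i* p.2) by move=> /SV.
  rewrite (pull_density_out _ nS) mulr0; have /dbar_near0[_ _ ->] := support_near0 nS.
  by rewrite mulr0.
split.
- rewrite /Rintegral (_ : (\int[lam]_p _)%E = 0)// -[RHS]Er.
  by apply: eq_integral => p _; rewrite FE reM.
- rewrite /Rintegral (_ : (\int[lam]_p _)%E = 0)// -[RHS]Ei.
  by apply: eq_integral => p _; rewrite FE imM.
Qed.

(** The two combinations of integrals vanish for the mollified pair. By [mollify_L1] and
    [push_bound] they differ from [mollifier_mass e] times those for [k1] and [k2] by at most a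
    constant times [d * mollifier_mass e]; the mass cancels and [d] is arbitrary. *)
Lemma pullback_integral V f eta O M k1 k2 : open V -> holomorphic_on V f ->
  (forall z, V z -> 'D_1 f z != 0) -> bounded_set (f @` V) ->
  test_function V eta -> open O -> f @` Defs.support eta `<=` O ->
  measurable_fun setT k1 -> measurable_fun setT k2 ->
  lam.-integrable setT (EFin \o k1) -> lam.-integrable setT (EFin \o k2) ->
  (forall p, ~ square M p -> k1 p = 0 /\ k2 p = 0) -> weak_pair O k1 k2 ->
  let T := push V f in
  let m1 (p : P) := re (pull_density f eta (p.1 +i* p.2)) in
  let m2 (p : P) := im (pull_density f eta (p.1 +i* p.2)) in
  [/\ lam.-integrable setT (EFin \o (fun p => k1 (T p) * m1 p - k2 (T p) * m2 p)),
      lam.-integrable setT (EFin \o (fun p => k1 (T p) * m2 p + k2 (T p) * m1 p)),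
      Rintegral lam setT (fun p => k1 (T p) * m1 p - k2 (T p) * m2 p) = 0 &
      Rintegral lam setT (fun p => k1 (T p) * m2 p + k2 (T p) * m1 p) = 0].
Proof.
move=> oV hf f'0 bf te oO KO mk1 mk2 i1 i2 kM wk T m1 m2; have [se cS SV] := te.
pose E := in_plane (Defs.support eta); have mE : measurable E := compact_in_plane cS.
have mT : measurable_fun setT T := measurable_push oV hf.
have [C C0 HC] := compact_comparison oV hf cS SV f'0 bf.
have [c1 c2] := continuous_plane (pull_density_continuous oV hf te).
have [M0 SM] := compact_in_square cS.
have m0 p : ~ E p -> m1 p = 0 /\ m2 p = 0.
  by move=> /pull_density_out d0; rewrite /m1 /m2 d0.
have m10 p : ~ E p -> m1 p = 0 by move=> /m0[].
have m20 p : ~ E p -> m2 p = 0 by move=> /m0[].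
have [B1 B10 mB1] : exists2 B, 0 < B & forall p, `|m1 p| <= B.
  by apply: (square_bounded (M := M0) c1) => p pM; apply: m10 => /SM.
have [B2 B20 mB2] : exists2 B, 0 < B & forall p, `|m2 p| <= B.
  by apply: (square_bounded (M := M0) c2) => p pM; apply: m20 => /SM.
have mm1 := continuous_plane_measurable c1; have mm2 := continuous_plane_measurable c2.
have int1 l : lam.-integrable setT (EFin \o l) ->
    lam.-integrable setT (EFin \o (fun p => l (T p) * m1 p)).
  by move=> il; exact: (push_integrable mE mT C0 (ltW B10) HC mm1 mB1 m10 il).
have int2 l : lam.-integrable setT (EFin \o l) ->
    lam.-integrable setT (EFin \o (fun p => l (T p) * m2 p)).
  by move=> il; exact: (push_integrable mE mT C0 (ltW B20) HC mm2 mB2 m20 il).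
have cf z : V z -> {for z, continuous f}.
  by move=> Vz; exact: cdiff_continuous (derivable_cdiff (hf z Vz)).
have cK : compact (f @` Defs.support eta).
  apply: continuous_compact => //; apply: continuous_in_subspaceT => z /set_mem/SV; exact: cf.
have [A [r [oA KA r0 AO]]] := compact_uniform_ball cK oO KO.
pose I l m := Rintegral lam setT (fun p : P => l (T p) * m p).
pose g e k (w : P) := mollify k (mollifier e) (mollifier e) w.1 w.2.
have near k (d : R) : measurable_fun setT k -> lam.-integrable setT (EFin \o k) ->
    (forall p, ~ square M p -> k p = 0) -> 0 < d ->
    exists2 e0, 0 < e0 & forall e : R, 0 < e -> e < e0 ->
      lam.-integrable setT (EFin \o g e k) /\
      `|I (g e k) m1 - mollifier_mass e * I k m1| <= B1 * (C * (d * mollifier_mass e)) /\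
      `|I (g e k) m2 - mollifier_mass e * I k m2| <= B2 * (C * (d * mollifier_mass e)).
  move=> mk ik k0 d0; have [e0 e00 He] := mollify_L1 mk ik k0 d0.
  exists e0 => // e ep ee; have {}He := He e ep ee.
  pose q w := g e k w - mollifier_mass e * k w.
  have bm := bump_mollifier e.
  have mg : measurable_fun setT (g e k).
    by apply: continuous_plane_measurable; exact: (mollify_continuous bm bm ik).
  have iZ : lam.-integrable setT (EFin \o (fun w => mollifier_mass e * k w)).
    exact: (integrableZl measurableT (mollifier_mass e) ik).
  have iq : lam.-integrable setT (EFin \o q).
    apply/integrableP; split.
      apply/measurable_EFinP; apply: measurable_funB; first exact: mg.
      by apply/measurable_EFinP; exact: (measurable_int _ iZ).
    exact: (le_lt_trans He (ltry _)).
  have ig : lam.-integrable setT (EFin \o g e k).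
    have := integrableD measurableT iq iZ; congr (lam.-integrable _ _).
    by apply/funext => w; rewrite /= -EFinD subrK.
  have split_I m : (forall l, lam.-integrable setT (EFin \o l) ->
        lam.-integrable setT (EFin \o (fun p => l (T p) * m p))) ->
      I (g e k) m - mollifier_mass e * I k m = I q m.
    move=> im; rewrite /I.
    have ZZ := RintegralZl (mollifier_mass e) measurableT (im _ ik); rewrite -ZZ.
    have iZm : lam.-integrable setT (EFin \o (fun p => mollifier_mass e * (k (T p) * m p))).
      exact: (integrableZl measurableT (mollifier_mass e) (im _ ik)).
    have BB := RintegralB measurableT (im _ ig) iZm; rewrite -BB.
    by congr Rintegral; apply/funext => p; rewrite /q; ring.
  split; [exact: ig|split].
    rewrite (split_I m1 int1).
    exact: (push_bound mE mT C0 (ltW B10) HC mm1 mB1 m10 iq He).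
  rewrite (split_I m2 int2).
  exact: (push_bound mE mT C0 (ltW B20) HC mm2 mB2 m20 iq He).
have k10 p : ~ square M p -> k1 p = 0 by move=> /kM[].
have k20 p : ~ square M p -> k2 p = 0 by move=> /kM[].
have EX := RintegralB measurableT (int1 _ i1) (int2 _ i2).
have EY := RintegralD measurableT (int2 _ i1) (int1 _ i2).
have c0 : 0 <= (B1 + B2) * C by rewrite mulr_ge0// addr_ge0// ltW.
have main (d : R) : 0 < d -> `|I k1 m1 - I k2 m2| <= (B1 + B2) * C * d /\
    `|I k1 m2 + I k2 m1| <= (B1 + B2) * C * d.
  move=> d0; have [e1 e10 H1] := near k1 d mk1 i1 k10 d0.
  have [e2 e20 H2] := near k2 d mk2 i2 k20 d0.
  (* A quarter of the minimum lies below [e1] and [e2] and satisfies [2 * e < r]. *)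
  pose e := Num.min (Num.min e1 e2) r / 4.
  have q0 : 0 < Num.min (Num.min e1 e2) r by rewrite !lt_min e10 e20 r0.
  have e0 : 0 < e by rewrite divr_gt0.
  have le1 : Num.min (Num.min e1 e2) r <= e1 by rewrite !ge_min lexx.
  have le2 : Num.min (Num.min e1 e2) r <= e2 by rewrite !ge_min lexx orbT.
  have le3 : Num.min (Num.min e1 e2) r <= r by rewrite !ge_min lexx orbT.
  have ee1 : e < e1 by apply: lt_le_trans le1; rewrite ltr_pdivrMr// ltr_pMr// ltr1n.
  have ee2 : e < e2 by apply: lt_le_trans le2; rewrite ltr_pdivrMr// ltr_pMr// ltr1n.
  have er : 2 * e < r by apply: lt_le_trans le3; rewrite /e mulrCA gtr_pMr// ltr_pdivrMr// mul1r ltr_nat.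
  have [g1 [H11 H12]] := H1 e e0 ee1; have [g2 [H21 H22]] := H2 e e0 ee2.
  have [Z1 Z2] := mollified_pullback oV hf te oA KA AO e0 er i1 i2 wk.
  have {}Z1 : I (g e k1) m1 - I (g e k2) m2 = 0.
    by rewrite /I -(RintegralB measurableT (int1 _ g1) (int2 _ g2)).
  have {}Z2 : I (g e k1) m2 + I (g e k2) m1 = 0.
    by rewrite /I -(RintegralD measurableT (int2 _ g1) (int1 _ g2)).
  have mass0 := mollifier_mass_gt0 e0.
  move: (I (g e k1) m1) (I (g e k2) m2) (I (g e k1) m2) (I (g e k2) m1) (mollifier_mass e)
    H11 H12 H21 H22 Z1 Z2 mass0 => a b c' a' mu H11 H12 H21 H22 Z1 Z2 mass0.
  have fin x : `|mu * x| <= B1 * (C * (d * mu)) + B2 * (C * (d * mu)) -> `|x| <= (B1 + B2) * C * d.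
    rewrite normrM (gtr0_norm mass0) -mulrDl !mulrA -(mulrC mu); by rewrite ler_pM2l.
  split; apply: fin.
    rewrite (_ : mu * _ = (b - mu * I k2 m2) - (a - mu * I k1 m1)); last first.
      by rewrite -[LHS]subr0 -Z1; ring.
    by rewrite (le_trans (ler_normB _ _))// addrC lerD.
  rewrite (_ : mu * _ = - ((c' - mu * I k1 m2) + (a' - mu * I k2 m1))); last first.
    by rewrite -[LHS]subr0 -Z2; ring.
  by rewrite normrN (le_trans (ler_normD _ _))// addrC lerD.
split.
- exact: (integrableB measurableT (int1 _ i1) (int2 _ i2)).
- exact: (integrableD measurableT (int2 _ i1) (int1 _ i2)).
- by rewrite EX; apply: (eq0_small c0) => d /main[].
- by rewrite EY; apply: (eq0_small c0) => d /main[].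
Qed.

End Pullback.

(** * The weak equation for the pulled-back function *)

Section MainPullback.
Context {R : realType}.
Local Notation P := (measurableTypeR R * measurableTypeR R)%type.
Local Notation lam := (@plane_borel R).
Implicit Types (U V : set (Cplx R)) (f g h : Cplx R -> Cplx R).

Lemma measurable_pduality (p : R) U g : open U -> measurable_on U g ->
  measurable_on U (fun z => pduality p (g z)).
Proof.
move=> oU [m1 m2].
have mU : measurable (of_plane @^-1` U : set (plane R)).
  exact: (borel_lebesgue_measurable (open_in_plane oU)).
pose n (w : plane R) := Num.sqrt (re (g (of_plane w)) ^+ 2 + im (g (of_plane w)) ^+ 2) `^ (p - 2).
have mn : measurable_fun (of_plane @^-1` U : set (plane R)) n.
  apply: (measurableT_comp (measurable_powR _)).
  apply: (measurableT_comp (continuous_measurable_fun (@sqrt_continuous R))).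
  by apply: measurable_funD; apply: measurable_funX.
have E w : pduality p (g (of_plane w)) = (n w)%:C * g (of_plane w).
  by rewrite /pduality normc_sqrt.
split.
- rewrite (_ : (fun w => _) = (fun w => n w * re (g (of_plane w)))); first exact: measurable_funM.
  by apply/funext => w; rewrite E reM/= mul0r subr0.
- rewrite (_ : (fun w => _) = (fun w => n w * im (g (of_plane w)))); first exact: measurable_funM.
  by apply/funext => w; rewrite E imM/= mul0r addr0.
Qed.

(** [compact_comparison] applied to the indicator of [N]. It ensures that [h \o f] may be replaced
    by its Borel version almost everywhere on the support of the test function. *)
Lemma preimage_null V f (E : set (Cplx R)) (N : set P) : open V -> holomorphic_on V f ->
  (forall z, V z -> 'D_1 f z != 0) -> bounded_set (f @` V) -> compact E -> E `<=` V ->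
  measurable N -> lam N = 0 ->
  measurable (in_plane E `&` push V f @^-1` N) /\ lam (in_plane E `&` push V f @^-1` N) = 0.
Proof.
move=> oV hf f'0 bf cE EV mN N0.
have mT := measurable_push oV hf; have mE := compact_in_plane cE.
have mTN : measurable (push V f @^-1` N).
  by rewrite -[X in measurable X]setTI; exact: mT.
split; first exact: measurableI.
have [C C0 HC] := compact_comparison oV hf cE EV f'0 bf.
have mF : measurable_fun setT (fun p => (\1_N p)%:E : \bar R).
  by apply/measurable_EFinP; exact: measurable_indic.
have F0 p : (0 <= (\1_N p)%:E :> \bar R)%E by rewrite lee_fin.
have E1 : (\int[lam]_q (\1_N q)%:E = 0)%E.
  by rewrite (integral_indic lam measurableT mN) setIT; exact: N0.
have E2 : (\int[lam]_(q in in_plane E) (\1_N (push V f q))%:E =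
    lam (in_plane E `&` push V f @^-1` N))%E.
  by rewrite setIC; exact: (integral_indic lam mE mTN).
have := HC _ mF F0; rewrite E1 E2 mule0 => H.
by apply/eqP; rewrite eq_le H measure_ge0.
Qed.

(** The exponent has disappeared: the pullback concerns any measurable weak solution [h], integrable
    against the [dbar] of test functions. *)
Lemma holomorphic_pullback U V f h : open U -> bounded_set U -> open V -> measurable_on U h ->
  weak_dbar_solution U h -> (forall z, V z -> U (f z)) -> holomorphic_on V f ->
  (forall z, V z -> 'D_1 f z != 0) ->
  weak_dbar_solution V (fun z => 'D_1 f z * h (f z)).
Proof.
move=> oU bU oV mh wh fU hf f'0 eta te; have [se cS SV] := te.
have cf z : V z -> {for z, continuous f}.
  by move=> Vz; exact: cdiff_continuous (derivable_cdiff (hf z Vz)).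
have cK : compact (f @` Defs.support eta).
  apply: continuous_compact => //; apply: continuous_in_subspaceT => z /set_mem/SV; exact: cf.
have KU : f @` Defs.support eta `<=` U by move=> _ [z /SV Vz <-]; exact: fU.
have bf : bounded_set (f @` V).
  have [B [Br HB]] := bU; exists B; split => // x Bx _ [z Vz <-].
  exact: (HB x Bx _ (fU z Vz)).
have [N [k1 [k2 [W [M [[mN N0] [oW KW _] [mk1 mk2 i1 i2] kM [kE wk]]]]]]] :=
  weak_pair_localize oU bU mh wh cK KU.
have [J1 J2 I1 I2] := pullback_integral oV hf f'0 bf te oW KW mk1 mk2 i1 i2 kM wk.
have [mN' N'0] := preimage_null oV hf f'0 bf cS SV mN N0.
have mV := open_in_plane oV.
pose T := push V f.
pose m1 (p : P) := re (pull_density f eta (p.1 +i* p.2)).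
pose m2 (p : P) := im (pull_density f eta (p.1 +i* p.2)).
have rearr z : 'D_1 f z * h (f z) * dbar eta z = h (f z) * pull_density f eta z.
  by rewrite /pull_density; ring.
have mout p : ~ Defs.support eta (p.1 +i* p.2) -> m1 p = 0 /\ m2 p = 0.
  by move=> /pull_density_out d0; rewrite /m1 /m2 d0.
(* On the support of [eta] this is the agreement of [h] with [k1] and [k2] off [N], taken at [f];
   off the support both sides vanish. *)
have agree p : in_plane V p -> ~ (in_plane (Defs.support eta) `&` T @^-1` N) p ->
    re ('D_1 f (of_plane p) * h (f (of_plane p)) * dbar eta (of_plane p)) =
      k1 (T p) * m1 p - k2 (T p) * m2 p /\
    im ('D_1 f (of_plane p) * h (f (of_plane p)) * dbar eta (of_plane p)) =
      k1 (T p) * m2 p + k2 (T p) * m1 p.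
  move=> Vp nN; rewrite rearr (reM (h _)) (imM (h _)) -/(m1 p) -/(m2 p).
  have [Sp|nS] := pselect (Defs.support eta (p.1 +i* p.2)); last first.
    by have [-> ->] := mout p nS; rewrite !mulr0.
  have Tp := push_complex f Vp; rewrite -/T in Tp.
  have OT : in_plane W (T p) by rewrite /in_plane/= Tp; apply: KW; exists (p.1 +i* p.2).
  have nT : ~ N (T p) by move=> NT; apply: nN.
  by have [-> ->] := kE _ OT nT; rewrite Tp.
have vanish p : ~ in_plane V p ->
    k1 (T p) * m1 p - k2 (T p) * m2 p = 0 /\ k1 (T p) * m2 p + k2 (T p) * m1 p = 0.
  move=> nV; have nS : ~ Defs.support eta (p.1 +i* p.2) by move=> /SV.
  by have [-> ->] := mout p nS; rewrite !mulr0 subr0 addr0.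
have mX : measurable_fun setT (fun p => k1 (T p) * m1 p - k2 (T p) * m2 p).
  by apply/measurable_EFinP; exact: measurable_int J1.
have mY : measurable_fun setT (fun p => k1 (T p) * m2 p + k2 (T p) * m1 p).
  by apply/measurable_EFinP; exact: measurable_int J2.
have [tX1 tX2] := transfer mV mN' N'0 mX (fun p Vp nN => (agree p Vp nN).1) (fun p nV => (vanish p nV).1).
have [tY1 tY2] := transfer mV mN' N'0 mY (fun p Vp nN => (agree p Vp nN).2) (fun p nV => (vanish p nV).2).
split; first by split; [exact: tX1.2 J1|exact: tY1.2 J2].
rewrite /integral_on.
by apply: complex_ext => /=; [rewrite tX2 I1|rewrite tY2 I2].
Qed.

End MainPullback.

Theorem theorem5 (R : realType) (p : R) (U V : set (Cplx R))
    (g f : Cplx R -> Cplx R) :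
  0 < p ->
  bounded_domain U -> bounded_domain V ->
  pCR_weak_solution p U g ->
  (forall z, V z -> U (f z)) ->
  holomorphic_on V f ->
  (forall z, V z -> 'D_1 f z != 0) ->
  weak_dbar_solution V (fun z => 'D_1 f z * pduality p (g (f z))).
Proof.
move=> _ [oU _ _ bU] [oV _ _ _] [[mg _] wg] fU hf f'0.
exact: (holomorphic_pullback oU bU oV (measurable_pduality p oU mg) wg fU hf f'0).
Qed.
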